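(* Let $d \ge 2$ and $r \ge 2$ be integers. Then $N_{\mathrm{pt}}(t,d,r) = rt + \Theta_{d,r}\left(t^{1/2-1/(2d)}\right)$ for positive integers $t$; that is, there exist constants $c_{d,r} > 0$ and $C_{d,r} > 0$, depending only on $d$ and $r$, such that for every positive integer $t$, $$rt + c_{d,r}\, t^{1/2-1/(2d)} \;\le\; N_{\mathrm{pt}}(t,d,r) \;\le\; rt + C_{d,r}\, t^{1/2-1/(2d)}.$$
   Context: For positive integers $t,d,r$, $N_{\mathrm{pt}}(t,d,r)$ denotes the smallest positive integer $N$ such that every set $X$ of $N$ points in $\mathbb{R}^d$ has a partition $X = X_1 \sqcup \cdots \sqcup X_r$ into $r$ parts such that $\bigcap_{j=1}^r \operatorname{conv}(X_j \setminus C) \neq \emptyset$ for every $C \subseteq X$ with at most $t$ points. Here $\operatorname{conv}$ denotes the convex hull (with $\operatorname{conv}(\emptyset)=\emptyset$). *)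

(* Defs.v *)
From mathcomp Require Import all_boot all_order all_algebra.
From mathcomp Require Import boolp classical_sets cardinality reals convex exp.

Set Implicit Arguments.
Unset Strict Implicit.
Unset Printing Implicit Defensive.

Import Order.TTheory GRing.Theory Num.Theory.

Local Open Scope classical_set_scope.
Local Open Scope card_scope.
Local Open Scope ring_scope.

Definition conv_hull (R : realType) (d : nat) (A : set 'rV[R]_d) :
    set 'rV[R]_d :=
  smallest (@convex_set R 'rV[R]_d) A.

(* [partition] asks for nonempty parts; this is no restriction here, since the
   intersection condition at C = set0 already excludes empty parts. *)
Definition tolerant_partition (R : realType) (t d r : nat)
    (X : set 'rV[R]_d) (F : 'I_r -> set 'rV[R]_d) : Prop :=
  partition [set: 'I_r] F X /\
  forall C : set 'rV[R]_d, C `<=` X -> C #<= `I_t ->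
    \bigcap_(j in [set: 'I_r]) conv_hull (F j `\` C) !=set0.

Definition tolerant_Tverberg_number (R : realType) (t d r N : nat) : Prop :=
  forall X : set 'rV[R]_d, X #= `I_N ->
    exists F : 'I_r -> set 'rV[R]_d, tolerant_partition t X F.

(* The default value 0 is taken exactly when no positive N has the property. *)
Definition Npt (R : realType) (t d r : nat) : nat :=
  xget 0%N [set N : nat | [/\ (0 < N)%N, tolerant_Tverberg_number R t d r N &
    forall M : nat, (0 < M)%N -> tolerant_Tverberg_number R t d r M ->
      (N <= M)%N]].

(* Main.v *)
Require Import Defs.
From mathcomp Require Import all_boot all_order all_algebra.
From mathcomp Require Import boolp classical_sets cardinality reals convex exp.
From mathcomp Require Import functions interval_inference sequences.
From mathcomp Require Import topology normedtype derive trigo complex.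
From mathcomp Require Import zify ring lra.

(** The statement is an equivalence between tolerant partitions and the
    discrepancy of halfspaces, combined with the sharp order
    [n `^ (1/2 - 1/(2d))] of that discrepancy.

    Removing [C] destroys the common point of the hulls of the [r] parts exactly
    when affine functions [f_j], nonnegative on [X_j \ C] and with negative sum,
    exist (Farkas' lemma, [common_point_or_separation]).  The open halfspaces
    [f_j < 0] then cover the space, and every point of [X_j] in the [j]-th one lies
    in [C].  If each part contains a fraction [1/r] of every halfspace up to an
    error [E], then [#|C| >= N / r - r E]; hence [N = r t + O(E)] points suffice.
    Conversely, for a halfspace [H] and two parts, removing [X_j] from [H] and
    [X_k] from its complement separates these parts; if [t] removals never suffice,
    then all parts agree on all halfspaces up to [N - r t] ([class_diff]).

    Upper bound on the discrepancy.  Up to complements and perturbation every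
    halfspace lies below a hyperplane, and such halfspaces have VC dimension at
    most [d] ([vc_lower_family]).  For set families of VC dimension at most [d] on
    [n] points a two-colouring of discrepancy [O(n `^ (1/2 - 1/(2d)))] exists
    ([vc_colouring]).  It is built from partial colourings
    ([vc_partial_levels]): every set is a telescoping sum along nets whose sizes
    are controlled by Haussler's packing lemma ([vc_packing], with Chazelle's
    sampling proof), the differences at level [k] are sets of size about
    [n / 4 ^ k], and by pigeonhole two of the [2 ^ n] colourings that differ in a
    constant proportion of the points have nearly equal sums on all the
    differences.  The entropy argument usual at this point is replaced by a Kraft
    inequality: rounded sums get explicit code words, typical colourings have short
    codes, and there are few short codes ([big_code_class]).  Colouring the bits of
    fractional weights one after the other turns two colours into [r]
    ([split_parts]).

    Lower bound on the discrepancy.  The [N] points are taken in the grid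
    [{0, ..., p-1} ^ d] with [p] about [N ^ (1/d)].  For weights [chi] on the grid,
    Parseval's identity modulo [q] gives the mean square of the exponential sums
    [sum_x chi(x) e(v.x / q)] over [v] modulo [q].  For fixed [v] such a sum is,
    by Abel summation, [1 - e(1/q)] times an exponential sum over [s] of the
    halfspace sums [G_v(s)] of [chi] on [v.x <= s].  As [q] varies from [p] to [2 p],
    the frequencies [1/q] are separated by about [1/p^2], and the large sieve bounds
    the total by [O(p^2)] times the largest [G_v(s)^2].  Comparison yields
    [sum_x chi(x)^2 = O(p max G_v(s)^2)] ([grid_discrepancy]), and
    [N / p = N ^ (1 - 1/d)] is the square of the claimed order. *)

Set Implicit Arguments.
Unset Strict Implicit.
Unset Printing Implicit Defensive.

Import Order.TTheory GRing.Theory Num.Theory numFieldNormedType.Exports.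

(** * Weighted families of bit strings *)

(** Sums over the cube of bit strings of length [n] are defined by recursion on
    the first coordinate, because all the bounds below are proved by splitting
    along it. *)
Fixpoint cube_sum n (w : seq bool -> nat) : nat :=
  if n is m.+1 then
    cube_sum m (fun b => w (false :: b)) + cube_sum m (fun b => w (true :: b))
  else w [::].

(** An edge joins two strings that differ in one bit and weighs as much as the
    lighter of its ends. *)
Fixpoint edge_weight n (w : seq bool -> nat) : nat :=
  if n is m.+1 then
    edge_weight m (fun b => w (false :: b)) +
    edge_weight m (fun b => w (true :: b)) +
    cube_sum m (fun b => minn (w (false :: b)) (w (true :: b)))
  else 0.

(** Some [k] coordinates carry all their [2 ^ k] patterns on the support of [w];
    see [shattersP]. The first coordinate is either skipped, which projects the
    support, or used, which keeps the strings that have both extensions. *)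
Fixpoint shatters n k (w : seq bool -> nat) : bool :=
  match n, k with
  | 0, 0 => 0 < w [::]
  | 0, _.+1 => false
  | m.+1, 0 => shatters m 0 (fun b => maxn (w (false :: b)) (w (true :: b)))
  | m.+1, k'.+1 =>
      shatters m k (fun b => maxn (w (false :: b)) (w (true :: b))) ||
      shatters m k' (fun b => minn (w (false :: b)) (w (true :: b)))
  end.

Lemma eq_cube_sum n w w' : (forall b, w b = w' b) ->
  cube_sum n w = cube_sum n w'.
Proof.
elim: n w w' => [|n IH] w w' e /=; first exact: e.
by congr (_ + _); apply: IH => b; apply: e.
Qed.

Lemma eq_edge_weight n w w' : (forall b, w b = w' b) ->
  edge_weight n w = edge_weight n w'.
Proof.
elim: n w w' => [|n IH] w w' e //=.
congr (_ + _ + _); try by apply: IH => b; apply: e.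
by apply: eq_cube_sum => b; rewrite !e.
Qed.

Lemma leq_cube_sum n w w' : (forall b, w b <= w' b) ->
  cube_sum n w <= cube_sum n w'.
Proof.
elim: n w w' => [|n IH] w w' e /=; first exact: e.
by apply: leq_add; apply: IH => b; apply: e.
Qed.

Lemma cube_sumD n w w' :
  cube_sum n (fun b => w b + w' b) = cube_sum n w + cube_sum n w'.
Proof. by elim: n w w' => [|n IH] w w' //=; rewrite !IH addnACA. Qed.

Lemma cube_sumMl n k w : cube_sum n (fun b => k * w b) = k * cube_sum n w.
Proof. by elim: n w => [|n IH] w //=; rewrite !IH mulnDr. Qed.

Lemma edge_weight_le n w : edge_weight n w <= n * cube_sum n w.
Proof.
elim: n w => [|n IH] w //=.
have := IH (fun b => w (false :: b)); have := IH (fun b => w (true :: b)).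
have : cube_sum n (fun b => minn (w (false :: b)) (w (true :: b))) <=
  cube_sum n (fun b => w (false :: b)).
  by apply: leq_cube_sum => b; apply: geq_minl.
nia.
Qed.

Lemma shatters0 n w : shatters n 0 w = (0 < cube_sum n w).
Proof.
elim: n w => [|n IH] w //=; rewrite IH.
have := @leq_cube_sum n (fun b => maxn (w (false :: b)) (w (true :: b)))
  (fun b => w (false :: b) + w (true :: b)).
rewrite cube_sumD => H; apply/idP/idP => h.
  by apply: leq_trans (H _); [|move=> b; lia].
have h1 := @leq_cube_sum n (fun b => w (false :: b))
  (fun b => maxn (w (false :: b)) (w (true :: b))).
have h2 := @leq_cube_sum n (fun b => w (true :: b))
  (fun b => maxn (w (false :: b)) (w (true :: b))).
have {}h1 := h1 (fun b => leq_maxl _ _); have {}h2 := h2 (fun b => leq_maxr _ _).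
lia.
Qed.

(** Compressing the first coordinate replaces the two facets by their pointwise
    maximum and minimum; this preserves the total weight, and the edges inside
    the facets can only gain weight. *)
Lemma edge_weight_max_min n w0 w1 :
  edge_weight n w0 + edge_weight n w1 <=
  edge_weight n (fun b => maxn (w0 b) (w1 b)) +
  edge_weight n (fun b => minn (w0 b) (w1 b)).
Proof.
elim: n w0 w1 => [|n IH] w0 w1 //=.
have h0 := IH (fun b => w0 (false :: b)) (fun b => w1 (false :: b)).
have h1 := IH (fun b => w0 (true :: b)) (fun b => w1 (true :: b)).
suff : cube_sum n (fun b => minn (w0 (false :: b)) (w0 (true :: b))) +
  cube_sum n (fun b => minn (w1 (false :: b)) (w1 (true :: b))) <=
  cube_sum n (fun b => minn (maxn (w0 (false :: b)) (w1 (false :: b)))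
                            (maxn (w0 (true :: b)) (w1 (true :: b)))) +
  cube_sum n (fun b => minn (minn (w0 (false :: b)) (w1 (false :: b)))
                            (minn (w0 (true :: b)) (w1 (true :: b)))) by lia.
by rewrite -!cube_sumD; apply: leq_cube_sum => b; lia.
Qed.

(** Haussler's bound on the edges of the unit distance graph, in weighted form.
    After compression the minimum facet shatters one coordinate less, which pays
    for the edges between the facets. *)
Lemma edge_weight_shatters n d w : ~~ shatters n d.+1 w ->
  edge_weight n w <= d * cube_sum n w.
Proof.
elim: n d w => [|n IH] d w //=; rewrite negb_or => /andP[hM hm].
have hE := edge_weight_max_min n (fun b => w (false :: b)) (fun b => w (true :: b)).
have hM' := IH _ _ hM.
have -> : cube_sum n (fun b => w (false :: b)) + cube_sum n (fun b => w (true :: b))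
  = cube_sum n (fun b => maxn (w (false :: b)) (w (true :: b))) +
    cube_sum n (fun b => minn (w (false :: b)) (w (true :: b))).
  by rewrite -!cube_sumD; apply: eq_cube_sum => b; lia.
case: d hm hM hM' => [|d] hm hM hM'.
  move: hm; rewrite shatters0 -leqNgt leqn0 => /eqP h0.
  have := edge_weight_le n (fun b => minn (w (false :: b)) (w (true :: b))).
  lia.
have := IH _ _ hm; nia.
Qed.

(** Sauer's lemma. The supports of the facets and those of their maximum and
    minimum have the same total size, so the recursion is that of the binomial
    sums, estimated here by a power of [n + 1]. *)
Lemma support_shatters n d w : ~~ shatters n d.+1 w ->
  cube_sum n (fun b => 0 < w b) <= n.+1 ^ d.
Proof.
elim: n d w => [|n IH] d w /=; first by move=> _; rewrite exp1n leq_b1.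
rewrite negb_or => /andP[hM hm].
have hM' := IH _ _ hM.
have -> : cube_sum n (fun b => nat_of_bool (0 < w (false :: b))) +
    cube_sum n (fun b => nat_of_bool (0 < w (true :: b)))
  = cube_sum n (fun b => nat_of_bool (0 < maxn (w (false :: b)) (w (true :: b)))) +
    cube_sum n (fun b => nat_of_bool (0 < minn (w (false :: b)) (w (true :: b)))).
  by rewrite -!cube_sumD; apply: eq_cube_sum => b; lia.
case: d hm hM hM' => [|d] hm hM hM'.
  move: hm; rewrite shatters0 -leqNgt leqn0 => /eqP h0.
  suff -> : cube_sum n (fun b => nat_of_bool (0 < minn (w (false :: b)) (w (true :: b)))) = 0.
    by rewrite addn0.
  apply/eqP; rewrite -leqn0 -h0; apply: leq_cube_sum => b; lia.
have h2 := IH _ _ hm.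
apply: leq_trans (leq_add hM' h2) _.
rewrite !expnS -mulSnr leq_mul2l /=.
by case: d {h2 hm hM hM'} => [|d] //; rewrite leq_exp2r.
Qed.

Lemma shattersP n k w : shatters n k w ->
  exists m : bitseq, [/\ size m = n, count id m = k &
    forall p, size p = k -> exists b, [/\ size b = n, 0 < w b & mask m b = p]].
Proof.
elim: n k w => [|n IH] [|k] w //=.
- move=> w0; exists [::]; split=> // p /eqP; rewrite size_eq0 => /eqP ->.
  by exists [::].
- move=> /IH [m [sm cm H]]; exists (false :: m); split=> /=; rewrite ?sm //.
  move=> p sp; have [b [sb wb mb]] := H p sp.
  move: wb; rewrite leq_max => /orP [] wb; [exists (false :: b)|exists (true :: b)];
    by split=> //=; rewrite sb.
- case/orP => /IH [m [sm cm H]].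
    exists (false :: m); split=> /=; rewrite ?sm //.
    move=> p sp; have [b [sb wb mb]] := H p sp.
    move: wb; rewrite leq_max => /orP [] wb; [exists (false :: b)|exists (true :: b)];
      by split=> //=; rewrite sb.
  exists (true :: m); split=> /=; rewrite ?sm ?cm //.
  case=> [//|x p] /= [sp]; have [b [sb wb mb]] := H p sp.
  exists (x :: b); split=> /=; rewrite ?sb ?mb //.
  by move: wb; rewrite leq_min => /andP[]; case: x.
Qed.

(** * Packing sets in families of bounded VC dimension *)

(** Samples are drawn with repetition, so that the average over samples of size
    [s.+1] splits into an average over the first point and one over the rest. *)
Fixpoint sample_sum (T : finType) s (f : seq T -> nat) : nat :=
  if s is s'.+1 then \sum_(x : T) sample_sum s' (fun xs => f (x :: xs))
  else f [::].

Section Packing.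
Variable T : finType.
Implicit Types (P Q : {set {set T}}) (A B : {set T}) (xs ys : seq T).

Definition trace xs A : bitseq := [seq x \in A | x <- xs].

(** VC dimension at most [d]. A list with a repeated point never has all its
    traces realised, so lists may stand for sets. *)
Definition vc_le d P := forall ys, size ys = d.+1 ->
  exists2 p : bitseq, size p = d.+1 & forall A, A \in P -> trace ys A != p.

Definition trace_count P xs (b : bitseq) := #|[set A in P | trace xs A == b]|.

Lemma trace_count_cons P x xs c b :
  trace_count P (x :: xs) (c :: b) =
  trace_count [set A in P | (x \in A) == c] xs b.
Proof.
by apply: eq_card => A; rewrite !inE /= eqseq_cons andbA.
Qed.

Lemma sum_trace_count P xs : cube_sum (size xs) (trace_count P xs) = #|P|.
Proof.
elim: xs P => [|x xs IH] P /=.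
  by rewrite /trace_count; apply: eq_card => A; rewrite !inE andbT.
rewrite (eq_cube_sum _ (trace_count_cons P x xs false)).
rewrite (eq_cube_sum _ (trace_count_cons P x xs true)) !IH.
rewrite -(cardsID [set A in P | x \in A] P) addnC; congr (_ + _); apply: eq_card => A; rewrite !inE; case: (A \in P); case: (x \in A) => //.
Qed.

Lemma eq_sample_sum s (f g : seq T -> nat) : (forall xs, size xs = s -> f xs = g xs) ->
  sample_sum s f = sample_sum s g.
Proof.
elim: s f g => [|s IH] f g e /=; first exact: e.
by apply: eq_bigr => x _; apply: IH => xs sx; apply: e; rewrite /= sx.
Qed.

Lemma leq_sample_sum s (f g : seq T -> nat) : (forall xs, size xs = s -> f xs <= g xs) ->
  sample_sum s f <= sample_sum s g.
Proof.
elim: s f g => [|s IH] f g e /=; first exact: e.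
by apply: leq_sum => x _; apply: IH => xs sx; apply: e; rewrite /= sx.
Qed.

Lemma sample_sumD s (f g : seq T -> nat) :
  sample_sum s (fun xs => f xs + g xs) = sample_sum s f + sample_sum s g.
Proof.
elim: s f g => [|s IH] f g //=.
by rewrite -big_split; apply: eq_bigr => x _; rewrite IH.
Qed.

Lemma sample_sumMl s k (f : seq T -> nat) :
  sample_sum s (fun xs => k * f xs) = k * sample_sum s f.
Proof.
elim: s f => [|s IH] f //=.
by rewrite big_distrr; apply: eq_bigr => x _; rewrite IH.
Qed.

Lemma sample_sum_sum s (I : finType) (f : I -> seq T -> nat) :
  sample_sum s (fun xs => \sum_i f i xs) = \sum_i sample_sum s (f i).
Proof.
elim: s f => [|s IH] f //=.
by rewrite exchange_big /=; apply: eq_bigr => x _; rewrite IH.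
Qed.

Lemma sample_sum_const s k : sample_sum s (fun _ : seq T => k) = #|T| ^ s * k.
Proof.
elim: s => [|s IH] /=; first by rewrite expn0 mul1n.
by rewrite IH sum_nat_const expnS mulnA.
Qed.

Lemma cube_sum_sum n (I : finType) (f : I -> bitseq -> nat) :
  cube_sum n (fun b => \sum_i f i b) = \sum_i cube_sum n (f i).
Proof.
elim: n f => [|n IH] f //=.
by rewrite !IH -big_split.
Qed.

Definition symdiff A B := (A :\: B) :|: (B :\: A).

(** Distinct members differ in at least a proportion [1 / L] of the points. *)
Definition far_apart L P := forall A B, A \in P -> B \in P -> A != B ->
  #|T| <= L * #|symdiff A B|.

Lemma far_apartS L P Q : Q \subset P -> far_apart L P -> far_apart L Q.
Proof. by move=> /fintype.subsetP QP sP A B /QP AP /QP BP; apply: sP. Qed.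

(** Both sides count the triples of two members of [P] and a point on which they
    disagree. *)
Lemma sum_split_pairs P : 2 * (\sum_x #|[set A in P | (x \in A) == false]| *
    #|[set A in P | (x \in A) == true]|) = \sum_(A in P) \sum_(B in P) #|symdiff A B|.
Proof.
have -> : \sum_(A in P) \sum_(B in P) #|symdiff A B| =
  \sum_(A in P) \sum_(B in P) \sum_x
    (((x \notin A) * (x \in B)) + ((x \in A) * (x \notin B))).
  apply: eq_bigr => A _; apply: eq_bigr => B _.
  rewrite -sum1_card big_mkcond; apply: eq_bigr => x _; rewrite !inE.
  by case: (x \in A); case: (x \in B).
have E (b c : bool) x : \sum_(A in P) \sum_(B in P) (((x \in A) == b) * ((x \in B) == c) : nat)
   = #|[set A in P | (x \in A) == b]| * #|[set A in P | (x \in A) == c]|.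
  rewrite -!sum1_card big_distrl /= [RHS]big_mkcond [LHS]big_mkcond.
  apply: eq_bigr => A _; rewrite !inE; case: (A \in P) => //=.
  case: eqP => _ /=; last by rewrite big1.
  rewrite mul1n [RHS]big_mkcond [LHS]big_mkcond; apply: eq_bigr => B _.
  by rewrite !inE mul1n; case: (B \in P) => //=; case: eqP.
under [RHS]eq_bigr => A _ do rewrite exchange_big /=.
rewrite [RHS]exchange_big big_distrr /=; apply: eq_bigr => x _.
transitivity (\sum_(A in P) \sum_(B in P) (((x \in A) == false) * ((x \in B) == true) : nat)
  + \sum_(A in P) \sum_(B in P) (((x \in A) == true) * ((x \in B) == false) : nat)).
  by rewrite !E mul2n -addnn [X in _ + X = _]mulnC.
rewrite -big_split; apply: eq_bigr => A _; rewrite -big_split; apply: eq_bigr => B _ /=.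
by case: (x \in A); case: (x \in B).
Qed.

(** A random point splits a family whose members are far apart: the smaller half
    has in expectation at least [(#|P| - 1) / (2 L)] members, since [min a b >=
    a b / (a + b)]. *)
Lemma expected_split L P : far_apart L P ->
  #|T| * #|P| <= #|T| * (0 < #|P|) +
  2 * L * \sum_x minn #|[set A in P | (x \in A) == false]|
                  #|[set A in P | (x \in A) == true]|.
Proof.
move=> sP; case: (posnP #|P|) => [->|P0]; first by rewrite muln0.
rewrite -(leq_pmul2l P0) muln1.
suff H : #|T| * (#|P| * #|P|.-1) <= #|P| * (2 * L * \sum_x minn #|[set A in P | (x \in A) == false]|
                  #|[set A in P | (x \in A) == true]|).
  move: H; set X := 2 * L * _; move: X => X.
  by case: #|P| P0 => // m _ /= H; rewrite !mulnDr; nia.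
apply: (@leq_trans (L * \sum_(A in P) \sum_(B in P) #|symdiff A B|)).
  have -> : #|T| * (#|P| * #|P|.-1) = \sum_(A in P) \sum_(B in P | B != A) #|T|.
    rewrite mulnC -mulnA -sum_nat_const; apply: eq_bigr => A AP.
    rewrite sum_nat_const; congr (_ * _).
    rewrite [in LHS](cardsD1 A P) AP /= -[RHS]/(#|_|).
    by apply: eq_card => B; rewrite !inE andbC.
  rewrite big_distrr /=; apply: leq_sum => A AP.
  rewrite big_distrr /= [X in _ <= X](bigID (fun B => B == A)) /=.
  apply: leq_trans (leq_addl _ _); apply: leq_sum => B /andP[BP BA].
  by apply: sP; rewrite // eq_sym.
rewrite -sum_split_pairs.
suff h : \sum_x #|[set A in P | (x \in A) == false]| * #|[set A in P | (x \in A) == true]|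
  <= #|P| * \sum_x minn #|[set A in P | (x \in A) == false]|
                  #|[set A in P | (x \in A) == true]|.
  by have := leq_mul (leqnn (2 * L)) h; lia.
rewrite big_distrr /=; apply: leq_sum => x _.
have h0 : #|[set A in P | (x \in A) == false]| <= #|P| by apply: subset_leq_card; apply/fintype.subsetP => A; rewrite inE => /andP[].
have h1 : #|[set A in P | (x \in A) == true]| <= #|P| by apply: subset_leq_card; apply/fintype.subsetP => A; rewrite inE => /andP[].
move: h0 h1; move: #|_| #|_| #|_| => a b c h0 h1; rewrite /minn; case: ltnP => _.
  by rewrite mulnC leq_mul2r h1 orbT.
by rewrite leq_mul2r h0 orbT.
Qed.

(** Chazelle's averaging step. Each coordinate of the sample splits the classes
    of equal trace on the other coordinates, and by [expected_split] the edges
    it creates have expected weight at least [(#|P| - number of classes) / (2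
    L)]. *)
Lemma sampled_edges L s P : far_apart L P ->
  s * (#|T| ^ s * #|P|) <=
  s * sample_sum s (fun xs => cube_sum s (fun b => 0 < trace_count P xs b)) +
  2 * L * sample_sum s (fun xs => edge_weight s (trace_count P xs)).
Proof.
elim: s P => [|s IH] P sP //.
pose Px c x := [set A in P | (x \in A) == c].
have sPx c x : far_apart L (Px c x).
  by apply: far_apartS sP; apply/fintype.subsetP => A; rewrite inE => /andP[].
have cPx x : #|Px false x| + #|Px true x| = #|P|.
  rewrite -(cardsID [set A in P | x \in A] P) addnC; congr (_ + _); apply: eq_card => A; rewrite !inE; case: (A \in P); case: (x \in A) => //.
pose Sx (c : bool) x := sample_sum s (fun xs => cube_sum s (fun b => 0 < trace_count (Px c x) xs b)).
pose Ex (c : bool) x := sample_sum s (fun xs => edge_weight s (trace_count (Px c x) xs)).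
pose Mx x := sample_sum s (fun xs => cube_sum s (fun b =>
  minn (trace_count (Px false x) xs b) (trace_count (Px true x) xs b))).
pose S := sample_sum s (fun xs => cube_sum s (fun b => 0 < trace_count P xs b)).
have -> : sample_sum s.+1 (fun xs => cube_sum s.+1 (fun b => 0 < trace_count P xs b))
   = \sum_x (Sx false x + Sx true x).
  apply: eq_bigr => x _; rewrite -sample_sumD; apply: eq_sample_sum => xs _ /=.
  by congr (_ + _); apply: eq_cube_sum => b; rewrite trace_count_cons.
have -> : sample_sum s.+1 (fun xs => edge_weight s.+1 (trace_count P xs))
   = \sum_x (Ex false x + Ex true x + Mx x).
  apply: eq_bigr => x _; rewrite -!sample_sumD; apply: eq_sample_sum => xs _ /=.
  congr (_ + _ + _); try by apply: eq_edge_weight => b; rewrite trace_count_cons.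
  by apply: eq_cube_sum => b; rewrite !trace_count_cons.
have h1 : s * (#|T| ^ s.+1 * #|P|) <= s * (\sum_x (Sx false x + Sx true x)) +
    2 * L * \sum_x (Ex false x + Ex true x).
  rewrite expnS -mulnA mulnCA -sum_nat_const !big_distrr -big_split /=.
  apply: leq_sum => x _; rewrite -(cPx x).
  have := IH _ (sPx false x); have := IH _ (sPx true x).
  rewrite -/(Sx false x) -/(Sx true x) -/(Ex false x) -/(Ex true x).
  move: (Sx false x) (Sx true x) (Ex false x) (Ex true x) (#|T| ^ s) #|_| #|_|; nia.
have h2 : #|T| ^ s.+1 * #|P| <= #|T| * S + 2 * L * \sum_x Mx x.
  rewrite /S /Mx -sample_sum_sum -!sample_sumMl -sample_sumD expnSr -mulnA -sample_sum_const.
  apply: leq_sample_sum => xs sx.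
  rewrite -{1}(sum_trace_count P xs) sx -cube_sum_sum -!cube_sumMl -cube_sumD.
  apply: leq_cube_sum => b.
  have sQ : far_apart L [set A in P | trace xs A == b].
    by apply: far_apartS sP; apply/fintype.subsetP => A; rewrite inE => /andP[].
  apply: leq_trans (expected_split sQ) _.
  rewrite leq_add2l leq_mul2l; apply/orP; right; apply: leq_sum => x _.
  have e c : #|[set A in [set A0 in P | trace xs A0 == b] | (x \in A) == c]| =
      trace_count (Px c x) xs b.
    by apply: eq_card => A; rewrite !inE -!andbA [(_ == b) && _]andbC.
  by rewrite !e.
have h3 : #|T| * S <= \sum_x (Sx false x + Sx true x).
  rewrite -sum_nat_const; apply: leq_sum => x _.
  rewrite -sample_sumD; apply: leq_sample_sum => xs _; rewrite -cube_sumD.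
  apply: leq_cube_sum => b.
  have : trace_count P xs b <= trace_count (Px false x) xs b + trace_count (Px true x) xs b.
    rewrite -cardsUI; apply: leq_trans (leq_addr _ _); apply: subset_leq_card.
    by apply/fintype.subsetP => A; rewrite !inE; case: (A \in P); case: (x \in A); case: (_ == b).
  lia.
have -> : \sum_x (Ex false x + Ex true x + Mx x) =
  \sum_x (Ex false x + Ex true x) + \sum_x Mx x by rewrite -big_split.
move: h1 h2 h3; move: (\sum_x (Ex false x + Ex true x)) (\sum_x Mx x).
move: (\sum_x (Sx false x + Sx true x)) (#|T| ^ s.+1 * #|P|) (#|T| * S) => a p t e m.
nia.
Qed.

Lemma vc_le_shatters d P xs : vc_le d P ->
  ~~ shatters (size xs) d.+1 (trace_count P xs).
Proof.
move=> vP; apply/negP => /shattersP [m [sm cm H]].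
have sy : size (mask m xs) = d.+1 by rewrite size_mask.
have [p sp Hp] := vP _ sy; have [b [sb wb mb]] := H p sp.
have [A] : exists A, A \in [set A in P | trace xs A == b] by apply/card_gt0P.
rewrite inE => /andP[AP /eqP tA]; have := Hp A AP.
by rewrite /trace map_mask -/(trace xs A) tA mb eqxx.
Qed.

(** Haussler's packing lemma. With [s = 4 L d] sample points, the upper bound [d
    #|P|] for the weight of the edges ([edge_weight_shatters]) contradicts
    [sampled_edges] unless half of [#|P|] is bounded by the number of traces on
    the sample. *)
Lemma vc_packing d L P : 0 < d -> 0 < L -> 0 < #|T| -> vc_le d P ->
  far_apart L P -> #|P| <= 2 * (4 * L * d).+1 ^ d.
Proof.
move=> d0 L0 T0 vP sP; pose s := 4 * L * d.
have := sampled_edges s sP.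
have hS : sample_sum s (fun xs => cube_sum s (fun b => 0 < trace_count P xs b))
   <= #|T| ^ s * s.+1 ^ d.
  rewrite -sample_sum_const; apply: leq_sample_sum => xs sx.
  by rewrite -sx; apply: support_shatters; apply: vc_le_shatters.
have hE : sample_sum s (fun xs => edge_weight s (trace_count P xs))
   <= #|T| ^ s * (d * #|P|).
  rewrite -sample_sum_const; apply: leq_sample_sum => xs sx.
  rewrite -(sum_trace_count P xs) -sx; apply: edge_weight_shatters.
  exact: vc_le_shatters.
move=> h.
have {}h : s * (#|T| ^ s * #|P|) <= s * (#|T| ^ s * s.+1 ^ d) + 2 * L * (#|T| ^ s * (d * #|P|)).
  apply: leq_trans h _; apply: leq_add; rewrite leq_mul2l; apply/orP; by right.
have {h} : (#|T| ^ s) * (s * #|P|) <= (#|T| ^ s) * (s * s.+1 ^ d + 2 * L * (d * #|P|)) by lia.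
rewrite leq_pmul2l ?expn_gt0 ?T0 // -/s => h.
have : (L * d) * #|P| <= (L * d) * (2 * s.+1 ^ d) by move: h; rewrite {1 2}/s; lia.
by rewrite leq_pmul2l // muln_gt0 L0.
Qed.

End Packing.

Local Open Scope ring_scope.

(** * Random signs *)

Section RandomSigns.
Variables (R : realType) (T : finType).
Implicit Types (chi : {ffun T -> bool}) (f : T -> int).

Definition sgb (b : bool) : int := if b then 1 else -1.

Definition dot f chi : int := \sum_x sgb (chi x) * f x.

Lemma bernoulli (x : R) n : -1 <= x -> 1 + n%:R * x <= (1 + x) ^+ n.
Proof.
move=> x1; elim: n => [|n IH]; first by rewrite mul0r addr0 expr0.
rewrite exprS; have x0 : 0 <= 1 + x by lra.
apply: le_trans (ler_wpM2l x0 IH).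
have : 0 <= n%:R * x ^+ 2 :> R by rewrite mulr_ge0 // sqr_ge0.
rewrite -natr1; set m := n%:R; nra.
Qed.

(** The moment generating function of a random signed sum, at the rational base
    [1 + 1/q], so that only integral powers occur. A sign contributes a factor
    [1 + 1 / (2 q (q + 1))] at most, and there are at most [q ^ 2] of them. *)
Lemma sum_exp_dot f q : (0 < q)%N -> (forall x, `|f x| <= 1) ->
  (#|[set x | f x != 0]| <= q ^ 2)%N ->
  \sum_chi ((1 + q%:R^-1 : R) ^ dot f chi) <= 2 ^+ #|T| * 2.
Proof.
move=> q0 f1 sf; set b : R := 1 + q%:R^-1.
have q0' : 0 < q%:R :> R by rewrite ltr0n.
have qi : 0 < q%:R^-1 :> R by rewrite invr_gt0.
have qi1 : q%:R^-1 <= 1 :> R by rewrite invf_le1 ?ler1n.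
have b0 : b != 0 by apply: lt0r_neq0; rewrite /b; lra.
(* [1 + y] bounds the mean of a factor; [(1 + y) ^+ (q ^ 2) <= 2] follows
   from Bernoulli's inequality for [1 - y]. *)
pose y : R := (q%:R^-1) ^+ 2 / 2.
have y0 : 0 <= y by rewrite /y divr_ge0 // sqr_ge0.
have y1 : y < 1.
  rewrite /y ltr_pdivrMr // mul1r.
  have : q%:R^-1 ^+ 2 <= 1 :> R by rewrite expr_le1 // ltW.
  lra.
have -> : \sum_chi (b ^ dot f chi) = \prod_x \sum_(c : bool) b ^ (sgb c * f x).
  rewrite (bigA_distr_bigA (fun x c => b ^ (sgb c * f x))); apply: eq_bigr => chi _.
  rewrite /dot (big_morph (fun z : int => b ^ z) (id1 := 1) (op1 := *%R)) //.
  by move=> i j; rewrite expfzDr.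
have H x : \sum_(c : bool) b ^ (sgb c * f x) <= 2 * (1 + y) ^+ (f x != 0).
  rewrite big_bool /= mul1r mulN1r.
  case: (eqVneq (f x) 0) => [->|fx] /=.
    by rewrite oppr0 !expr0z expr0; lra.
  have E : b + b^-1 <= 2 * (1 + y).
    have -> : b^-1 = q%:R / (q%:R + 1).
      rewrite /b; field; apply/andP; split; apply: lt0r_neq0 => //; lra.
    have -> : b + q%:R / (q%:R + 1) = 2 + q%:R^-1 * (q%:R + 1)^-1.
      rewrite /b; field; apply/andP; split; apply: lt0r_neq0 => //; lra.
    rewrite /y.
    have : (q%:R + 1)^-1 <= q%:R^-1 :> R by rewrite lef_pV2 ?posrE //; lra.
    move=> h; have := ler_wpM2l (ltW qi) h; rewrite -expr2; lra.
  have : f x = 1 \/ f x = -1 by have := f1 x; move: fx; case: (f x) => -[|[|?]] //=; [left|right].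
  by case=> ->; rewrite ?opprK expr1z ?exprN1 expr1 // addrC.
apply: le_trans (_ : \prod_x (2 * (1 + y) ^+ (f x != 0)) <= _).
  apply: ler_prod => x _; rewrite H andbT sumr_ge0 // => c _.
  by apply: exprz_ge0; rewrite /b; lra.
rewrite big_split /= prodr_const prodrXr ler_pM2l ?exprn_gt0 //.
have {sf} : (\sum_x (f x != 0%R) <= q ^ 2)%N.
  by move: sf; rewrite -sum1_card big_mkcond /=; under eq_bigr => x _ do rewrite inE.
move: (\sum_x _)%N => s sf.
apply: le_trans (_ : (1 + y) ^+ (q ^ 2) <= _); first by apply: ler_weXn2l; [lra|].
have y1' : 0 < (1 - y) ^+ (q ^ 2) by rewrite exprn_gt0 // subr_gt0.
rewrite -(ler_pM2r y1') -exprMn.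
apply: le_trans (_ : 1 <= _).
  have -> : (1 + y) * (1 - y) = 1 - y ^+ 2 by ring.
  by rewrite exprn_ile1 //; have := sqr_ge0 y; nra.
have := @bernoulli (- y) (q ^ 2).
have -> : 1 + (q ^ 2)%:R * - y = 1 / 2.
  by rewrite /y natrX; field; apply: lt0r_neq0.
move=> /(_ ltac:(lra)); lra.
Qed.

Lemma dot_tail_pos f q a : (0 < q)%N -> (forall x, `|f x| <= 1) ->
  (#|[set x | f x != 0]| <= q ^ 2)%N ->
  #|[set chi | (a * q)%N%:Z <= dot f chi]|%:R * 2 ^+ a <= 2 ^+ #|T| * 2 :> R.
Proof.
move=> q0 f1 sf; apply: le_trans (sum_exp_dot q0 f1 sf).
have q0' : 0 < q%:R :> R by rewrite ltr0n.
have qi : 0 < q%:R^-1 :> R by rewrite invr_gt0.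
rewrite -sum1_card natr_sum mulr_suml big_mkcond; apply: ler_sum => chi _.
rewrite inE; case: ifP => [h|_]; last by apply: exprz_ge0; lra.
rewrite mul1r; apply: le_trans (_ : (1 + q%:R^-1) ^+ (a * q) <= _).
  have b0 : 0 <= (1 + q%:R^-1) ^+ q :> R by apply: exprn_ge0; lra.
  rewrite mulnC exprM lerXn2r ?nnegrE //.
  have := @bernoulli (q%:R^-1) q; rewrite divff ?lt0r_neq0 // => h1.
  by apply: le_trans (h1 _); lra.
rewrite exprnP; apply: ler_weXz2l => //; lra.
Qed.

(** Signed sums of at most [q ^ 2] terms exceed [a q] with probability
    exponentially small in [a]; a subexponential tail is enough for the chaining
    below. *)
Lemma dot_tail f q a : (0 < q)%N -> (forall x, `|f x| <= 1) ->
  (#|[set x | f x != 0]| <= q ^ 2)%N ->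
  #|[set chi | (a * q <= `|dot f chi|)%N]|%:R * 2 ^+ a <= 4 * 2 ^+ #|T| :> R.
Proof.
move=> q0 f1 sf.
have h1 := dot_tail_pos a q0 f1 sf.
have h2 : #|[set chi | (a * q)%N%:Z <= dot (fun x => - f x) chi]|%:R * 2 ^+ a <= 2 ^+ #|T| * 2 :> R.
  apply: dot_tail_pos => //; first by move=> x; rewrite normrN.
  apply: leq_trans sf; apply: subset_leq_card; apply/fintype.subsetP => x.
  by rewrite !inE oppr_eq0.
have {}h2 : #|[set chi | (a * q)%N%:Z <= - dot f chi]|%:R * 2 ^+ a <= 2 ^+ #|T| * 2 :> R.
  apply: le_trans h2; rewrite ler_pM2r ?exprn_gt0 // ler_nat.
  apply: subset_leq_card; apply/fintype.subsetP => chi; rewrite !inE.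
  by rewrite /dot -sumrN; under eq_bigr => x _ do rewrite -mulrN.
have : #|[set chi | (a * q <= `|dot f chi|)%N]|%:R <=
  #|[set chi | (a * q)%N%:Z <= dot f chi]|%:R + #|[set chi | (a * q)%N%:Z <= - dot f chi]|%:R :> R.
  rewrite -natrD ler_nat -cardsUI; apply: leq_trans (leq_addr _ _).
  apply: subset_leq_card; apply/fintype.subsetP => chi; rewrite !inE; lia.
have : 0 < 2 ^+ a :> R by rewrite exprn_gt0.
set A := #|_|%:R; set B := #|_|%:R; set D := #|_|%:R; nra.
Qed.

Lemma dot_le f chi : (forall x, `|f x| <= 1) -> (`|dot f chi| <= #|T|)%N.
Proof.
move=> f1; rewrite -lez_nat abszE /dot; apply: le_trans (ler_norm_sum _ _ _) _.
rewrite -[#|T|%:Z]natz -sum1_card natr_sum; apply: ler_sum => x _; rewrite normrM.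
by apply: le_trans (f1 x); rewrite /sgb; case: (chi x); rewrite ?normrN normr1 mul1r.
Qed.

Lemma geo_sum (x : R) n : 0 <= x -> x <= 1 / 2 -> \sum_(1 <= a < n.+1) x ^+ a <= 2 * x.
Proof.
move=> x0 x1; suff H : \sum_(1 <= a < n.+1) x ^+ a <= 2 * x - 2 * x ^+ n.+1.
  by apply: le_trans H _; have := exprn_ge0 n.+1 x0; lra.
elim: n => [|n IH]; first by rewrite big_geq // expr1; lra.
rewrite big_nat_recr //= (exprS x n.+1).
have := exprn_ge0 n.+1 x0; move: IH; set s := \sum_(_ <= _ < _) _; set p := x ^+ n.+1; nra.
Qed.

Lemma sum_quotient f q l : (0 < q)%N -> (0 < l)%N -> (forall x, `|f x| <= 1) ->
  (#|[set x | f x != 0]| <= q ^ 2)%N ->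
  (\sum_chi (`|dot f chi| %/ (l * q))%N)%:R <= 8 * 2 ^- l * 2 ^+ #|T| :> R.
Proof.
move=> q0 l0 f1 sf.
have -> : (\sum_chi (`|dot f chi| %/ (l * q)) =
  \sum_(1 <= a < #|T|.+1) #|[set chi | (a * l * q <= `|dot f chi|)%N]|)%N.
  under [RHS]eq_bigr => a _ do rewrite -sum1_card big_mkcond /=.
  rewrite exchange_big; apply: eq_bigr => chi _ /=.
  under eq_bigr => a _ do rewrite inE -mulnA -leq_divRL ?muln_gt0 ?l0 //.
  have : (`|dot f chi| %/ (l * q) <= #|T|)%N.
    by apply: leq_trans (leq_div _ _) (dot_le _ f1).
  move: (_ %/ _)%N #|T| => c n cn.
  rewrite -big_mkcond /= (big_cat_nat (n := c.+1)) //= [X in (_ = _ + X)%N]big_nat_cond.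
  rewrite [X in (_ = _ + X)%N]big1 ?addn0; last by move=> i /andP[]; lia.
  rewrite big_nat_cond (eq_bigl (fun i => (1 <= i < c.+1)%N)); last by move=> i /=; lia.
  by rewrite -big_nat sum_nat_const_nat; lia.
rewrite natr_sum; apply: le_trans (_ : \sum_(1 <= a < #|T|.+1) 4 * 2 ^+ #|T| * (2 ^- l) ^+ a <= _).
  apply: ler_sum => a _; have := dot_tail (a * l) q0 f1 sf.
  rewrite -ler_pdivlMr ?exprn_gt0 // => h; apply: le_trans h _.
  by rewrite -exprVn -exprM mulnC -exprVn.
rewrite -big_distrr /=.
have h0 : 0 <= 2 ^- l :> R by rewrite invr_ge0 exprn_ge0.
have h1 : 2 ^- l <= 1 / 2 :> R.
  case: l l0 {h0} => // l _; rewrite exprS invfM div1r ler_piMr ?invr_ge0 //.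
  by rewrite invf_le1 ?exprn_gt0 // exprn_ege1 // ler1n.
have := geo_sum #|T| h0 h1; have : 0 < 2 ^+ #|T| :> R by rewrite exprn_gt0.
set s := \sum_(_ <= _ < _) _; nra.
Qed.

End RandomSigns.

(** * Partial colouring by pigeonhole *)

Section Kraft.
Variables (R : realType) (X I K : finType).

(** Kraft's inequality in place of entropy. At least half of the points have
    total code length at most [2 E] by Markov's inequality, and the classes with
    such codes number at most [2 ^ (2 E + M)], because each has weight at least
    [2 ^ - (2 E)] in a product of total mass at most [2 ^ M]. *)
Lemma big_code_class (x0 : X) (b : I -> X -> K) (len : I -> K -> nat) E M :
  (\sum_x \sum_i len i (b i x) <= E * #|X|)%N ->
  \prod_i \sum_k (2 ^- len i k) <= 2 ^+ M :> R ->
  exists kap : {ffun I -> K},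
    #|X|%:R <= 2 ^+ (1 + 2 * E + M) * #|[set x | [forall i, b i x == kap i]]|%:R :> R.
Proof.
move=> hE hM; pose cls (kap : {ffun I -> K}) := [set x | [forall i, b i x == kap i]].
pose code x := [ffun i => b i x].
case: (arg_maxnP (fun kap => #|cls kap|) (isT : xpredT (code x0))) => kap _ hmax.
exists kap; rewrite -/(cls kap).
pose L x := (\sum_i len i (b i x))%N.
have hG : (#|X| <= 2 * #|[set x | L x <= 2 * E]|)%N.
  rewrite -(cardC (mem [set x | L x <= 2 * E]%N)).
  have : ((2 * E).+1 * #|[predC (mem [set x | L x <= 2 * E]%N)]| <= E * #|X|)%N.
    apply: leq_trans hE; rewrite mulnC -sum_nat_const [X in (_ <= X)%N](bigID (fun x => x \in [set x | L x <= 2 * E]%N)) /=.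
    apply: leq_trans (leq_addl _ _); apply: leq_sum => x.
    by rewrite !inE -ltnNge.
  rewrite -(cardC (mem [set x | L x <= 2 * E]%N)).
  set a := #|_|; set c := #|_|; nia.
have hS : #|[set x | L x <= 2 * E]%N|%:R <= 2 ^+ (2 * E) * 2 ^+ M * #|cls kap|%:R :> R.
  rewrite (bigA_distr_bigA (fun i k => 2 ^- len i k)) in hM.
  apply: le_trans (_ : \sum_(k : {ffun I -> K}) #|cls kap|%:R * 2 ^+ (2 * E) * \prod_i 2 ^- len i (k i) <= _); last first.
    rewrite -big_distrr /= [X in _ <= X]mulrC mulrA ler_wpM2l // mulr_ge0 // exprn_ge0 //.
  rewrite -sum1_card (partition_big code xpredT) //= natr_sum; apply: ler_sum => k _.
  rewrite sum1dep_card.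
  case: (posnP #|[set x in [set x | L x <= 2 * E]%N | code x == k]|) => [->|].
    by rewrite !mulr_ge0 ?exprn_ge0 // prodr_ge0 // => i _; rewrite invr_ge0 exprn_ge0.
  case/card_gt0P => x; rewrite !inE => /andP[Lx /eqP kx].
  have -> : \prod_i 2 ^- len i (k i) = 2 ^- L x :> R.
    rewrite /L -exprVn -prodrXr; apply: eq_bigr => i _.
    by rewrite -exprVn -kx ffunE.
  rewrite -mulrA; apply: le_trans (_ : #|cls kap|%:R * 1 <= _).
    rewrite mulr1 ler_nat; apply: leq_trans (hmax k isT).
    apply: subset_leq_card; apply/fintype.subsetP => y; rewrite !inE => /andP[_ /eqP ky].
    by apply/forallP => i; rewrite -ky ffunE.
  rewrite ler_wpM2l // ler_pdivlMr ?exprn_gt0 // mul1r.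
  by rewrite ler_weXn2l // ler1n.
rewrite [_ ^+ (_ + M)]exprD [_ ^+ (1 + _)]exprD expr1 -2!mulrA; apply: le_trans (_ : 2 * #|[set x | L x <= 2 * E]%N|%:R <= _).
  by rewrite -natrM ler_nat.
by rewrite ler_pM2l // mulrA.
Qed.

End Kraft.

Lemma ball_numerics (R : realFieldType) e r n : (8 * r <= n)%N -> (3 * e <= n)%N ->
  (0 < n)%N -> 2 ^+ e * (4 ^+ r * (5 / 4) ^+ n) < 2 ^+ n :> R.
Proof.
move=> hr he n0.
have c0 : 0 <= 5 / 4 :> R by lra.
rewrite -(@ltr_pXn2r _ 12) // ?nnegrE ?mulr_ge0 ?exprn_ge0 //.
rewrite (_ : (2 ^+ e * (4 ^+ r * (5 / 4) ^+ n)) ^+ 12 =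
    2 ^+ (12 * e + 24 * r) * ((5 / 4) ^+ 12) ^+ n :> R); last first.
  rewrite exprD [X in _ = _ * X]exprAC !exprMn (_ : 4 = 2 ^+ 2 :> R); last by ring.
  by rewrite -!exprM mulrA; congr (2 ^+ _ * 2 ^+ _ * _); lia.
apply: le_lt_trans (_ : 2 ^+ (7 * n) * ((5 / 4) ^+ 12) ^+ n < _).
  rewrite ler_pM2r ?exprn_gt0 ?divr_gt0 //.
  by rewrite ler_weXn2l // ?ler1n //; lia.
rewrite exprM -exprMn -exprM mulnC exprM.
rewrite ltr_pXn2r ?nnegrE ?mulr_ge0 ?exprn_ge0 ?invr_ge0 //.
by rewrite !(exprSr _ 11, exprSr _ 10, exprSr _ 9, exprSr _ 8, exprSr _ 7, exprSr _ 6, exprSr _ 5, exprSr _ 4, exprSr _ 3, exprSr _ 2, exprSr _ 1); lra.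
Qed.

Section PartialColouring.
Variables (R : realType) (T : finType).
Implicit Types (chi : {ffun T -> bool}) (f : T -> int).

Definition hdist chi chi' := #|[set x | chi x != chi' x]|.

(** The bound is the generating function of the Hamming distance at [1 / 4],
    divided by the least weight in the ball. *)
Lemma ball_card chi r :
  #|[set chi' | (hdist chi chi' <= r)%N]|%:R <= 4 ^+ r * (5 / 4) ^+ #|T| :> R.
Proof.
have : \sum_(chi' : {ffun T -> bool}) 4 ^- hdist chi chi' = (5 / 4) ^+ #|T| :> R.
  rewrite -prodr_const.
  transitivity (\prod_(x : T) \sum_(c : bool) (4 ^- (chi x != c) : R)).
    rewrite (bigA_distr_bigA (fun x c => 4 ^- (chi x != c) : R)); apply: eq_bigr => c _.
    rewrite -exprVn /hdist; under [RHS]eq_bigr => i _ do rewrite -exprVn.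
    rewrite prodrXr -sum1_card big_mkcond; congr (_ ^+ _); apply: eq_bigr => x _.
    by rewrite inE.
  by apply: eq_bigr => x _; rewrite big_bool; case: (chi x); rewrite /= expr0 expr1; lra.
move=> <-; rewrite -sum1_card natr_sum mulr_sumr big_mkcond; apply: ler_sum => c _.
rewrite inE; case: ifP => h; last by rewrite mulr_ge0 ?invr_ge0 ?exprn_ge0.
by rewrite ler_pdivlMr ?exprn_gt0 // mul1r ler_weXn2l // ler1n.
Qed.

Lemma exists_far_pair (Y : {set {ffun T -> bool}}) r :
  (0 < #|Y|)%N -> 4 ^+ r * (5 / 4) ^+ #|T| < #|Y|%:R :> R ->
  exists chi chi', [/\ chi \in Y, chi' \in Y & (r < hdist chi chi')%N].
Proof.
move=> /card_gt0P [chi chiY] hY; apply: contrapT => H.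
suff : #|Y|%:R <= 4 ^+ r * (5 / 4) ^+ #|T| :> R by rewrite leNgt hY.
apply: le_trans (ball_card chi r); rewrite ler_nat.
apply: subset_leq_card; apply/fintype.subsetP => chi' chiY'; rewrite inE leqNgt.
by apply/negP => h; apply: H; exists chi, chi'.
Qed.

(** Two colourings in one large code class that differ in an eighth of the
    points have signed sums within [2 * D i] of each other; half of their
    difference is the partial colouring. The class is determined by the rounded
    absolute value and the sign, the sign being dropped when the rounded value
    vanishes, so that this most frequent case has a single code. *)
Lemma partial_colouring_codes (I : finType) (f : I -> T -> int) (D : I -> nat)
    (len : I -> nat -> bool -> nat) E M :
  (0 < #|T|)%N -> (forall i x, `|f i x| <= 1) -> (forall i, 0 < D i)%N ->
  (\sum_chi \sum_i len i (`|dot (f i) chi| %/ D i)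
     ((0 < `|dot (f i) chi| %/ D i) && (dot (f i) chi < 0)%R) <= E * 2 ^ #|T|)%N ->
  \prod_i \sum_(k : 'I_(#|T|.+1) * bool) 2 ^- len i k.1 k.2 <= 2 ^+ M :> R ->
  (3 * (1 + 2 * E + M) <= #|T|)%N ->
  exists g : T -> int, [/\ forall x, `|g x| <= 1,
    (#|T| <= 8 * #|[set x | g x != 0]|)%N &
    forall i, (`|(\sum_x g x * f i x)%R| <= D i)%N].
Proof.
move=> T0 f1 D0 hE hM hn.
pose c i chi := (`|dot (f i) chi| %/ D i)%N.
pose s i chi := (0 < c i chi)%N && (dot (f i) chi < 0)%R.
have cT i chi : (c i chi < #|T|.+1)%N.
  by rewrite ltnS; apply: leq_trans (leq_div _ _) (dot_le _ (f1 i)).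
pose b i chi := (Ordinal (cT i chi), s i chi).
have cX : #|{ffun T -> bool}| = (2 ^ #|T|)%N by rewrite card_ffun card_bool.
have [] := @big_code_class R _ _ _ [ffun=> true] b (fun i k => len i k.1 k.2) E M _ hM.
  by rewrite cX.
move=> kap; rewrite cX; set Y := finset _ => hY.
(* The Hamming balls of radius [n / 8] are smaller than the code class. *)
pose r := (#|T| %/ 8)%N.
have hr : (8 * r <= #|T|)%N by rewrite /r; lia.
have pY : (0 < #|Y|)%N.
  rewrite lt0n; apply/eqP => h; move: hY; rewrite h mulr0 leNgt ltr0n.
  by rewrite expn_gt0.
have hball : 4 ^+ r * (5 / 4) ^+ #|T| < #|Y|%:R :> R.
  rewrite -(ltr_pM2l (_ : 0 < 2 ^+ (1 + 2 * E + M) :> R)) ?exprn_gt0 //.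
  apply: lt_le_trans hY; rewrite natrX.
  exact: ball_numerics.
have [chi [chi' [h h' hd]]] := exists_far_pair pY hball.
exists (fun x => if chi x == chi' x then 0 else sgb (chi x)); split.
- by move=> x; case: eqP => // _; rewrite /sgb; case: (chi x).
- have -> : [set x | (if chi x == chi' x then 0 else sgb (chi x)) != 0] = [set x | chi x != chi' x].
    by apply/setP => x; rewrite !inE; rewrite /sgb; case: (chi x); case: (chi' x).
  by move: hd; rewrite /hdist /r; lia.
move=> i.
have E2 : dot (f i) chi - dot (f i) chi' = 2 * \sum_x (if chi x == chi' x then 0 else sgb (chi x)) * f i x.
  rewrite /dot -sumrB mulr_sumr; apply: eq_bigr => x _; rewrite /sgb.
  by case: (chi x); case: (chi' x) => /=; ring.
move: h h'; rewrite !inE => /forallP /(_ i) /eqP h /forallP /(_ i) /eqP.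
rewrite -h /b /s => -[] /eqP; rewrite /c => /eqP.
move: E2; move: (\sum_x _ : int) (dot (f i) chi) (dot (f i) chi') => S u v E2.
have := divn_eq `|u| (D i); have := divn_eq `|v| (D i).
have := ltn_pmod `|u| (D0 i); have := ltn_pmod `|v| (D0 i).
move: (`|u| %% D i)%N (`|v| %% D i)%N (`|u| %/ D i)%N (`|v| %/ D i)%N => a a' q q' h1 h2 h3 h4 e.
subst q'; move: h1 h2 h3 h4; move: (D i) => Di h1 h2 h3 h4.
case: (posnP q) => q0 /=; first by subst q; lia.
move: h3 h4; move: (q * Di)%N => z h3 h4.
have : (u < 0) = (v < 0) -> (`|S| <= Di)%N by lia.
by move=> H e; apply: H.
Qed.

End PartialColouring.

(** * Chaining along nets *)

Section Nets.
Variables (T : finType).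
Implicit Types (P F : {set {set T}}) (A B : {set T}).

(** Maximality of the far apart family makes it a net. *)
Lemma far_apart_net L F : (0 < #|T|)%N -> exists P,
  [/\ P \subset F, far_apart L P &
    forall A, A \in F -> exists2 B, B \in P & (L * #|symdiff A B| < #|T|)%N].
Proof.
move=> T0; pose good P := (P \subset F) && `[< far_apart L P >].
have g0 : good finset.set0.
  by rewrite /good finset.sub0set /=; apply/asboolP => A B; rewrite inE.
case: (arg_maxnP (fun P : {set {set T}} => #|P|) g0) => P /andP[PF /asboolP sP] mP.
exists P; split=> // A AF; apply: contrapT => H.
have AP : A \notin P.
  apply/negP => AP; apply: H; exists A => //.
  by rewrite /symdiff finset.setDv finset.setU0 cards0 muln0.
have symC B : symdiff A B = symdiff B A by rewrite /symdiff finset.setUC.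
have far B : B \in P -> (#|T| <= L * #|symdiff A B|)%N.
  by move=> BP; rewrite leqNgt; apply/negP => h; apply: H; exists B.
have : good (A |: P).
  rewrite /good finset.subUset finset.sub1set AF PF /=; apply/asboolP => B B'.
  rewrite !inE => /orP[/eqP ->|BP] /orP[/eqP ->|BP']; rewrite ?eqxx // => ne.
  - exact: far.
  - by rewrite -symC; apply: far.
  - exact: sP.
by move=> /mP; rewrite /= cardsU1 AP /= add1n ltnn.
Qed.

Lemma approximating_nets d F : (0 < d)%N -> (0 < #|T|)%N -> vc_le d F ->
  exists (P : nat -> {set {set T}}) (pr : nat -> {set T} -> {set T}),
  forall k, [/\ P k \subset F, (#|P k| <= 2 * (5 * d) ^ d * 4 ^ (k * d))%N,
    forall A, A \in F -> pr k A \in P k &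
    forall A, A \in F -> (4 ^ k * #|symdiff A (pr k A)| < #|T|)%N].
Proof.
move=> d0 T0 vF.
have /choice [P hP] : forall k, exists P, [/\ P \subset F, far_apart (4 ^ k) P &
    forall A, A \in F -> exists2 B, B \in P & (4 ^ k * #|symdiff A B| < #|T|)%N].
  by move=> k; apply: far_apart_net.
have /choice [pr hpr] : forall kA : nat * {set T}, exists B,
    kA.2 \in F -> B \in P kA.1 /\ (4 ^ kA.1 * #|symdiff kA.2 B| < #|T|)%N.
  move=> [k A] /=; case: (boolP (A \in F)) => [AF|_]; last by exists finset.set0.
  by have [_ _ /(_ A AF) [B BP h]] := hP k; exists B.
exists P, (fun k A => pr (k, A)) => k; have [PF sP _] := hP k; split=> //.
- have vP : vc_le d (P k).
    move=> ys sy; have [p sp hp] := vF ys sy; exists p => // A AP; apply: hp.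
    exact: (fintype.subsetP PF).
  apply: leq_trans (vc_packing d0 _ T0 vP sP) _; first by rewrite expn_gt0.
  rewrite -(mulnA 2) leq_mul2l /= expnM -expnMn leq_exp2r //.
  have : (0 < 4 ^ k)%N by rewrite expn_gt0.
  by move: (4 ^ k)%N => z; nia.
- by move=> A AF; have [] := hpr (k, A) AF.
- by move=> A AF; have [] := hpr (k, A) AF.
Qed.

End Nets.

Lemma sum_pow2 a m : (\sum_(k < m) 2 ^ (a + k) <= 2 ^ (a + m))%N.
Proof.
elim: m => [|m IH]; first by rewrite big_ord0.
by rewrite big_ord_recr /= addnS expnS mul2n -addnn leq_add2r.
Qed.

Lemma sum_arith_pow2 n : (\sum_(j < n) j.+1 * 2 ^ (n - j) <= 4 * 2 ^ n)%N.
Proof.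
suff : (\sum_(j < n) j.+1 * 2 ^ (n - j) + 2 * n + 4 = 4 * 2 ^ n)%N.
  by move=> <-; rewrite -addnA leq_addr.
elim: n => [|n IH]; first by rewrite big_ord0.
rewrite big_ord_recr /= subSnn expn1 expnS.
have -> : (\sum_(j < n) j.+1 * 2 ^ (n.+1 - j) = 2 * \sum_(j < n) j.+1 * 2 ^ (n - j))%N.
  rewrite big_distrr; apply: eq_bigr => j _ /=.
  by rewrite subSn ?expnS; [lia|apply: ltnW].
by move: IH; move: (2 ^ n)%N (\sum_(j < n) _)%N => z s; lia.
Qed.

Section Lengths.
Variables (R : realType).

Lemma geo_half n : \sum_(j < n) 2 ^- j.+1 <= 1 :> R.
Proof.
suff : \sum_(j < n) 2 ^- j.+1 = 1 - 2 ^- n :> R.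
  by move=> ->; rewrite gerBl invr_ge0 exprn_ge0.
elim: n => [|n IH]; first by rewrite big_ord0 expr0 invr1 subrr.
by rewrite big_ord_recr /= IH !exprS invfM; lra.
Qed.

Lemma geo_half0 n : \sum_(j < n) 2 ^- j <= 2 :> R.
Proof.
apply: le_trans (_ : 2 * \sum_(j < n) 2 ^- j.+1 <= _); last by have := geo_half n; lra.
by rewrite mulr_sumr; apply: ler_sum => j _; rewrite exprS invfM; lra.
Qed.

(** Code length for a coarse level: the rounding is [4 ^ i] times finer than the
    typical size of the sum, so every value costs about [2 i] bits. *)
Definition coarse_len i (c : nat) (s : bool) := (2 * i + 2 + c %/ 4 ^ i)%N.

(** Code length for a fine level: the rounding is [l] times the typical size of
    the sum, so the value zero, which costs nothing, is overwhelmingly likely. *)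
Definition fine_len l (c : nat) (s : bool) := if (c == 0)%N && ~~ s then 0%N else (l + c)%N.

Lemma kraft_coarse i n :
  \sum_(k : 'I_n * bool) 2 ^- coarse_len i k.1 k.2 <= 1 :> R.
Proof.
rewrite -(pair_bigA _ (fun (c : 'I_n) (s : bool) => 2 ^- coarse_len i c s)) /=.
under eq_bigr => c _ do rewrite big_bool /=.
have -> : \sum_(c < n) (2 ^- coarse_len i c true + 2 ^- coarse_len i c false) =
  2 ^- (2 * i + 1) * \sum_(c < n) 2 ^- (c %/ 4 ^ i) :> R.
  rewrite mulr_sumr; apply: eq_bigr => c _.
  rewrite /coarse_len addnS addn1 addSn !exprS !exprD !invfM.
  by field; rewrite ?expf_neq0 ?pnatr_eq0.
suff H : \sum_(c < n) 2 ^- (c %/ 4 ^ i) <= (4 ^ i)%:R * 2 :> R.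
  have e : 2 ^- (2 * i + 1) * ((4 ^ i)%:R * 2) = 1 :> R.
    rewrite natrX (_ : 4%:R = 2 ^+ 2); last by ring.
    by rewrite exprD expr1 -exprM; field; rewrite ?expf_neq0 ?pnatr_eq0.
  by rewrite -[X in _ <= X]e ler_wpM2l // invr_ge0 exprn_ge0.
have p4 : (0 < 4 ^ i)%N by rewrite expn_gt0.
apply: le_trans (_ : \sum_(c < n * 4 ^ i) 2 ^- (c %/ 4 ^ i) <= _).
  rewrite -!(big_mkord xpredT (fun c => 2 ^- (c %/ 4 ^ i) : R)).
  rewrite [X in _ <= X](big_cat_nat (n := n)) //=; last by rewrite leq_pmulr.
  by rewrite lerDl sumr_ge0 // => c _; rewrite invr_ge0 exprn_ge0.
apply: le_trans (_ : (4 ^ i)%:R * \sum_(j < n) 2 ^- j <= _); last first.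
  by rewrite ler_wpM2l // geo_half0.
elim: n => [|n IH]; first by rewrite mul0n !big_ord0 mulr0.
rewrite big_ord_recr /= mulrDr -(big_mkord xpredT (fun c => 2 ^- (c %/ 4 ^ i) : R)).
rewrite mulSnr (big_cat_nat (n := n * 4 ^ i)) ?leq_addr //= big_mkord lerD //.
rewrite -{1}[(n * 4 ^ i)%N]add0n big_addn addKn big_mkord.
rewrite mulr_natl -[in X in _ <= X](card_ord (4 ^ i)) -sumr_const; apply: ler_sum => c _.
by rewrite addnC divnMDl // divn_small ?addn0.
Qed.

Lemma kraft_fine l n :
  \sum_(k : 'I_n * bool) 2 ^- fine_len l k.1 k.2 <= 1 + 4 * 2 ^- l :> R.
Proof.
rewrite -(pair_bigA _ (fun (c : 'I_n) (s : bool) => 2 ^- fine_len l c s)) /=.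
under eq_bigr => c _ do rewrite big_bool /=.
have l0 : 0 < 2 ^- l :> R by rewrite invr_gt0 exprn_gt0.
case: n => [|n]; first by rewrite big_ord0; lra.
rewrite big_ord_recl (eq_bigr (fun c : 'I_n => 2 * 2 ^- l * 2 ^- c.+1)); last first.
  move=> c _; rewrite /fine_len lift0 /= exprD invfM; ring.
rewrite -mulr_sumr /fine_len /= addn0 expr0 invr1.
by have := geo_half n; set s := \sum_(_ < _) _; nra.
Qed.

Variable T : finType.
Implicit Types f : T -> int.

(** Average code length on a coarse level, multiplied by the number of
    colourings. *)
Lemma coarse_cost i q D f : (0 < q)%N -> (D * 4 ^ i = q)%N -> (forall x, `|f x| <= 1) ->
  (#|[set x | f x != 0%R]| <= q ^ 2)%N ->
  (\sum_(chi : {ffun T -> bool}) coarse_len i (`|dot f chi| %/ D)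
    ((0 < `|dot f chi| %/ D) && (dot f chi < 0)%R) <= (2 * i + 6) * 2 ^ #|T|)%N.
Proof.
move=> q0 Dq f1 sf; rewrite /coarse_len big_split /= sum_nat_const card_ffun card_bool.
have -> : (2 * i + 6 = 2 * i + 2 + 4)%N by rewrite -addnA.
rewrite mulnDl mulnC leq_add2l.
under eq_bigr => chi _ do rewrite -divnMA Dq.
have := @sum_quotient R T f q 1 q0 isT f1 sf; rewrite mul1n expr1.
rewrite -(ler_nat R) natrM natrX; set s := (\sum_(_ | _) _)%N; set z := 2 ^+ _; lra.
Qed.

Lemma fine_cost l q f : (0 < q)%N -> (0 < l)%N -> (forall x, `|f x| <= 1) ->
  (#|[set x | f x != 0%R]| <= q ^ 2)%N ->
  (\sum_(chi : {ffun T -> bool}) fine_len l (`|dot f chi| %/ (l * q))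
    ((0 < `|dot f chi| %/ (l * q)) && (dot f chi < 0)%R))%:R
  <= 8 * (l.+1)%:R * 2 ^- l * 2 ^+ #|T| :> R.
Proof.
move=> q0 l0 f1 sf.
have := @sum_quotient R T f q l q0 l0 f1 sf; set S := (\sum_(_ | _) _)%N => h.
apply: le_trans (_ : (l.+1 * S)%:R <= _); last first.
  have : 0 <= l.+1%:R :> R by [].
  by rewrite natrM => h'; have := ler_wpM2l h' h; lra.
rewrite ler_nat /S big_distrr /=; apply: leq_sum => chi _; rewrite /fine_len.
by case: (_ %/ _)%N => [|c] //=; rewrite !mulSn; nia.
Qed.

End Lengths.

Section VCPartial.
Variables (R : realType) (T : finType).

Definition diff_ind (A B : {set T}) (x : T) : int := (x \in A)%:Z - (x \in B)%:Z.

Lemma diff_ind_le1 A B x : `|diff_ind A B x| <= 1.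
Proof. by rewrite /diff_ind; case: (x \in A); case: (x \in B). Qed.

Lemma diff_ind_supp A B : #|[set x | diff_ind A B x != 0]| = #|symdiff A B|.
Proof.
by apply: eq_card => x; rewrite !inE /diff_ind; case: (x \in A); case: (x \in B).
Qed.

Lemma sum_diff_ind g A B :
  \sum_x g x * diff_ind A B x = \sum_(x in A) g x - \sum_(x in B) g x.
Proof.
rewrite ![\sum_(_ in _) _]big_mkcond -sumrB; apply: eq_bigr => x _.
by rewrite /diff_ind; case: (x \in A); case: (x \in B); rewrite ?subrr ?subr0 ?sub0r ?mulr0 ?mulr1 ?mulrN1.
Qed.

(** Rounding of the sums over the differences between nets [k] and [k.+1], whose
    supports have at most [4 ^ (K - k)] points. Near the critical level [m],
    where the size of the nets is proportional to the number of points, it is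
    about [2 ^ (K - m)], and it decays geometrically in both directions so that
    the widths can be summed. *)
Definition level_width d K m k : nat :=
  (if k < m then 2 ^ (K - k - 2 * (m - k.+1)) else 4 * d * (k - m).+1 * 2 ^ (K - k))%N.

Definition level_len d m k : nat -> bool -> nat :=
  (if k < m then coarse_len (m - k.+1) else fine_len (4 * d * (k - m).+1))%N.

(** A bound for the total code length spent on level [k], in units of the size
    of net [m]. *)
Definition level_weight m k : R :=
  if (k < m)%N then 6 * 2 ^- (m - k.+1) else 40 * 2 ^- (k - m).+1.

Lemma sum_level_width d K m : (m <= K)%N -> (2 * m <= K + 2)%N ->
  (\sum_(k < K) level_width d K m k <= 2 ^ (K - m).+1 * (2 + 8 * d))%N.
Proof.
move=> mK mK2; rewrite -(big_mkord xpredT) (big_cat_nat (n := m)) //= mulnDr.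
apply: leq_add.
  rewrite big_nat (eq_bigr (fun k => 2 ^ (K + 2 - 2 * m + k))%N); last first.
    by move=> k /andP[_ km]; rewrite /level_width km; congr (2 ^ _)%N; lia.
  rewrite -big_nat big_mkord; apply: leq_trans (sum_pow2 _ _) _.
  by rewrite -expnSr leq_exp2l //; lia.
rewrite -{1}[m]add0n big_addn big_mkord.
rewrite (eq_bigr (fun j : 'I_(K - m) => 4 * d * (j.+1 * 2 ^ (K - m - j)))%N); last first.
  move=> j _; rewrite /level_width ltnNge leq_addl /= addnK -mulnA.
  by congr (_ * (_ * 2 ^ _))%N; lia.
rewrite -big_distrr /=; have := sum_arith_pow2 (K - m).
by rewrite expnS; move: (2 ^ _)%N (\sum_(_ < _) _)%N => z s h; nia.
Qed.

Lemma sum_level_weight m K : (m <= K)%N -> \sum_(k < K) level_weight m k <= 52.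
Proof.
move=> mK; rewrite -(big_mkord xpredT) (big_cat_nat (n := m)) //=.
rewrite (_ : 52 = 6 * 2 + 40 * 1 :> R); last by ring.
apply: lerD.
  rewrite big_nat (eq_bigr (fun k => 6 * 2 ^- (m - k.+1))); last first.
    by move=> k /andP[_ km]; rewrite /level_weight km.
  rewrite -big_nat big_mkord (reindex_inj rev_ord_inj) /= -mulr_sumr ler_wpM2l //.
  apply: le_trans (geo_half0 R m); apply: ler_sum => k _.
  by rewrite subnSK // subKn // ltnW.
rewrite -{1}[m]add0n big_addn big_mkord.
rewrite (eq_bigr (fun j : 'I_(K - m) => 40 * 2 ^- j.+1)); last first.
  by move=> j _; rewrite /level_weight ltnNge leq_addl /= addnK.
by rewrite -mulr_sumr ler_wpM2l // geo_half.
Qed.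

Lemma expR1_le4 : expR 1 <= 4 :> R.
Proof.
have h : expR (- (1 / 2)) >= 1 / 2 :> R by have := expR_ge1Dx (- (1 / 2) : R); lra.
have h0 : 0 < expR (1 / 2) :> R by exact: expR_gt0.
have e : expR (1 / 2) * expR (- (1 / 2)) = 1 :> R by rewrite -expRD subrr expR0.
have -> : 1 = 1 / 2 + 1 / 2 :> R by lra.
rewrite expRD; nra.
Qed.

Lemma prod1D_le (I : finType) (a : I -> R) N : (forall i, 0 <= a i) ->
  \sum_i a i <= N%:R -> \prod_i (1 + a i) <= 2 ^+ (2 * N).
Proof.
move=> a0 aN; apply: le_trans (_ : \prod_i expR (a i) <= _).
  apply: ler_prod => i _; rewrite expR_ge1Dx andbT; have := a0 i; lra.
rewrite -expR_sum; apply: le_trans (_ : expR N%:R <= _); first by rewrite ler_expR.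
rewrite -[N%:R]mulr1 expRM_natl exprM (_ : 2 ^+ 2 = 4 :> R); last by ring.
by rewrite lerXn2r ?nnegrE ?expR_ge0 // expR1_le4.
Qed.

Lemma pow4 n : 2 ^+ (2 * n) = (4 ^ n)%:R :> R.
Proof. by rewrite exprM natrX; congr (_ ^+ _); ring. Qed.

Lemma sum_levels (S : finType) K (P : 'I_K -> {set S}) (G : 'I_K * S -> R) (W : 'I_K -> R) :
  (forall k, 0 <= W k) -> (forall u, u.2 \in P u.1 -> G u * #|P u.1|%:R <= W u.1) ->
  \sum_(u in [set u : 'I_K * S | u.2 \in P u.1]) G u <= \sum_k W k.
Proof.
move=> W0 GW; rewrite (eq_bigl (fun u => true && (u.2 \in P u.1))); last by move=> u; rewrite inE.
rewrite (eq_bigr (fun u => G (u.1, u.2))); last by case.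
rewrite -(pair_big_dep xpredT (fun k A => A \in P k) (fun k A => G (k, A))) /=.
apply: ler_sum => k _; case: (posnP #|P k|) => [/eqP|P0].
  by rewrite cards_eq0 => /eqP ->; rewrite finset.big_set0.
have P0' : 0 < #|P k|%:R :> R by rewrite ltr0n.
apply: le_trans (_ : \sum_(A in P k) W k / #|P k|%:R <= _).
  by apply: ler_sum => A AP; rewrite ler_pdivlMr //; apply: (GW (k, A)).
by rewrite sumr_const -(mulr_natr (W k / _)) -mulrA mulVf ?mulr1 // lt0r_neq0.
Qed.

(** Chaining. A member of the family is the last of a chain of approximations in
    the nets; its sum telescopes into the sums over the differences, each
    controlled by [partial_colouring_codes] up to [level_width]. The hypothesis
    on [m] makes the total code length, which is proportional to the size of net
    [m], smaller than the number of points. *)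
Lemma vc_partial_levels d K m (F : {set {set T}}) :
  (0 < d)%N -> (0 < #|T|)%N -> vc_le d F -> (#|T| <= 4 ^ K)%N ->
  (m <= K)%N -> (2 * m <= K + 1)%N ->
  (512 * (2 * (5 * d) ^ d * 4 ^ (m * d)) <= #|T|)%N ->
  exists g : T -> int, [/\ forall x, `|g x| <= 1,
    (#|T| <= 8 * #|[set x | g x != 0%R]|)%N &
    forall A, A \in F -> (`|(\sum_(x in A) g x)%R| <= 2 ^ (K - m).+1 * (2 + 8 * d))%N].
Proof.
move=> d0 T0 vF nK mK mK2; set Y := (2 * (5 * d) ^ d * 4 ^ (m * d))%N => hY.
have Y0 : (0 < Y)%N by rewrite /Y !muln_gt0 !expn_gt0 muln_gt0 d0.
have [P [pi hP]] := approximating_nets d0 T0 vF.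
(* The chain starts at the empty set, which is within [n] of every set. *)
pose pr k A := if k is 0 then finset.set0 else pi k A.
pose ff (u : 'I_K * {set T}) := diff_ind u.2 (pr u.1 u.2).
pose J := [set u : 'I_K * {set T} | u.2 \in P u.1.+1].
have PF k A : A \in P k -> A \in F by have [/fintype.subsetP h _ _ _] := hP k; apply: h.
have ff1 u x : `|ff u x| <= 1 by exact: diff_ind_le1.
have supp u : u \in J -> (#|[set x | ff u x != 0%R]| <= (2 ^ (K - u.1)) ^ 2)%N.
  move: u => [k A]; rewrite inE /ff diff_ind_supp /= => Ak.
  rewrite -expnM mulnC expnM.
  rewrite /pr; case: {Ak}(nat_of_ord k) (ltn_ord k) (PF _ _ Ak) => [_ _|k' kK AF].
    by rewrite subn0; apply: leq_trans nK; apply: max_card.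
  have [_ _ _ /(_ A AF) h] := hP k'.+1.
  rewrite -(leq_pmul2l (_ : 0 < 4 ^ k'.+1)%N) ?expn_gt0 // -expnD subnKC; last exact: ltnW.
  by apply: leq_trans nK; apply: ltnW.
have wid0 k : (k < K)%N -> (0 < level_width d K m k)%N.
  by move=> kK; rewrite /level_width; case: ifP => _; rewrite ?muln_gt0 ?expn_gt0 ?d0.
have cost u : u \in J ->
  (\sum_(chi : {ffun T -> bool}) level_len d m u.1 (`|dot (ff u) chi| %/ level_width d K m u.1)
     ((0 < `|dot (ff u) chi| %/ level_width d K m u.1) && (dot (ff u) chi < 0)%R))%:R
  * #|P u.1.+1|%:R <= level_weight m u.1 * (Y%:R * 2 ^+ #|T|) :> R.
  move=> uJ; have su := supp u uJ; have fu := ff1 u.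
  case: u uJ su fu => k A; rewrite inE /= => Ak su fu.
  have q0 : (0 < 2 ^ (K - k))%N by rewrite expn_gt0.
  have [_ cP _ _] := hP k.+1.
  have {}cP : #|P k.+1|%:R <= (2 * (5 * d) ^ d)%:R * 2 ^+ (2 * (k.+1 * d)) :> R.
    by rewrite pow4 -natrM ler_nat; apply: leq_trans cP _; rewrite leq_mul2l leqnn orbT.
  have YE : Y%:R = (2 * (5 * d) ^ d)%:R * 2 ^+ (2 * (m * d)) :> R.
    by rewrite pow4 -natrM.
  set c0 : R := (2 * (5 * d) ^ d)%:R in cP YE.
  have c0_ge0 : 0 <= c0 by [].
  have T2 : 0 < 2 ^+ #|T| :> R by rewrite exprn_gt0.
  rewrite /level_weight /level_len /level_width; case: ltnP => km.
    set i := (m - k.+1)%N.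
    have qi : (2 ^ (K - k - 2 * i) * 4 ^ i = 2 ^ (K - k))%N.
      by rewrite -[4%N]/(2 ^ 2)%N -expnM -expnD subnK //; rewrite /i; lia.
    have := coarse_cost R q0 qi fu su; rewrite -(ler_nat R) natrM natrX.
    set S := (\sum_(chi : _) _)%:R => hS; have S0 : 0 <= S by rewrite /S ler0n.
    apply: le_trans (ler_pM S0 (ler0n _ _) hS cP) _.
    rewrite YE (_ : (2 * (m * d) = 2 * (k.+1 * d) + 2 * (i * d))%N); last by rewrite /i; nia.
    rewrite exprD.
    set z := 2 ^+ (2 * _); have z0 : 0 < z by rewrite exprn_gt0.
    suff h : (2 * i + 6)%:R <= 6 * 2 ^- i * 2 ^+ (2 * (i * d)) :> R.
      have w0 : 0 <= 2 ^+ #|T| * c0 * z by rewrite !mulr_ge0 // ltW.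
      by have := ler_wpM2l w0 h; lra.
    apply: le_trans (_ : 6 * 2 ^+ i <= _).
      rewrite -natrX -natrM ler_nat; have : (i < 2 ^ i)%N by apply: ltn_expl.
      lia.
    rewrite -mulrA ler_pM2l // mulrC ler_pdivlMr ?exprn_gt0 // -exprD.
    by rewrite ler_weXn2l ?ler1n //; nia.
  set j := (k - m).+1; set l := (4 * d * j)%N.
  have l0 : (0 < l)%N by rewrite /l !muln_gt0 d0.
  have := fine_cost R q0 l0 fu su.
  set S := (\sum_(chi : _) _)%:R => hS; have S0 : 0 <= S by rewrite /S ler0n.
  apply: le_trans (ler_pM S0 (ler0n _ _) hS cP) _.
  rewrite YE (_ : (2 * (k.+1 * d) = 2 * (m * d) + 2 * (j * d))%N); last by rewrite /j; nia.
  rewrite exprD.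
  set z := 2 ^+ (2 * _); have z0 : 0 < z by rewrite exprn_gt0.
  suff h : 8 * l.+1%:R * 2 ^- l * 2 ^+ (2 * (j * d)) <= 40 * 2 ^- j :> R.
    have w0 : 0 <= 2 ^+ #|T| * c0 * z by rewrite !mulr_ge0 // ltW.
    by have := ler_wpM2l w0 h; lra.
  have jd : (j <= j * d)%N by rewrite leq_pmulr.
  apply: le_trans (_ : 40 * 2 ^+ (j * d) * 2 ^- l * 2 ^+ (2 * (j * d)) <= _).
    rewrite !ler_pM2r ?invr_gt0 ?exprn_gt0 // -natrX -!natrM ler_nat.
    have : (j * d < 2 ^ (j * d))%N by apply: ltn_expl.
    by rewrite /l (_ : 4 * d * j = 4 * (j * d))%N ?[(d * j)%N]mulnC; lia.
  rewrite -!mulrA ler_pM2l // mulrCA ler_pdivrMl ?exprn_gt0 //.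
  rewrite ler_pdivlMr ?exprn_gt0 // -!exprD.
  by rewrite ler_weXn2l ?ler1n // /l; nia.
have kraft u : u \in J ->
  \sum_(k : 'I_(#|T|.+1) * bool) 2 ^- level_len d m u.1 k.1 k.2
  <= 1 + (if (u.1 < m)%N then 0 else 4 * 2 ^- (4 * d * (u.1 - m).+1)) :> R.
  by rewrite /level_len; case: ifP => _ _; [rewrite addr0; apply: kraft_coarse|apply: kraft_fine].
have [] := @partial_colouring_codes R T 'I_#|J| (fun i => ff (enum_val i))
  (fun i => level_width d K m (enum_val i).1) (fun i => level_len d m (enum_val i).1)
  (52 * Y) (2 * (4 * Y)) T0.
- by move=> i x; apply: ff1.
- by move=> i; apply: wid0.
- rewrite -(ler_nat R) natr_sum.
  under eq_bigr => chi _ do rewrite natr_sum.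
  rewrite exchange_big /=.
  rewrite -(big_enum_val (fun u : 'I_K * {set T} => \sum_(chi : {ffun T -> bool})
    (level_len d m u.1 (`|dot (ff u) chi| %/ level_width d K m u.1)
     ((0 < `|dot (ff u) chi| %/ level_width d K m u.1)%N && (dot (ff u) chi < 0)%R))%:R : R)).
  apply: le_trans (_ : \sum_(k < K) level_weight m k * (Y%:R * 2 ^+ #|T|) <= _); last first.
    have w0 : 0 <= Y%:R * 2 ^+ #|T| :> R by rewrite mulr_ge0 // exprn_ge0.
    rewrite -mulr_suml 2!natrM natrX; have := ler_wpM2r w0 (sum_level_weight mK).
    by move=> h; apply: le_trans h _; rewrite mulrA.
  apply: (@sum_levels _ _ (fun k => P k.+1)) => [k|u uJ].
    by rewrite mulr_ge0 ?mulr_ge0 ?exprn_ge0 // /level_weight; case: ifP => _; rewrite mulr_ge0 // invr_ge0 exprn_ge0.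
  by rewrite -natr_sum; apply: cost; rewrite inE.
- pose x (u : 'I_K * {set T}) : R := if (u.1 < m)%N then 0 else 4 * 2 ^- (4 * d * (u.1 - m).+1).
  have x0 u : 0 <= x u by rewrite /x; case: ifP => _; rewrite ?mulr_ge0 ?invr_ge0 ?exprn_ge0.
  apply: le_trans (_ : \prod_(i < #|J|) (1 + x (enum_val i)) <= _).
    apply: ler_prod => i _; rewrite kraft ?enum_valP // andbT.
    by apply: sumr_ge0 => k _; rewrite invr_ge0 exprn_ge0.
  apply: prod1D_le => //; rewrite -(big_enum_val x).
  apply: le_trans (_ : \sum_(k < K) (if (k < m)%N then 0 else (4 * Y)%:R * 2 ^- (k - m).+1) <= _).
    apply: (@sum_levels _ _ (fun k => P k.+1)) => [k|u uJ].
      by case: ifP => _; rewrite ?mulr_ge0 ?invr_ge0 ?exprn_ge0.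
    rewrite /x; case: ltnP => km; first by rewrite mul0r.
    have [_ cP _ _] := hP u.1.+1; move: cP; rewrite -(ler_nat R) => cP.
    apply: le_trans (ler_wpM2l _ cP) _; first by rewrite mulr_ge0 ?invr_ge0 ?exprn_ge0.
    rewrite [in X in _ <= X]natrM /Y 2![(2 * (5 * d) ^ d * _)%:R]natrM -!pow4.
    set c1 := (2 * (5 * d) ^ d)%:R; set j := (u.1 - m).+1; set z := 2 ^+ (2 * (m * d)).
    have c1z : 0 <= 4 * c1 * z by rewrite !mulr_ge0 // exprn_ge0.
    rewrite (_ : (2 * (u.1.+1 * d) = 2 * (m * d) + 2 * (j * d))%N); last first.
      by rewrite -mulnDr -mulnDl /j addnS subnKC.
    have jd : (j <= j * d)%N by rewrite leq_pmulr.
    have h : 2 ^- (4 * d * j) * 2 ^+ (2 * (j * d)) <= 2 ^- j :> R.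
      rewrite ler_pdivrMl ?exprn_gt0 // ler_pdivlMr ?exprn_gt0 // -!exprD.
      by rewrite ler_weXn2l ?ler1n //; nia.
    by rewrite exprD -/z; have := ler_wpM2l c1z h; lra.
  rewrite -(big_mkord xpredT (fun k => if (k < m)%N then 0 else (4 * Y)%:R * 2 ^- (k - m).+1 : R)).
  rewrite (big_cat_nat (n := m)) //= big_nat big1 ?add0r; last first.
    by move=> k /andP[_ ->].
  rewrite -{1}[m]add0n big_addn big_mkord.
  rewrite (eq_bigr (fun j : 'I_(K - m) => (4 * Y)%:R * 2 ^- j.+1)); last first.
    by move=> j _; rewrite ltnNge leq_addl /= addnK.
  by rewrite -mulr_sumr; apply: ler_piMr => //; apply: geo_half.
- lia.
move=> g [g1 gs gf]; exists g; split=> // A AF.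
have gJ k B : (k < K)%N -> B \in P k.+1 ->
  (`|(\sum_(x in B) g x - \sum_(x in pr k B) g x)%R| <= level_width d K m k)%N.
  move=> kK BP; have uJ : (Ordinal kK, B) \in J by rewrite inE.
  have := gf (enum_rank_in uJ (Ordinal kK, B)).
  by rewrite enum_rankK_in // /ff /= sum_diff_ind.
(* Descending the chain from a member of net [k.+1] to the empty set. *)
have chain k B : (k < K)%N -> B \in P k.+1 ->
  (`|(\sum_(x in B) g x)%R| <= \sum_(j < k.+1) level_width d K m j)%N.
  elim: k B => [|k IH] B kK BP; rewrite big_ord_recr /=.
    have := gJ 0%N B kK BP; rewrite /pr big_ord0 add0n.
    by rewrite finset.big_set0 subr0.
  have h := gJ _ _ kK BP.
  have h' : pr k.+1 B \in P k.+1.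
    by have [_ _ h' _] := hP k.+1; apply: h'; apply: PF BP.
  have := IH _ (ltnW kK) h'.
  move: h; move: (\sum_(x in B) g x) (\sum_(x in pr k.+1 B) g x) (level_width _ _ _ _) (\sum_(_ < _) _)%N.
  lia.
have K0 : (0 < K)%N by case: (K) nK; [rewrite expn0; lia|].
have [_ _ hpi hsep] := hP K.
(* The finest net contains the family: its members are approximated up to
   fewer than one point. *)
have AP : A \in P K.
  have -> : A = pi K A; last by apply: hpi.
  have : #|symdiff A (pi K A)| == 0%N.
    rewrite -leqn0 -(leq_pmul2l (_ : 0 < 4 ^ K)%N) ?expn_gt0 // muln0.
    have := hsep A AF; move: #|symdiff _ _| => s h.
    have : (4 ^ K * s < 4 ^ K * 1)%N by rewrite muln1; apply: leq_trans h nK.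
    by rewrite ltn_pmul2l ?expn_gt0 // ltnS; lia.
  rewrite cards_eq0 /symdiff finset.setU_eq0 !finset.setD_eq0 => /andP[h1 h2].
  by apply/eqP; rewrite finset.eqEsubset h1.
apply: leq_trans (sum_level_width d mK _); last by lia.
by have := chain K.-1 A; rewrite prednK // => /(_ (leqnn _) AP).
Qed.

End VCPartial.

(** * Discrepancy of families of bounded VC dimension *)

(** The first summand serves large point sets; the second one serves those with
    fewer than [4 ^ (d (5 d + 6))] points, on which any colouring is good
    enough. *)
Definition vc_const (d : nat) : nat :=
  ((2 + 8 * d) ^ (2 * d) * 4 ^ (d * (5 * d + 8)) * 4 ^ d + (4 ^ (d * (5 * d + 6))) ^ (d + 1))%N.

(** The bound [B] is of order [n ^ (1/2 - 1/(2d))], stated without roots. *)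
Lemma vc_partial (R : realType) d (T : finType) (F : {set {set T}}) :
  (2 <= d)%N -> (0 < #|T|)%N -> vc_le d F ->
  exists (g : T -> int) (B : nat), [/\ forall x, `|g x| <= 1,
    (#|T| <= 8 * #|[set x | g x != 0%R]|)%N,
    forall A, A \in F -> (`|(\sum_(x in A) g x)%R| <= B)%N &
    (B ^ (2 * d) <= vc_const d * #|T| ^ d.-1)%N].
Proof.
move=> d2 T0 vF; have d0 : (0 < d)%N by apply: ltnW.
(* The critical level is [m = K / d - c0]: net [m] has at most [2 (5 d) ^ d
   4 ^ (m d)] members, and [c0] is large enough to make this a small
   fraction of [n]. *)
pose K := (trunc_log 4 #|T|).+1; pose c0 := (5 * d + 6)%N.
have [] := andP (@trunc_log_bounds 4 #|T| isT T0); rewrite -/K => hK1 /ltnW hK2.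
have hK3 : (4 ^ K <= 4 * #|T|)%N by rewrite /K expnS leq_mul2l.
have [h|h] := leqP c0 (K %/ d); last first.
  exists (fun _ => 1), #|T|; split=> //.
  - rewrite (_ : [set x | _] = [set: T]) ?cardsT ?leq_pmull //.
  - by move=> A _; rewrite sumr_const natz absz_nat max_card.
  rewrite (_ : 2 * d = d + 1 + d.-1)%N; last by lia.
  rewrite expnD leq_mul2r; apply/orP; right.
  apply: leq_trans (_ : (4 ^ (d * c0)) ^ (d + 1) <= _)%N; last by rewrite /vc_const leq_addl.
  rewrite leq_exp2r ?addn1 //; apply: leq_trans hK2 _; rewrite leq_exp2l //.
  by move: h; rewrite ltn_divLR // mulnC => /ltnW.
pose m := (K %/ d - c0)%N.
have hKd : (d * (K %/ d) <= K)%N by rewrite mulnC leq_divM.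
have hKd' : (K < d * (K %/ d) + d)%N by rewrite mulnC -mulSnr ltn_ceil.
have hm : (d * (K %/ d) = d * m + d * c0)%N by rewrite -mulnDr subnK.
have mK : (m <= K)%N by rewrite /m; apply: leq_trans (leq_subr _ _) (leq_div _ _).
have mK2 : (2 * m <= K + 1)%N.
  have : (2 * (K %/ d) <= d * (K %/ d))%N by rewrite leq_mul2r d2 orbT.
  by rewrite /m; lia.
have small : (512 * (2 * (5 * d) ^ d * 4 ^ (m * d)) <= #|T|)%N.
  rewrite -(leq_pmul2l (_ : 0 < 4)%N) //; apply: leq_trans hK3 => //.
  apply: (@leq_trans (4 ^ 6 * (4 ^ (5 * d)) ^ d * 4 ^ (m * d))%N).
    have -> : (4 * (512 * (2 * (5 * d) ^ d * 4 ^ (m * d))) =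
      4 ^ 6 * (5 * d) ^ d * 4 ^ (m * d))%N by rewrite !mulnA.
    rewrite leq_mul2r leq_mul2l leq_exp2r //=.
    by rewrite [(5 * d <= _)%N]ltnW ?orbT // ltn_expl.
  rewrite -expnM -!expnD leq_exp2l //; move: hm; rewrite /c0; nia.
have [g [g1 gs gA]] := vc_partial_levels R d0 T0 vF hK2 mK mK2 small.
exists g, (2 ^ (K - m).+1 * (2 + 8 * d))%N; split=> //.
rewrite expnMn /vc_const mulnDl; apply: leq_trans (leq_addr _ _).
rewrite [X in (X <= _)%N]mulnC -!mulnA leq_mul2l; apply/orP; right.
apply: (@leq_trans (4 ^ (d * (5 * d + 8)) * 4 ^ (K * d.-1))%N).
  rewrite -[4%N]/(2 ^ 2)%N -!expnM -expnD leq_exp2l //.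
  have e1 : (d * (K - m) + d * m = d * K)%N by rewrite -mulnDr subnK.
  have e2 : (K * d.-1 + K = d * K)%N by rewrite -mulnSr prednK // mulnC.
  move: e1 e2 hm hKd'; rewrite mulSn mulnCA [((K - m) * d)%N]mulnC /c0.
  move: (d * (K - m))%N (d * m)%N (d * K)%N (K * d.-1)%N (d * (K %/ d))%N.
  nia.
rewrite leq_mul2l (expnM 4 K); apply/orP; right.
apply: (@leq_trans ((4 * #|T|) ^ d.-1)%N).
  by case: d.-1 => // e; rewrite leq_exp2r.
by rewrite expnMn leq_mul2r leq_exp2l // leq_pred orbT.
Qed.

Section Discrepancy.
Variables (R : realType).

Definition restrict_family (T : finType) (S : {set T}) (F : {set {set T}}) :
    {set {set {x | x \in S}}} :=
  [set [set u : {x | x \in S} | val u \in (A : {set T})] | A in F].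

Lemma vc_le_restrict d (T : finType) (S : {set T}) F :
  vc_le d F -> vc_le d (restrict_family S F).
Proof.
move=> vF ys sy; have [|p sp hp] := vF (map val ys); first by rewrite size_map.
exists p => // _ /imsetP[A AF ->]; have := hp A AF; rewrite /trace -map_comp.
by congr (_ != _); apply: eq_map => u; rewrite inE.
Qed.

Lemma sum_restrict (V : nmodType) (T : finType) (S A : {set T}) (h : T -> V) :
  \sum_(u in [set u : {x | x \in S} | val u \in A]) h (val u) =
  \sum_(x in A :&: S) h x.
Proof.
rewrite (eq_bigl (fun u : {x | x \in S} => val u \in A)); last by move=> u; rewrite inE.
by rewrite -(big_sub_cond _ (mem A)); apply: eq_bigl => x; rewrite !inE andbC.
Qed.

Definition disc_exponent (d : nat) : R := 1 / 2 - 1 / (2 * d%:R).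

Lemma disc_exponent_gt0 d : (2 <= d)%N -> 0 < disc_exponent d.
Proof.
move=> d2; have d0 : 0 < d%:R :> R by rewrite ltr0n; lia.
have -> : disc_exponent d = (d%:R - 1) / (2 * d%:R).
  by rewrite /disc_exponent; field; apply: lt0r_neq0.
by rewrite divr_gt0 ?mulr_gt0 // subr_gt0 ltr1n.
Qed.

Lemma disc_exponent_le_half d : disc_exponent d <= 1 / 2.
Proof. by rewrite /disc_exponent lerBlDr lerDl divr_ge0 // mulr_ge0. Qed.

Lemma root_bound d B C n : (2 <= d)%N -> (B ^ (2 * d) <= C * n ^ d.-1)%N ->
  B%:R <= C%:R `^ (1 / (2 * d%:R)) * n%:R `^ disc_exponent d :> R.
Proof.
move=> d2 h; have d0 : 0 < d%:R :> R by rewrite ltr0n; lia.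
have e0 : 0 <= 1 / (2 * d%:R) :> R by rewrite divr_ge0 // mulr_ge0.
have -> : disc_exponent d = d.-1%:R * (1 / (2 * d%:R)).
  rewrite /disc_exponent -subn1 natrB ?(ltnW d2) //; field; exact: lt0r_neq0.
rewrite (powRrM n%:R) powR_mulrn // -powRM // ?exprn_ge0 //.
have -> : B%:R = ((B ^ (2 * d))%:R : R) `^ (1 / (2 * d%:R)).
  rewrite natrX -powR_mulrn // -powRrM (_ : _ * _ = 1) ?powRr1 //.
  by rewrite natrM; field; exact: lt0r_neq0.
by rewrite ge0_ler_powR ?nnegrE // ?mulr_ge0 ?exprn_ge0 // -natrX -natrM ler_nat.
Qed.

(** Partial colourings are iterated on the uncoloured points. Their number
    shrinks by a factor [7/8] each time, so the discrepancies add up to a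
    geometric series. *)
Lemma vc_colouring d : (2 <= d)%N -> exists2 C : R, 0 < C &
  forall (T : finType) (F : {set {set T}}), vc_le d F ->
  exists chi : T -> bool, forall A, A \in F ->
    `|(\sum_(x in A) sgb (chi x))%:~R| <= C * #|T|%:R `^ disc_exponent d.
Proof.
move=> d2; set a := disc_exponent d; have a0 : 0 < a by exact: disc_exponent_gt0.
(* The constant [C1 / (1 - th)] is the sum of the geometric series of the
   discrepancies. *)
pose th : R := (7 / 8) `^ a.
have th1 : th < 1 by have <- : 1 `^ a = 1 :> R; [rewrite powR1|rewrite gt0_ltr_powR ?nnegrE //; lra].
pose C1 : R := (vc_const d)%:R `^ (1 / (2 * d%:R)) + 1.
have C10 : 0 < C1 by rewrite ltr_pwDr // powR_ge0.
have t1 : 0 < 1 - th by rewrite subr_gt0.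
exists (C1 / (1 - th)); first by rewrite divr_gt0.
move=> T F; move: {2}#|T| (leqnn #|T|) => n.
elim: n T F => [|n IH] T F hn vF.
  exists (fun _ => true) => A _.
  have -> : A = finset.set0.
    by apply/eqP; rewrite -cards_eq0 -leqn0; apply: leq_trans hn; apply: max_card.
  by rewrite finset.big_set0 normr0 mulr_ge0 ?powR_ge0 // divr_ge0 // ltW.
case: (posnP #|T|) => [T0|T0]; first by apply: IH; rewrite ?T0.
have [g [B [g1 gs gA hB]]] := vc_partial R d2 T0 vF.
pose S := [set x | g x == 0].
have cS : (8 * #|S| <= 7 * #|T|)%N.
  have := cardsC S; rewrite (_ : ~: S = [set x | g x != 0]); last by apply/setP => x; rewrite !inE.
  by move: gs; lia.
have cS' : #|{: {x | x \in S}}| = #|S| by rewrite card_sig; apply: eq_card => x; rewrite !inE.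
have [|chi hchi] := IH {x | x \in S} (restrict_family S F) _ (vc_le_restrict vF).
  by rewrite cS'; lia.
exists (fun x => if insub x is Some u then chi u else g x == 1) => A AF.
have -> : \sum_(x in A) sgb (if insub x is Some u then chi u else g x == 1) =
   \sum_(x in A) g x + \sum_(u in [set u : {x | x \in S} | val u \in A]) sgb (chi u).
  rewrite (eq_bigr (fun u => sgb (if insub (val u) is Some u then chi u else g (val u) == 1))); last first.
    by move=> u _; rewrite valK.
  rewrite (sum_restrict S A (fun x => sgb (if insub x is Some u then chi u else g x == 1))).
  rewrite [LHS]big_mkcond /= [X in X + _]big_mkcond [X in _ + X]big_mkcond -big_split.
  apply: eq_bigr => x _; rewrite !inE; case: (x \in A) => //=.
  case: insubP => [u|]; rewrite inE.
    by move=> /eqP gx _; rewrite gx eqxx add0r.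
  move=> gx; rewrite (negbTE gx) addr0.
  by have := g1 x; move: gx; case: (g x) => -[|[|?]].
rewrite intrD; apply: le_trans (ler_normD _ _) _.
have h1 : `|(\sum_(x in A) g x)%:~R| <= C1 * #|T|%:R `^ a.
  rewrite -intr_norm -abszE -pmulrn; apply: le_trans (_ : B%:R <= _).
    by rewrite ler_nat gA.
  apply: le_trans (root_bound d2 hB) _; rewrite ler_wpM2r ?powR_ge0 // /C1; lra.
have h2 := hchi _ (imset_f _ AF).
have h3 : #|{: {x | x \in S}}|%:R `^ a <= th * #|T|%:R `^ a :> R.
  have c78 : 0 <= 7 / 8 :> R by lra.
  rewrite cS' -powRM // ge0_ler_powR ?nnegrE ?(ltW a0) ?mulr_ge0 ?invr_ge0 //.
  by move: cS; rewrite -(ler_nat R) !natrM; lra.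
have C0 : 0 <= C1 / (1 - th) by rewrite divr_ge0 // ltW.
apply: le_trans (lerD h1 (le_trans h2 (ler_wpM2l C0 h3))) _.
set z := _ `^ a.
suff -> : C1 * z + C1 / (1 - th) * (th * z) = C1 / (1 - th) * z by [].
by field; apply: lt0r_neq0.
Qed.

End Discrepancy.

(** * From two colours to r colours *)

Section Splitting.
Variables (R : realType) (T : finType).
Implicit Types (F : {set {set T}}) (A B O : {set T}).

(** Hereditary discrepancy: every subset of the points is split evenly by the
    members of [F]. *)
Definition herdisc_le F (D : R) := forall O, exists2 B : {set T}, B \subset O &
  forall A, A \in F -> `|2 * #|A :&: B|%:R - #|A :&: O|%:R| <= D.

Lemma card_setI_sum A B : #|A :&: B|%:R = \sum_(x in A) (x \in B)%:R :> R.
Proof.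
rewrite -sum1_card natr_sum big_mkcond [RHS]big_mkcond; apply: eq_bigr => x _.
by rewrite inE; case: (x \in A); case: (x \in B).
Qed.

(** The rounding argument of Lovasz, Spencer and Vesztergombi: the points of odd
    weight are split evenly into those rounded up and those rounded down, which
    clears the lowest bit; the errors form a geometric series. *)
Lemma round_weights F D : herdisc_le F D -> forall k (c : T -> nat),
  (forall x, c x <= 2 ^ k)%N -> exists2 B : {set T}, (forall x, x \in B -> 0 < c x)%N &
  forall A, A \in F ->
    `|2 ^+ k * #|A :&: B|%:R - \sum_(x in A) (c x)%:R| <= (2 ^+ k - 1) * D.
Proof.
move=> hD; elim=> [|k IH] c ck.
  exists [set x | c x == 1%N]; first by move=> x; rewrite inE => /eqP ->.
  move=> A AF; rewrite expr0 subrr mul0r mul1r normr_le0 subr_eq0.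
  rewrite -sum1_card natr_sum [X in X == _]big_mkcond [X in _ == X]big_mkcond /=.
  apply/eqP; apply: eq_bigr => x _; rewrite !inE; case: (x \in A) => //=.
  by move: (ck x); rewrite expn0; case: (c x) => [|[|?]].
pose O := [set x | odd (c x)].
have [B BO hB] := hD O.
(* Half of the weight, rounded up on [B] and down elsewhere. *)
pose c' x := if x \in B then (c x).+1./2 else (c x)./2.
have c'k x : (c' x <= 2 ^ k)%N.
  have : (c x <= 2 * 2 ^ k)%N by rewrite -expnS.
  by rewrite /c'; move: (2 ^ k)%N (c x) => z y; case: ifP; lia.
have c'E x : 2 * (c' x)%:R = (c x)%:R + 2 * (x \in B)%:R - (x \in O)%:R :> R.
  have : (2 * c' x + (x \in O) = c x + 2 * (x \in B))%N.
    have := fintype.subsetP BO x; rewrite inE /c'; case: (x \in B) => [/(_ isT)|_]; lia.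
  by move/(congr1 (fun n => n%:R : R)); rewrite !natrD; lra.
have [B' hB' hA] := IH c' c'k; exists B'.
  by move=> x /hB'; rewrite /c'; have := fintype.subsetP BO x; rewrite inE; case: ifP => _; case: (c x).
move=> A AF; have h1 := hA A AF; have h2 := hB A AF.
have E : 2 * \sum_(x in A) (c' x)%:R - \sum_(x in A) (c x)%:R = 2 * #|A :&: B|%:R - #|A :&: O|%:R :> R.
  rewrite !card_setI_sum !mulr_sumr -!sumrB; apply: eq_bigr => x _; rewrite c'E; ring.
move: E h1 h2; rewrite exprS; set s := \sum_(_ in _) _; set s' := \sum_(_ in _) _.
move=> E; rewrite -E => h1 h2.
have -> : 2 * 2 ^+ k * #|A :&: B'|%:R - s' = 2 * (2 ^+ k * #|A :&: B'|%:R - s) + (2 * s - s') by ring.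
apply: le_trans (ler_normD _ _) _; rewrite normrM ger0_norm //; lra.
Qed.

(** Rounding the constant weight [1 / r], known to enough bits to make the
    truncation error at most one. *)
Lemma split_fraction F D r O : 0 <= D -> herdisc_le F D -> (0 < r)%N ->
  exists2 B : {set T}, B \subset O & forall A, A \in F ->
    `|#|A :&: B|%:R - #|A :&: O|%:R / r%:R| <= D + 1.
Proof.
move=> D0 hD r0; pose k := #|T|; pose c x := if x \in O then (2 ^ k %/ r)%N else 0%N.
have [|B hB hA] := round_weights hD (k := k) (c := c).
  by move=> x; rewrite /c; case: ifP => // _; apply: leq_div.
exists B; first by apply/fintype.subsetP => x /hB; rewrite /c; case: ifP.
move=> A AF; have := hA A AF.
have -> : \sum_(x in A) (c x)%:R = #|A :&: O|%:R * (2 ^ k %/ r)%:R :> R.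
  rewrite mulr_natl -sumr_const [LHS]big_mkcond [RHS]big_mkcond; apply: eq_bigr => x _.
  by rewrite inE /c; case: (x \in A); case: (x \in O).
have r0' : 0 < r%:R :> R by rewrite ltr0n.
have p0 : 0 < 2 ^+ k :> R by rewrite exprn_gt0.
have hn : #|A :&: O|%:R <= 2 ^+ k :> R.
  rewrite -natrX ler_nat; apply: leq_trans (max_card _) _.
  by apply: ltnW; apply: ltn_expl.
have q1 : (2 ^ k %/ r)%:R * r%:R <= 2 ^+ k :> R by rewrite -natrM -natrX ler_nat leq_divM.
have q2 : 2 ^+ k <= (2 ^ k %/ r)%:R * r%:R + r%:R :> R.
  by rewrite -natrX -natrM -natrD ler_nat -mulSnr ltnW // ltn_ceil.
move: q1 q2; set q : R := (2 ^ k %/ r)%:R; set a : R := #|A :&: O|%:R; set b : R := #|A :&: B|%:R => q1 q2.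
have a0 : 0 <= a by [].
have : `|a * q - 2 ^+ k * (a / r%:R)| <= 2 ^+ k.
  rewrite distrC ger0_norm.
    rewrite -subr_ge0 -(pmulr_rge0 _ r0').
    have -> : r%:R * (2 ^+ k - (2 ^+ k * (a / r%:R) - a * q)) = 2 ^+ k * r%:R - a * (2 ^+ k - q * r%:R).
      by field; apply: lt0r_neq0.
    nra.
  rewrite -(pmulr_rge0 _ r0').
  have -> : r%:R * (2 ^+ k * (a / r%:R) - a * q) = a * (2 ^+ k - q * r%:R).
    by field; apply: lt0r_neq0.
  by rewrite mulr_ge0 // subr_ge0.
move=> h1 h2; rewrite -(ler_pM2l p0) -{1}(ger0_norm (ltW p0)) -normrM mulrBr.
have -> : 2 ^+ k * b - 2 ^+ k * (a / r%:R) = (2 ^+ k * b - a * q) + (a * q - 2 ^+ k * (a / r%:R)) by ring.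
by apply: le_trans (ler_normD _ _) _; move: h1 h2; set u := `|_|; set v := `|_|; nra.
Qed.

(** One part is split off at a time. *)
Lemma split_parts F D r : 0 <= D -> herdisc_le F D -> forall O,
  exists f : T -> 'I_r.+1, forall A j, A \in F ->
    `|#|[set x in A :&: O | f x == j]|%:R - #|A :&: O|%:R / r.+1%:R| <= r%:R * (D + 1).
Proof.
move=> D0 hD; elim: r => [|r IH] O.
  exists (fun _ => ord0) => A j _; rewrite mul0r divr1 normr_le0 subr_eq0.
  by apply/eqP; congr _%:R; apply: eq_card => x; rewrite !inE [j]ord1 eqxx andbT.
have [B BO hB] := @split_fraction F D r.+2 O D0 hD isT.
have [f hf] := IH (O :\: B).
exists (fun x => if x \in B then ord0 else lift ord0 (f x)) => A j AF.
have hb := hB A AF.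
have D1 : 0 <= D + 1 by rewrite addr_ge0.
case: (unliftP ord0 j) => [i ->|->].
  have -> : #|[set x in A :&: O | (if x \in B then ord0 else lift ord0 (f x)) == lift ord0 i]|
     = #|[set x in A :&: (O :\: B) | f x == i]|.
    apply: eq_card => x; rewrite !inE; case: (x \in B) => /=; first by rewrite !andbF.
    by rewrite (inj_eq lift_inj).
  have := hf A i AF.
  have -> : #|A :&: (O :\: B)|%:R = #|A :&: O|%:R - #|A :&: B|%:R :> R.
    rewrite -(cardsID B (A :&: O)) natrD.
    have -> : A :&: O :&: B = A :&: B by rewrite -finset.setIA (finset.setIidPr BO).
    have -> : A :&: (O :\: B) = (A :&: O) :\: B by rewrite finset.setIDA.
    by rewrite addrAC subrr add0r.
  move: hb; set a : R := #|A :&: O|%:R; set b : R := #|A :&: B|%:R; set y : R := #|_|%:R => hb hy.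
  have -> : y - a / r.+2%:R = (y - (a - b) / r.+1%:R) + (- ((b - a / r.+2%:R) / r.+1%:R)).
    have := ltr0Sn R r; rewrite -(natr1 r.+1); move: (r.+1%:R : R) => p p0.
    by field; apply/andP; split; apply: lt0r_neq0 => //; lra.
  apply: le_trans (ler_normD _ _) _; have -> : r.+1%:R * (D + 1) = r%:R * (D + 1) + (D + 1) by rewrite -natr1; ring.
  rewrite lerD // normrN normrM [`|_^-1|]ger0_norm ?invr_ge0 //.
  apply: le_trans hb; rewrite ler_piMr // invf_le1 // ler1n //.
have -> : #|[set x in A :&: O | (if x \in B then ord0 else lift ord0 (f x)) == ord0]|
     = #|A :&: B|.
  apply: eq_card => x; rewrite !inE; have := fintype.subsetP BO x.
  case: (x \in B) => /=; first by move=> -> //; rewrite eqxx !andbT.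
  by rewrite !andbF.
apply: le_trans hb _; rewrite ler_peMl // ler1n //.
Qed.

End Splitting.

Lemma vc_herdisc (R : realType) d : (2 <= d)%N -> exists2 C : R, 0 < C &
  forall (T : finType) (F : {set {set T}}), vc_le d F ->
  herdisc_le F (C * #|T|%:R `^ disc_exponent R d).
Proof.
move=> d2; have [C C0 hC] := vc_colouring R d2; exists C => // T F vF O.
have [chi hchi] := hC {x | x \in O} _ (vc_le_restrict (S := O) vF).
pose e x := if insub x is Some u then chi (u : {x | x \in O}) else false.
exists [set x | e x].
  by apply/fintype.subsetP => x; rewrite inE /e; case: insubP.
move=> A AF; have := hchi _ (imset_f _ AF).
rewrite (eq_bigr (fun u => sgb (e (val u)))); last by move=> u _; rewrite /e valK.
rewrite (sum_restrict O A (fun x => sgb (e x))).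
have -> : (\sum_(x in A :&: O) sgb (e x))%:~R = 2 * #|A :&: [set x | e x]|%:R - #|A :&: O|%:R :> R.
  rewrite card_setI_sum -sum1_card natr_sum.
  have -> : \sum_(x in A) (x \in [set x | e x])%:R = \sum_(x in A :&: O) (e x)%:R :> R.
    rewrite big_mkcond [RHS]big_mkcond; apply: eq_bigr => x _.
    by rewrite !inE /e; case: (x \in A) => //=; case: insubP => [u ->|/negbTE ->].
  rewrite mulr_sumr -sumrB rmorph_sum; apply: eq_bigr => x _ /=; rewrite /sgb.
  by case: (e x) => /=; rewrite ?mulr1 ?mulr0 ?sub0r; ring.
move=> h; apply: le_trans h _; rewrite ler_pM2l // ge0_ler_powR ?nnegrE //.
  by apply: ltW; apply: disc_exponent_gt0.
by rewrite ler_nat card_sig; apply: max_card.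
Qed.

(** * Convex hulls and separation *)

Section Farkas.
Variables (R : realFieldType) (V : lmodType R).
Implicit Types (u b : V -> R).

Definition functional u := forall a x y, u (a *: x + y) = a * u x + u y.

(** Induction on the number of constraints. If [y0] solves all but the last one,
    it is used to project along the last constraint, and the induction
    hypothesis is applied to the projected system. *)
Lemma farkas n (u : nat -> V -> R) b : (forall i, functional (u i)) -> functional b ->
  (exists2 lam : nat -> R, (forall i, 0 <= lam i) &
     forall y, b y = \sum_(i < n) lam i * u i y) \/
  (exists2 y, (forall i, (i < n)%N -> 0 <= u i y) & b y < 0).
Proof.
elim: n u b => [|n IH] u b lu lb.
  have [h|] := pselect (forall y, b y = 0).
    by left; exists (fun _ => 0) => // y; rewrite big_ord0.
  move=> /existsNP [y /eqP by0]; right.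
  have bN : b (- y) = - b y.
    have b0 : b 0 = 0 by have := lb (-1) 0 0; rewrite scaler0 addr0; lra.
    by have := lb (-1) y 0; rewrite scaleN1r addr0 b0; lra.
  move: by0; rewrite neq_lt => /orP[h|h]; [by exists y|exists (- y) => //].
  by rewrite bN oppr_lt0.
have [[lam lam0 hlam]|[y0 hy0 by0]] := IH u b lu lb.
  left; exists (fun i => if i == n then 0 else lam i); first by move=> i; case: ifP.
  move=> y; rewrite big_ord_recr /= eqxx mul0r addr0 hlam; apply: eq_bigr => i _.
  by rewrite ltn_eqF.
case: (lerP 0 (u n y0)) => [un0|un0].
  right; exists y0 => // i; rewrite ltnS leq_eqVlt => /orP[/eqP -> //|]; exact: hy0.
pose c := - (u n y0)^-1; have c0 : 0 < c by rewrite /c oppr_gt0 invr_lt0.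
have cE : c * u n y0 = -1 by rewrite /c mulNr mulVf //; apply: ltr0_neq0.
(* Normalised so that the last constraint takes the value [-1] on [y1]. *)
pose y1 := c *: y0.
have u0 (f : V -> R) : functional f -> f y1 = c * f y0.
  move=> hf; have f0 : f 0 = 0 by have := hf (-1) 0 0; rewrite scaler0 addr0; lra.
  by rewrite /y1 -[_ *: _]addr0 hf f0 addr0.
pose u' i y := u i y + u i y1 * u n y.
pose b' y := b y + b y1 * u n y.
have lu' i : functional (u' i) by move=> a x y; rewrite /u' !lu; ring.
have lb' : functional b' by move=> a x y; rewrite /b' lb lu; ring.
have proj (f : V -> R) y : functional f -> f (u n y *: y1 + y) = f y + f y1 * u n y.
  by move=> hf; rewrite hf; ring.
have [[lam lam0 hlam]|[y hy b'y]] := IH u' b' lu' lb'; last first.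
  right; exists (u n y *: y1 + y); last by rewrite proj.
  move=> i; rewrite ltnS leq_eqVlt => /orP[/eqP ->|/hy]; last by rewrite proj.
  by rewrite proj // u0 // cE mulN1r addrN.
left; exists (fun i => if i == n then \sum_(j < n) lam j * u j y1 - b y1 else lam i).
  move=> i; case: ifP => // _; rewrite subr_ge0.
  apply: le_trans (_ : 0 <= _); first by rewrite u0 // pmulr_rle0 // ltW.
  apply: sumr_ge0 => j _; rewrite mulr_ge0 // u0 // mulr_ge0 ?(ltW c0) //; exact: hy0.
move=> y; rewrite big_ord_recr /= eqxx.
have := hlam y; rewrite /b' /u' => /eqP; rewrite -subr_eq0 => /eqP h.
rewrite mulrBl mulr_suml; apply/eqP; rewrite -subr_eq0; apply/eqP; rewrite -[RHS]h.
rewrite (eq_bigr (fun i : 'I_n => lam i * u i y)); last by move=> i _; rewrite ltn_eqF.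
rewrite [in RHS](eq_bigr (fun i : 'I_n => lam i * u i y + lam i * u i y1 * u n y)); last first.
  by move=> i _; ring.
rewrite big_split /=; ring.
Qed.

Lemma farkas_fin (I : finType) (u : I -> V -> R) b :
  (forall i, functional (u i)) -> functional b ->
  (exists2 lam : I -> R, (forall i, 0 <= lam i) &
     forall y, b y = \sum_i lam i * u i y) \/
  (exists2 y, (forall i, 0 <= u i y) & b y < 0).
Proof.
move=> lu lb.
pose u' (k : nat) y := if insub k is Some j then u (enum_val (j : 'I_#|I|)) y else 0.
have lu' k : functional (u' k).
  by move=> a x y; rewrite /u'; case: insub => [j|]; [apply: lu|rewrite mulr0 addr0].
have [[lam lam0 h]|[y hy by0]] := farkas #|I| lu' lb; [left|right].
  exists (fun i => lam (enum_rank i)) => // y; rewrite h.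
  rewrite [RHS](reindex (@enum_val I (mem I))); last first.
    by apply: onW_bij; apply: enum_val_bij.
  by apply: eq_bigr => k _; rewrite enum_valK /u' valK.
exists y => // i; have := hy (enum_rank i) (ltn_ord _).
by rewrite /u' valK enum_rankK.
Qed.

End Farkas.

Section Hull.
Variables (R : realType) (d : nat).
Local Notation V := 'rV[R]_d.

Lemma convex_combination (B : set V) (I : eqType) (s : seq I) (lam : I -> R) (x : I -> V) :
  @convex_set R V B -> (forall i, 0 <= lam i) -> (forall i, lam i != 0 -> B (x i)) ->
  \sum_(i <- s) lam i != 0 ->
  B ((\sum_(i <- s) lam i)^-1 *: \sum_(i <- s) lam i *: x i).
Proof.
move=> cB lam0 hB; elim: s => [|i s IH]; first by rewrite big_nil eqxx.
rewrite !big_cons; set S := \sum_(j <- s) lam j; set X := \sum_(j <- s) _.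
have S0 : 0 <= S by apply: sumr_ge0.
case: (eqVneq (lam i) 0) => [->|li]; first by rewrite add0r scale0r add0r; exact: IH.
move=> h; case: (eqVneq S 0) => [SE|Sn0].
  have -> : X = 0.
    rewrite /X big_seq big1 // => j js; suff -> : lam j = 0 by rewrite scale0r.
    apply/eqP; rewrite eq_le lam0 andbT -SE /S.
    by rewrite (big_rem j js) /= lerDl sumr_ge0.
  by rewrite SE !addr0 scalerA mulVf // scale1r; apply: hB.
have li0 : 0 < lam i by rewrite lt0r li lam0.
have t0 : 0 <= (lam i + S)^-1 * lam i by rewrite mulr_ge0 // invr_ge0 addr_ge0.
have t1 : (lam i + S)^-1 * lam i <= 1.
  by rewrite mulrC ler_pdivrMr ?mul1r ?lerDl // ltr_pwDl.
have := cB (x i) (S^-1 *: X) (Itv01 t0 t1); rewrite !inE => /(_ (hB _ li) (IH Sn0)).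
rewrite /conv /= scalerDr !scalerA.
rewrite (_ : _ * S^-1 = (lam i + S)^-1) //.
by rewrite /unstable.onem; field; rewrite Sn0 h.
Qed.

Lemma conv_hull_combination (A : set V) (I : finType) (lam : I -> R) (x : I -> V) :
  (forall i, 0 <= lam i) -> (forall i, lam i != 0 -> A (x i)) -> \sum_i lam i = 1 ->
  conv_hull A (\sum_i lam i *: x i).
Proof.
move=> lam0 hA s1 B [cB AB].
have := @convex_combination B I (index_enum I) lam x cB lam0.
rewrite s1 invr1 scale1r; apply; last exact: oner_neq0.
by move=> i /hA /AB.
Qed.

Definition dotv (v x : V) : R := \sum_l v 0 l * x 0 l.

(** Open and closed halfspaces are both of this form. *)
Lemma convex_halfspace v (P : R -> Prop) :
  (forall a b t, 0 <= t -> t <= 1 -> P a -> P b -> P (t * a + (1 - t) * b)) ->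
  @convex_set R V [set x | P (dotv v x)].
Proof.
move=> hP x y k; rewrite !inE /= => Px Py.
rewrite /conv /= (_ : dotv v _ = k%:num * dotv v x + (1 - k%:num) * dotv v y).
  by apply: hP.
rewrite /dotv !mulr_sumr -big_split; apply: eq_bigr => l _ /=.
by rewrite !mxE /unstable.onem; ring.
Qed.

End Hull.

(** * The VC dimension of halfspaces *)

Section Halfspaces.
Variables (R : realType) (d N : nat) (pt : 'I_N -> 'rV[R]_d) (l0 : 'I_d).
Implicit Types (A : {set 'I_N}).

(** Halfspaces below a hyperplane that is a graph over the coordinates other
    than [l0]. The normalisation of the normal vector is what lowers the VC
    dimension from [d + 1] to [d]. *)
Definition lower_family : {set {set 'I_N}} :=
  [set A : {set 'I_N} | `[< exists (u : 'rV[R]_d) (b : R),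
     u 0 l0 = 1 /\ A = [set i | dotv u (pt i) <= b] >]].

(** Among [d + 1] points there is an affine dependency for the [d - 1]
    coordinates other than [l0]; it sees a normalised functional only through
    the fixed coordinate [l0]. *)
Lemma lower_dependency (y : 'I_d.+1 -> 'rV[R]_d) : exists c : 'I_d.+1 -> R,
  [/\ exists i, c i != 0, \sum_i c i = 0 &
      forall u : 'rV[R]_d, u 0 l0 = 1 ->
        \sum_i c i * dotv u (y i) = \sum_i c i * y i 0 l0].
Proof.
pose M : 'M[R]_(d.+1, d) := \matrix_(i, l) if l == l0 then 1 else y i 0 l.
have : kermx M != 0.
  rewrite -mxrank_eq0 mxrank_ker -lt0n subn_gt0 ltnS.
  exact: rank_leq_col.
case/rowV0Pn => v /sub_kermxP vM v0.
have hM l : \sum_i v 0 i * M i l = 0.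
  by have := congr1 (fun B : 'M_(1, d) => B 0 l) vM; rewrite !mxE.
exists (fun i => v 0 i); split.
- apply/not_existsP => h; move/eqP: v0; apply; apply/rowP => i; rewrite mxE.
  by have := h i => /negP; rewrite negbK => /eqP.
- by rewrite -[RHS](hM l0); apply: eq_bigr => i _; rewrite mxE eqxx mulr1.
move=> u u1; rewrite /dotv.
under eq_bigr => i _ do rewrite mulr_sumr.
rewrite exchange_big (bigD1 l0) //= [X in _ + X]big1 ?addr0.
  by apply: eq_bigr => i _; rewrite u1 mul1r.
move=> l ll0; under eq_bigr => i _ do rewrite mulrCA.
rewrite -mulr_sumr; have := hM l.
under eq_bigr => i _ do rewrite mxE (negbTE ll0).
by move=> ->; rewrite mulr0.
Qed.

(** Let the points with positive coefficient in a dependency be those of a lower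
    halfspace. All terms of the dependency applied to the affine function are
    then nonpositive, while their sum is nonnegative for one choice of sign; if
    it is zero, some coefficient is negative and its term does not vanish. *)
Lemma vc_lower_family : vc_le d lower_family.
Proof.
move=> ys sy.
have [ysN|] := boolP (0 < size ys)%N; last by rewrite sy.
have x0 : 'I_N by case: ys sy ysN => // x.
pose y (i : 'I_d.+1) := pt (nth x0 ys i).
have [c [[i0 ci0] cs cu]] := lower_dependency y.
pose kap := \sum_i c i * y i 0 l0.
(* The dependency is oriented so that its value [kap] is positive or, if it
   vanishes, some coefficient is negative. *)
have [e [[e1 e2] e3]] : exists e : R, (0 <= e * kap /\ (e * kap = 0 -> exists i, e * c i < 0)) /\ e != 0.
  have [k0|k0|k0] := ltgtP kap 0.
  - by exists (-1); rewrite oppr_eq0 oner_eq0; split=> //; split; [lra|lra].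
  - by exists 1; rewrite oner_eq0; split=> //; split; [lra|lra].
  - have [h|h|h] := ltgtP (c i0) 0; last by rewrite h eqxx in ci0.
    + exists 1; rewrite oner_eq0 mul1r k0; split=> //; split=> // _; exists i0; lra.
    + exists (-1); rewrite oppr_eq0 oner_eq0 k0 mulr0; split=> //; split=> // _; exists i0; lra.
exists (mkseq (fun i => if insub i is Some j then 0 < e * c (j : 'I_d.+1) else false) d.+1).
  by rewrite size_mkseq.
move=> A; rewrite inE => /asboolP [u [b [u1 AE]]]; apply/eqP => tr.
have sgn (i : 'I_d.+1) : (dotv u (y i) <= b) = (0 < e * c i).
  have := congr1 (fun s => nth false s i) tr.
  rewrite /trace (nth_map x0) ?sy // nth_mkseq // valK.
  by rewrite AE inE.
have S : \sum_i e * c i * (dotv u (y i) - b) = e * kap.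
  transitivity (e * (\sum_i c i * dotv u (y i)) - e * b * \sum_i c i).
    by rewrite !mulr_sumr -sumrB; apply: eq_bigr => i _; ring.
  by rewrite cs (cu u u1) mulr0 subr0.
have neg (i : 'I_d.+1) : e * c i * (dotv u (y i) - b) <= 0.
  have := sgn i; case: (lerP (dotv u (y i)) b) => h /esym.
    by move=> h'; rewrite mulr_ge0_le0 ?subr_le0 // ltW.
  by move/negbT; rewrite -leNgt => h'; rewrite mulr_le0_ge0 // subr_ge0 ltW.
have k0 : e * kap = 0.
  by apply/eqP; rewrite eq_le e1 andbT -S; apply: sumr_le0.
have [i ci] := e2 k0.
have : \sum_i e * c i * (dotv u (y i) - b) < 0.
  rewrite (bigD1 i) //=; apply: ltr_wnDr; first by apply: sumr_le0.
  rewrite nmulr_rlt0 // subr_gt0 ltNge sgn -leNgt ltW //.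
by rewrite S k0 ltxx.
Qed.

Lemma strict_to_weak (T : finType) (h : T -> R) s : exists b, b < s /\ forall i, (h i < s) = (h i <= b).
Proof.
have [[i0 hi0]|none] := pselect (exists i, h i < s).
  case: (arg_maxP h (P := fun i => h i < s) hi0) => i hi hmax.
  exists (h i); split=> // j; apply/idP/idP => [/hmax //|h']; exact: le_lt_trans h' hi.
exists (s - 1); split=> [|i]; first by rewrite ltrBlDr ltrDl.
have hs : s <= h i by rewrite leNgt; apply/negP => h'; apply: none; exists i.
by rewrite ltNge hs /=; apply/esym/negbTE; rewrite -ltNge; apply: lt_le_trans hs; rewrite ltrBlDr ltrDl.
Qed.

Lemma dotvZ a (v x : 'rV[R]_d) : dotv (a *: v) x = a * dotv v x.
Proof. by rewrite /dotv mulr_sumr; apply: eq_bigr => l _; rewrite mxE mulrA. Qed.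

Lemma dotvD (v w x : 'rV[R]_d) : dotv (v + w) x = dotv v x + dotv w x.
Proof. by rewrite /dotv -big_split; apply: eq_bigr => l _; rewrite mxE mulrDl. Qed.

Lemma dotv_delta x : dotv (delta_mx 0 l0) x = x 0 l0 :> R.
Proof.
rewrite /dotv (bigD1 l0) //= big1 ?addr0 ?mxE ?eqxx ?mul1r // => l ll0.
by rewrite mxE (negbTE ll0) andbF mul0r.
Qed.

Lemma halfspace_lower_pos (v : 'rV[R]_d) s : 0 < v 0 l0 ->
  [set i | dotv v (pt i) < s] \in lower_family.
Proof.
move=> v0; have [b [_ hb]] := strict_to_weak (fun i => dotv v (pt i)) s.
rewrite inE; apply/asboolP; exists ((v 0 l0)^-1 *: v), ((v 0 l0)^-1 * b); split.
  by rewrite mxE mulVf // lt0r_neq0.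
by apply/finset.setP => i; rewrite !inE hb dotvZ ler_pM2l // invr_gt0.
Qed.

(** A vertical hyperplane is tilted by less than the gap it leaves between the
    finitely many points on its two sides; a normal vector with negative
    coordinate [l0] leads to the complement. *)
Lemma halfspace_lower (v : 'rV[R]_d) s :
  [set i | dotv v (pt i) < s] \in lower_family \/
  ~: [set i | dotv v (pt i) < s] \in lower_family.
Proof.
have [v0|v0|v0] := ltgtP (v 0 l0) 0; last first.
- left; have [b [bs hb]] := strict_to_weak (fun i => dotv v (pt i)) s.
  (* The tilt moves every value by less than half of the gap [s - b]. *)
  pose m := 1 + \sum_i `|pt i 0 l0|.
  have m0 : 0 < m by rewrite ltr_pwDl // sumr_ge0.
  pose g := (s - b) / 2; have g0 : 0 < g by rewrite divr_gt0 // subr_gt0.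
  have hx i : `|g / m * pt i 0 l0| < g.
    have gm : 0 < g / m by rewrite divr_gt0.
    rewrite normrM (gtr0_norm gm) mulrAC ltr_pdivrMr //.
    rewrite ltr_pM2l // /m (bigD1 i) //= addrCA ltrDl ltr_pwDl //; exact: sumr_ge0.
  have -> : [set i | dotv v (pt i) < s] =
      [set i | dotv (v + (g / m) *: delta_mx 0 l0) (pt i) < (s + b) / 2].
    apply/finset.setP => i; rewrite !inE dotvD dotvZ dotv_delta.
    have := hx i; rewrite ltr_norml => /andP[h1 h2].
    apply/idP/idP => h.
      by move: h; rewrite hb; rewrite /g in h1 h2 *; lra.
    rewrite ltNge; apply/negP => h'; move: h; rewrite ltNge => /negP; apply.
    by rewrite /g in h1 h2 *; lra.
  apply: halfspace_lower_pos.
  by rewrite !mxE v0 !eqxx add0r mulr1 divr_gt0.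
- by left; apply: halfspace_lower_pos.
right; rewrite inE; apply/asboolP.
exists ((v 0 l0)^-1 *: v), ((v 0 l0)^-1 * s); split.
  by rewrite mxE mulVf // ltr0_neq0.
by apply/finset.setP => i; rewrite !inE -leNgt dotvZ ler_nM2l // invr_lt0.
Qed.

Lemma setT_lower : [set: 'I_N] \in lower_family.
Proof.
rewrite inE; apply/asboolP; exists (delta_mx 0 l0), (\sum_i `|pt i 0 l0|); split.
  by rewrite mxE !eqxx.
apply/finset.setP => i; rewrite !inE dotv_delta (bigD1 i) //=; symmetry.
apply: le_trans (ler_norm _) _; rewrite lerDl; exact: sumr_ge0.
Qed.

Lemma lower_split_halfspace r (f : 'I_N -> 'I_r.+1) (E : R) :
  (forall A j, A \in lower_family ->
    `|#|[set x in A | f x == j]|%:R - #|A|%:R / r.+1%:R| <= E) ->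
  forall v s j, `|#|[set x in [set i | dotv v (pt i) < s] | f x == j]|%:R -
    #|[set i | dotv v (pt i) < s]|%:R / r.+1%:R| <= 2 * E.
Proof.
move=> hE v s j.
have E0 : 0 <= E by apply: le_trans (hE _ j setT_lower); apply: normr_ge0.
set A := [set i | dotv v (pt i) < s]; have [h|h] := halfspace_lower v s.
  by have := hE _ j h; rewrite -/A; lra.
have h1 := hE _ j h; have h2 := hE _ j setT_lower; rewrite -/A in h1.
have e1 : #|[set x in [set: 'I_N] | f x == j]|%:R = #|[set x in A | f x == j]|%:R + #|[set x in ~: A | f x == j]|%:R :> R.
  rewrite -natrD -(cardsID A [set x in [set: 'I_N] | f x == j]); congr (_ + _)%N%:R.
    by apply: eq_card => x; rewrite !inE andbC.
  by apply: eq_card => x; rewrite !inE andbC.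
have e2 : #|[set: 'I_N]|%:R = #|A|%:R + #|~: A|%:R :> R.
  by rewrite -natrD cardsC cardsT.
rewrite e1 e2 in h2.
have tri (a a' b b' p E' : R) : `|a' - b' / p| <= E' -> `|a + a' - (b + b') / p| <= E' ->
    `|a - b / p| <= 2 * E'.
  move=> h3 h4; have -> : a - b / p = (a + a' - (b + b') / p) - (a' - b' / p) by ring.
  by apply: le_trans (ler_normB _ _) _; lra.
exact: tri h1 h2.
Qed.

End Halfspaces.

(** * Balanced partitions are tolerant *)

Section Tolerant.
Variables (R : realType) (d N r : nat) (pt : 'I_N -> 'rV[R]_d) (f : 'I_N -> 'I_r.+1).

Local Notation V := ('M[R]_(r.+1, d) * 'rV[R]_r.+1)%type.

(** The linear system for a common point. The unknown [y] collects the normal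
    vectors (a row for each part) and the constants of the separating functions.
    Constraints [inl] ask for nonnegativity on the remaining points; the pairs
    [inr] force the normal vectors to sum to zero. Multipliers for these
    constraints are convex combinations, one for each part, with the same value. *)
Definition sep_constraint (J : {set 'I_N}) (c : 'I_N + 'I_d * bool) (y : V) : R :=
  match c with
  | inl i => if i \in J then 0 else dotv (row (f i) y.1) (pt i) + y.2 0 (f i)
  | inr (l, s) => (if s then 1 else -1) * \sum_j y.1 j l
  end.

Lemma functional_sep_constraint J c : functional (sep_constraint J c).
Proof.
move=> a x y; case: c => [i|[l s]] /=.
  case: ifP => _; first by rewrite mulr0 addr0.
  have -> : row (f i) (a *: x.1 + y.1) = a *: row (f i) x.1 + row (f i) y.1.
    by apply/rowP => l; rewrite !mxE.
  by rewrite dotvD dotvZ !mxE; ring.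
have -> : \sum_j (a *: x.1 + y.1) j l = a * \sum_j x.1 j l + \sum_j y.1 j l.
  by rewrite mulr_sumr -big_split; apply: eq_bigr => j _; rewrite !mxE.
by ring.
Qed.

Lemma common_point_or_separation (J : {set 'I_N}) :
  (exists z, forall j,
     conv_hull [set x | exists i, [/\ f i = j, i \notin J & pt i = x]]%classic z) \/
  (exists (v : 'I_r.+1 -> 'rV[R]_d) (s : 'I_r.+1 -> R),
    (forall i, i \notin J -> 0 <= dotv (v (f i)) (pt i) + s (f i)) /\
    (forall x, \sum_j (dotv (v j) x + s j) < 0)).
Proof.
have lb : functional (fun y : V => \sum_j y.2 0 j).
  move=> a x y; rewrite mulr_sumr -big_split; apply: eq_bigr => j _.
  by rewrite !mxE.
have [[lam lam0 hlam]|[y hy by0]] := farkas_fin (functional_sep_constraint J) lb; [left|right].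
  exists (\row_l (lam (inr (l, false)) - lam (inr (l, true)))) => j.
  pose mu i := if (f i == j) && (i \notin J) then lam (inl i) else 0.
  have mu0 i : 0 <= mu i by rewrite /mu; case: ifP.
  have -> : \row_l (lam (inr (l, false)) - lam (inr (l, true))) = \sum_i mu i *: pt i.
    apply/rowP => l; rewrite mxE summxE.
    have := hlam (delta_mx j l, 0); rewrite /= big1; last by move=> k _; rewrite mxE.
    rewrite big_sumType /= => /esym.
    rewrite (eq_bigr (fun i => mu i * pt i 0 l)); last first.
      move=> i _; rewrite /mu; case: (boolP (i \in J)) => iJ; first by rewrite andbF mulr0 mul0r.
      rewrite andbT mxE addr0; case: eqP => [<-|ne].
        congr (_ * _); rewrite /dotv (bigD1 l) //= big1 ?addr0 ?mxE ?eqxx ?mul1r // => l' ll.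
        by rewrite !mxE (negbTE ll) andbF mul0r.
      rewrite /dotv big1 ?mulr0 ?mul0r // => l' _.
      by rewrite !mxE (introF eqP ne) mul0r.
    have -> : \sum_(c : 'I_d * bool) lam (inr c) * (let (l', s) := c in (if s then 1 else -1) * \sum_j0 (delta_mx j l : 'M[R]_(_, _)) j0 l')
       = lam (inr (l, true)) - lam (inr (l, false)).
      rewrite (eq_bigr (fun c => lam (inr (c.1, c.2)) * ((if c.2 then 1 else -1) * \sum_j0 (delta_mx j l : 'M[R]_(_, _)) j0 c.1))); last by case.
      rewrite -(pair_bigA _ (fun l' s => lam (inr (l', s)) * ((if s then 1 else -1) * \sum_j0 (delta_mx j l : 'M[R]_(_, _)) j0 l'))) /=.
      rewrite (bigD1 l) //= [X in _ + X]big1 ?addr0; last first.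
        move=> l' ll; rewrite big1 // => s _; rewrite big1 ?mulr0 // => k _.
        by rewrite mxE (negbTE ll) andbF.
      rewrite big_bool /= (bigD1 j) //= big1 ?addr0 ?mxE ?eqxx ?mulr1 ?mulrN1 // => k kj.
      by rewrite mxE (negbTE kj).
    move=> h; under [RHS]eq_bigr => i _ do rewrite mxE.
    by move: h; set S := \sum_(_ | _) _ => h; lra.
  apply: conv_hull_combination => //.
    move=> i; rewrite /mu; case: ifP => [/andP[/eqP fi iJ] _|]; last by rewrite eqxx.
    by exists i.
  have := hlam (0, delta_mx 0 j); rewrite /= (bigD1 j) //= mxE !eqxx big1 ?addr0; last first.
    by move=> k kj; rewrite mxE (negbTE kj) andbF.
  move=> h1; apply: (etrans _ (esym h1)); rewrite big_sumType /= [X in _ = _ + X]big1 ?addr0.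
    apply: eq_bigr => i _; rewrite /mu; case: (i \in J); first by rewrite andbF mulr0.
    rewrite andbT /dotv big1 ?add0r; last by move=> l _; rewrite !mxE mul0r.
    by rewrite mxE eqxx /=; case: eqP; rewrite ?mulr1 ?mulr0.
  by move=> [l s] _; rewrite big1 ?mulr0 // => k _; rewrite mxE.
exists (fun j => row j y.1), (fun j => y.2 0 j); split.
  by move=> i iJ; have := hy (inl i); rewrite /= (negbTE iJ).
move=> x; rewrite big_split /= /dotv exchange_big big1 ?add0r // => l _ /=.
under eq_bigr => j _ do rewrite mxE.
rewrite -mulr_suml.
have h1 := hy (inr (l, true)); have h2 := hy (inr (l, false)); rewrite /= in h1 h2.
have -> : \sum_j y.1 j l = 0 by move: h1 h2; set S := \sum_(_ | _) _; lra.
by rewrite mul0r.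
Qed.

(** Separating functions with negative sum define open halfspaces that cover the
    space. A balanced partition puts at least [N / r - r E] points into the
    matching parts of these halfspaces, and all of them have been removed. *)
Lemma common_point (E : R) (J : {set 'I_N}) t :
  (forall v s j, `|#|[set x in [set i | dotv v (pt i) < s] | f x == j]|%:R -
    #|[set i | dotv v (pt i) < s]|%:R / r.+1%:R| <= E) ->
  (#|J| <= t)%N -> (r.+1 * t)%:R + r.+1%:R ^+ 2 * E < N%:R ->
  exists z, forall j,
     conv_hull [set x | exists i, [/\ f i = j, i \notin J & pt i = x]]%classic z.
Proof.
move=> hE Jt hN; have [//|[v [s [hJ hneg]]]] := common_point_or_separation J.
pose A j := [set i | dotv (v j) (pt i) < - s j].
have cover : (N <= \sum_j #|A j|)%N.
  rewrite -[X in (X <= _)%N](card_ord N) -sum1_card.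
  under [X in (_ <= X)%N]eq_bigr => j _ do rewrite -sum1_card big_mkcond.
  rewrite exchange_big; apply: leq_sum => i _ /=.
  have [j hj] : exists j, dotv (v j) (pt i) + s j < 0.
    apply: contrapT => /forallNP h; have := hneg (pt i); rewrite ltNge => /negP; apply.
    by apply: sumr_ge0 => j _; rewrite leNgt; apply/negP; apply: h.
  by rewrite (bigD1 j) //= inE -subr_lt0 opprK hj.
have inJ : (\sum_j #|[set x in A j | f x == j]| <= t)%N.
  apply: leq_trans Jt; rewrite -sum1_card.
  under eq_bigr => j _ do rewrite -sum1_card big_mkcond.
  rewrite exchange_big [X in (_ <= X)%N]big_mkcond; apply: leq_sum => i _ /=.
  rewrite (bigD1 (f i)) //= [X in (_ + X)%N]big1 ?addn0; last first.
    by move=> j jf; rewrite !inE [f i == j]eq_sym (negbTE jf) andbF.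
  rewrite !inE eqxx andbT; case: ifP => // h.
  case: (boolP (i \in J)) => // /hJ; rewrite leNgt => /negP; case.
  by rewrite -subr_lt0 opprK in h.
have p0 : 0 < r.+1%:R :> R by rewrite ltr0n.
have h j : #|A j|%:R <= r.+1%:R * #|[set x in A j | f x == j]|%:R + r.+1%:R * E :> R.
  have := hE (v j) (- s j) j; rewrite -/(A j) ler_norml => /andP[h _].
  rewrite -mulrDr -ler_pdivrMl // [_^-1 * _]mulrC -lerBlDr.
  by move: h; rewrite -subr_ge0 => h; rewrite -subr_ge0; apply: le_trans h _; rewrite le_eqVlt; apply/orP; left; apply/eqP; ring.
have : N%:R <= r.+1%:R * t%:R + r.+1%:R ^+ 2 * E :> R.
  apply: le_trans (_ : (\sum_j #|A j|)%:R <= _); first by rewrite ler_nat.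
  rewrite natr_sum; apply: le_trans (ler_sum _ (fun j _ => h j)) _.
  rewrite big_split /= -mulr_sumr sumr_const card_ord -[X in _ + X]mulr_natl -natr_sum.
  by rewrite mulrA -expr2 lerD2r ler_pM2l // ler_nat.
by rewrite -natrM leNgt hN.
Qed.

End Tolerant.

Lemma setII_points (T : Type) (X : set T) N : (X #= `I_N)%card -> exists pt : 'I_N -> T,
  injective pt /\ X = [set x | exists i, pt i = x]%classic.
Proof.
rewrite card_eq_sym => /card_eqP[f].
have mem (i : 'I_N) : (i : nat) \in `I_N by rewrite inE /=; exact: ltn_ord.
exists (fun i => set_val (f (SigSub (mem i)))); split.
  move=> i j /val_inj h; apply: val_inj.
  have := @inj _ _ _ f _ _ (mem_set I) (mem_set I) h.
  by move/(congr1 set_val).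
rewrite eqEsubset; split=> [x Xx|x [i <-]]; last exact: set_valP.
have [[n nN] _ nE] := @surj _ _ _ _ f (SigSub (mem_set Xx)) I.
have nN' : (n < N)%N by move: (nN); rewrite inE.
exists (Ordinal nN'); have -> : SigSub (mem (Ordinal nN')) = SigSub nN by apply: val_inj.
by rewrite nE.
Qed.
Lemma card_points_le (T : Type) N t (pt : 'I_N -> T) (C : set T) : injective pt ->
  (C #<= `I_t)%card -> (#|[set i | `[< C (pt i) >]]| <= t)%N.
Proof.
move=> ipt Ct; rewrite leqNgt; apply/negP => h.
have [i0 _] : exists i, i \in [set i | `[< C (pt i) >]].
  by apply/card_gt0P; apply: leq_ltn_trans h.
set J := finset _ in h.
pose g n := pt (nth i0 (enum J) n).
have ginj : {in `I_#|J| &, injective g}%classic.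
  move=> m n; rewrite !inE /= => mJ nJ /ipt /eqP.
  by rewrite nth_uniq -?cardE ?enum_uniq // => /eqP.
have : (`I_#|J| #<= `I_t)%card.
  apply: card_le_trans Ct; rewrite -(card_le_eql (inj_card_eq ginj)).
  apply: subset_card_le => x [n nJ <-].
  have : nth i0 (enum J) n \in J by rewrite -mem_enum mem_nth // -cardE.
  by rewrite inE => /asboolP.
by rewrite card_le_II leqNgt h.
Qed.

Lemma conv_hull_sub (R : realType) d (A B : set 'rV[R]_d) :
  (A `<=` B)%classic -> (conv_hull A `<=` conv_hull B)%classic.
Proof. by move=> AB x hx M [cM BM]; apply: hx; split=> // y /AB /BM. Qed.

Lemma tolerant_of_balanced (R : realType) (d N r t : nat) (pt : 'I_N -> 'rV[R]_d)
    (f : 'I_N -> 'I_r.+1) (E : R) : injective pt ->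
  (forall v s j, `|#|[set x in [set i | dotv v (pt i) < s] | f x == j]|%:R -
    #|[set i | dotv v (pt i) < s]|%:R / r.+1%:R| <= E) ->
  (r.+1 * t)%:R + r.+1%:R ^+ 2 * E < N%:R ->
  tolerant_partition t [set x | exists i, pt i = x]%classic
    (fun j : 'I_r.+1 => [set x | exists i, f i = j /\ pt i = x]%classic).
Proof.
move=> ipt hE hN; split; last first.
  move=> C CX Ct; have Jt := card_points_le ipt Ct.
  have [z hz] := common_point hE Jt hN; exists z => j _.
  apply: conv_hull_sub (hz j) => x [i [fi iJ <-]]; split; first by exists i.
  by move=> Ci; move: iJ; rewrite inE => /asboolP.
split.
- rewrite eqEsubset; split=> [x [j _ [i [_ <-]]]|x [i <-]]; first by exists i.
  by exists (f i) => //; exists i.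
- by move=> j k _ _ [x [[i [fi <-]] [i' [fi' /ipt ii]]]]; rewrite -fi -fi' ii.
move=> j _; have [|z hz] := @common_point _ _ _ _ pt f E finset.set0 t hE _ hN.
  by rewrite cards0.
have [[x [i [fi _ _]]]|none] := pselect (exists x, exists i, [/\ f i = j, i \notin (finset.set0 : {set 'I_N}) & pt i = x]).
  by exists (pt i), i.
exfalso; have := hz j set0; apply; split; first by move=> x y k; rewrite inE.
by move=> x hx; apply: none; exists x.
Qed.

Lemma tolerant_Tverberg_upper (R : realType) (d r : nat) : (2 <= d)%N -> (0 < r)%N ->
  exists2 C : R, 0 < C & forall t N : nat,
    (r * t)%:R + C * (N%:R `^ disc_exponent R d + 1) < N%:R ->
    tolerant_Tverberg_number R t d r N.
Proof.
move=> d2; case: r => // r _; have [C0 C00 hC0] := vc_herdisc R d2.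
have rr : 0 < r.+1%:R :> R by rewrite ltr0n.
pose C := r.+1%:R ^+ 2 * (2 * r.+1%:R * (C0 + 1)).
exists C; first by rewrite /C !mulr_gt0 ?exprn_gt0 // addr_gt0.
move=> t N hN X XN; have [pt [ipt ->]] := setII_points XN.
have l0 : 'I_d by exact: Ordinal (ltnW d2).
have hD := hC0 _ _ (@vc_lower_family R d N pt l0).
rewrite card_ord in hD.
set p := N%:R `^ _ in hD hN.
have p0 : 0 <= p by exact: powR_ge0.
have D0 : 0 <= C0 * p by rewrite mulr_ge0 // ltW.
have [f hf] := @split_parts _ _ _ _ r D0 hD [set: 'I_N].
exists (fun j => [set x | exists i, f i = j /\ pt i = x]%classic).
apply: (@tolerant_of_balanced _ _ _ _ _ pt f (2 * (r%:R * (C0 * p + 1)))) => //.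
  apply: lower_split_halfspace => A j AF; have := hf A j AF.
  by rewrite finset.setIT.
apply: le_lt_trans hN; rewrite lerD2l /C -!mulrA ler_wpM2l ?exprn_ge0 // ler_pM2l //.
have q : C0 * p + 1 <= (C0 + 1) * (p + 1) by nra.
have rn : r%:R <= r.+1%:R :> R by rewrite ler_nat.
have q0 : 0 <= C0 * p + 1 by rewrite addr_ge0.
apply: ler_pM => //; first exact: mulr_ge0.
exact: ler_pM.
Qed.

(** * Exponential sums *)

Section UnitCircle.
Variable R : realType.
Implicit Types (z w : R[i]).

(** The squared modulus as a real number, which keeps all estimates in the real
    field. *)
Definition nsq z : R := complex.Re z ^+ 2 + complex.Im z ^+ 2.

Lemma nsq_ge0 z : 0 <= nsq z.
Proof. by rewrite addr_ge0 ?sqr_ge0. Qed.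

Lemma nsqM z w : nsq (z * w) = nsq z * nsq w.
Proof. by case: z => a b; case: w => c d; rewrite /nsq /=; ring. Qed.

Lemma nsqE z : nsq z = complex.Re (z * conjc z).
Proof. by case: z => a b; rewrite /nsq /=; ring. Qed.

Lemma nsqD_le z w : nsq (z + w) <= 2 * nsq z + 2 * nsq w.
Proof.
case: z => a b; case: w => c e; rewrite /nsq /=.
have := sqr_ge0 (a - c); have := sqr_ge0 (b - e); nra.
Qed.

Lemma ReM_conj_le z w : complex.Re (z * conjc w) <= (nsq z + nsq w) / 2.
Proof.
case: z => a b; case: w => c e; rewrite /nsq /=.
have := sqr_ge0 (a - c); have := sqr_ge0 (b - e); nra.
Qed.

Lemma Re_sum (I : finType) (P : pred I) (F : I -> R[i]) :
  complex.Re (\sum_(i | P i) F i) = \sum_(i | P i) complex.Re (F i).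
Proof. by elim/big_rec2: _ => // i y1 y2 _ <-; case: (F i); case: y2. Qed.

Definition cis (t : R) : R[i] := Complex (cos t) (sin t).

Lemma cis0 : cis 0 = 1.
Proof. by rewrite /cis cos0 sin0. Qed.

Lemma cisD s t : cis (s + t) = cis s * cis t.
Proof. by rewrite /cis cosD sinD; congr Complex; ring. Qed.

Lemma cisX t n : cis t ^+ n = cis (t * n%:R).
Proof.
elim: n => [|n IH]; first by rewrite expr0 mulr0 cis0.
by rewrite exprS IH -cisD -natr1 mulrDr mulr1 addrC.
Qed.

Lemma conj_cis t : conjc (cis t) = cis (- t).
Proof. by rewrite /cis cosN sinN. Qed.

Lemma nsq_cis t : nsq (cis t) = 1.
Proof. by rewrite /nsq /= cos2Dsin2. Qed.

Lemma cis_conj t : cis t * conjc (cis t) = 1.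
Proof. by rewrite conj_cis -cisD subrr cis0. Qed.

Lemma cis_2pi : cis (2 * pi) = 1.
Proof. by rewrite /cis mulr_natl cos2pi sin2pi. Qed.

Lemma nsq_1Bcis t : nsq (1 - cis t) = 2 - 2 * cos t.
Proof. by rewrite /nsq /=; have := cos2Dsin2 t; move: (cos t) (sin t) => c s; rewrite add0r; nra. Qed.

Lemma sin_le (x : R) : 0 <= x -> sin x <= x.
Proof.
move=> x0.
have [|c _] := @MVT_segment R sin cos 0 x x0 (fun y _ => is_derive_sin y).
  by apply: continuous_subspaceT => y; apply: continuous_sin.
rewrite sin0 !subr0 => ->; rewrite ler_piMl // cos_le1 //.
Qed.

Lemma nsq_1Bcis_le t : 0 <= t -> t <= pi -> nsq (1 - cis t) <= t ^+ 2.
Proof.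
move=> t0 tpi; rewrite nsq_1Bcis.
have -> : cos t = 1 - 2 * sin (t / 2) ^+ 2.
  rewrite -[in LHS](@divfK _ 2 _ t) // mulr_natr cos_mulr2n sin2cos2; lra.
have h1 := @sin_le (t / 2); have h2 := @sin_ge0_pi R (t / 2).
have {}h1 : sin (t / 2) <= t / 2 by apply: h1; lra.
have {}h2 : 0 <= sin (t / 2) by apply: h2; apply/andP; split; lra.
nra.
Qed.

Lemma cis_neq1 t : 0 < t -> t < 2 * pi -> cis t != 1.
Proof.
move=> t0 t2; apply/eqP => h; have := nsq_1Bcis t; rewrite h subrr.
have -> : cos t = 1 - 2 * sin (t / 2) ^+ 2.
  rewrite -[in LHS](@divfK _ 2 _ t) // mulr_natr cos_mulr2n sin2cos2; lra.
have s0 : 0 < sin (t / 2) by apply: sin_gt0_pi; apply/andP; split; lra.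
rewrite /nsq /=; nra.
Qed.

Lemma geometric_sum (V : comNzRingType) (w : V) n : (1 - w) * \sum_(h < n) w ^+ h = 1 - w ^+ n.
Proof.
by rewrite -[1 - w]opprB mulNr -subrX1 opprB.
Qed.

Lemma cauchy_schwarz (I : finType) (P : pred I) (a b : I -> R) :
  (\sum_(i | P i) a i * b i) ^+ 2 <= (\sum_(i | P i) a i ^+ 2) * (\sum_(i | P i) b i ^+ 2).
Proof.
rewrite -subr_ge0.
suff -> : (\sum_(i | P i) a i ^+ 2) * (\sum_(i | P i) b i ^+ 2) - (\sum_(i | P i) a i * b i) ^+ 2 =
  (\sum_(i | P i) \sum_(j | P j) (a i * b j - a j * b i) ^+ 2) / 2.
  by rewrite divr_ge0 // sumr_ge0 // => i _; rewrite sumr_ge0 // => j _; apply: sqr_ge0.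
have E (f g : I -> R) : (\sum_(i | P i) f i) * (\sum_(i | P i) g i) =
  \sum_(i | P i) \sum_(j | P j) f i * g j by rewrite big_distrlr.
have -> : \sum_(i | P i) \sum_(j | P j) (a i * b j - a j * b i) ^+ 2 =
  \sum_(i | P i) \sum_(j | P j) a i ^+ 2 * b j ^+ 2 + \sum_(i | P i) \sum_(j | P j) b i ^+ 2 * a j ^+ 2
  - 2 * \sum_(i | P i) \sum_(j | P j) (a i * b i) * (a j * b j).
  rewrite mulr_sumr -big_split -sumrB; apply: eq_bigr => i _.
  rewrite mulr_sumr -big_split -sumrB; apply: eq_bigr => j _ /=; ring.
rewrite -!E; set A := \sum_(i | P i) a i ^+ 2; set B := \sum_(i | P i) b i ^+ 2.
by set S := \sum_(i | P i) a i * b i; field.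
Qed.

Lemma nsq_sum_cis_le (t : R) n : nsq (\sum_(h < n) cis t ^+ h) <= n%:R ^+ 2.
Proof.
have H (f : 'I_n -> R) : (\sum_i f i) ^+ 2 <= n%:R * \sum_i f i ^+ 2.
  have := cauchy_schwarz xpredT (fun _ => 1) f.
  rewrite (eq_bigr f); last by move=> i _; rewrite mul1r.
  by rewrite [X in _ <= X * _](eq_bigr (fun _ => 1)) ?sumr_const ?card_ord // => i _; rewrite expr1n.
rewrite /nsq Re_sum.
have -> : complex.Im (\sum_(h < n) cis t ^+ h) = \sum_(h < n) complex.Im (cis t ^+ h).
  by elim/big_rec2: _ => // i y1 y2 _ <-; case: (_ ^+ _); case: y2.
apply: le_trans (lerD (H _) (H _)) _; rewrite -mulrDr -big_split /= expr2 ler_wpM2l //.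
rewrite (eq_bigr (fun _ => 1)) ?sumr_const ?card_ord // => i _.
by have := nsq_cis (t * i%:R); rewrite -cisX.
Qed.

End UnitCircle.

Section ExponentialSums.
Variable R : realType.

Definition root_cis (q : nat) : R[i] := cis (2 * pi / q%:R).

Lemma cis_2piMn n : cis (2 * pi * n%:R) = 1 :> R[i].
Proof. by rewrite -cisX cis_2pi expr1n. Qed.

Lemma root_cis_ortho q a b : (0 < q)%N -> (a < q)%N -> (b < q)%N ->
  \sum_(k < q) (root_cis q ^+ a * conjc (root_cis q) ^+ b) ^+ k = (q * (a == b))%:R.
Proof.
move=> q0 aq bq; have q0' : 0 < q%:R :> R by rewrite ltr0n.
have pi0 : 0 < pi :> R := pi_gt0 R.
rewrite /root_cis conj_cis !cisX -cisD; set t := _ + _.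
have tE : t = 2 * pi * (a%:R - b%:R) / q%:R by rewrite /t; field; apply: lt0r_neq0.
case: eqVneq => [ab|ab].
  rewrite tE ab subrr mulr0 mul0r cis0 muln1.
  by under eq_bigr => k _ do rewrite expr1n; rewrite sumr_const card_ord.
rewrite muln0; have := geometric_sum (cis t) q.
have -> : cis t ^+ q = 1.
  rewrite cisX tE divfK ?lt0r_neq0 // mulrBr cisD cis_2piMn mul1r.
  by rewrite -conj_cis cis_2piMn conjc1.
rewrite subrr => /eqP; rewrite mulf_eq0 => /orP[|/eqP //].
rewrite subr_eq0 eq_sym => /eqP ct.
have ctN : cis (- t) = 1 by rewrite -conj_cis ct conjc1.
have aq' : a%:R < q%:R :> R by rewrite ltr_nat.
have bq' : b%:R < q%:R :> R by rewrite ltr_nat.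
have a0 : 0 <= a%:R :> R by [].
have b0 : 0 <= b%:R :> R by [].
exfalso; move: ab; rewrite neq_ltn -!(ltr_nat R) => /orP[ab|ab].
  have /eqP := ctN; apply/negP; apply: cis_neq1; rewrite tE -mulNr -mulrN opprB.
    by rewrite divr_gt0 // !mulr_gt0 // subr_gt0.
  by rewrite ltr_pdivrMr // -!mulrA ltr_pM2l // ltr_pM2l //; lra.
have /eqP := ct; apply/negP; apply: cis_neq1; rewrite tE.
  by rewrite divr_gt0 // !mulr_gt0 // subr_gt0.
by rewrite ltr_pdivrMr // -!mulrA ltr_pM2l // ltr_pM2l //; lra.
Qed.

Lemma nsq_1Broot q : (0 < q)%N -> nsq (1 - root_cis q) <= 64 / q%:R ^+ 2.
Proof.
move=> q0; have q0' : 0 < q%:R :> R by rewrite ltr0n.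
have pi0 : 0 < pi :> R := pi_gt0 R.
case: (eqVneq q 1%N) => [->|q1].
  by rewrite /root_cis divr1 cis_2pi subrr /nsq /= expr0n /= addr0 divr_ge0 // exprn_ge0.
have q2 : 2 <= q%:R :> R by rewrite ler_nat; case: q q0 q1 {q0'} => [|[|]].
apply: le_trans (nsq_1Bcis_le _ _) _.
- by rewrite divr_ge0 // mulr_ge0 // ltW.
- by rewrite ler_pdivrMr // mulrC ler_pM2l.
rewrite expr_div_n ler_pM2r ?invr_gt0 ?exprn_gt0 //.
have := @pihalf_lt2 R; nra.
Qed.

(** Some number [k] of steps by the given angle leads to the left half plane, at
    distance at least [sqrt 2] from [1]; a single step covers at least a [k]-th
    of that distance. *)
Lemma nsq_1Bcis_ge p q q' : (0 < p)%N -> (p <= q)%N -> (q < q')%N -> (q' <= 2 * p)%N ->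
  (q' - q)%:R ^+ 2 <= 2 * p%:R ^+ 4 * nsq (1 - cis (2 * pi / q%:R - 2 * pi / q'%:R) : R[i]).
Proof.
move=> p0 pq qq' q'p; set t : R := 2 * pi / q%:R - 2 * pi / q'%:R; set m := (q' - q)%N.
have q0 : (0 < q)%N by apply: leq_trans pq.
have q'0 : (0 < q')%N by apply: leq_trans qq'.
have rq : 0 < q%:R :> R by rewrite ltr0n.
have rq' : 0 < q'%:R :> R by rewrite ltr0n.
have m0 : (0 < m)%N by rewrite subn_gt0.
have rm : 0 < m%:R :> R by rewrite ltr0n.
have pi0 : 0 < pi :> R := pi_gt0 R.
have mE : q'%:R = q%:R + m%:R :> R by rewrite -natrD subnKC // ltnW.
have tE : t = 2 * pi * m%:R / (q * q')%:R.
  rewrite /t natrM (_ : m%:R = q'%:R - q%:R); last by rewrite mE; ring.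
  by field; apply/andP; split; apply: lt0r_neq0.
(* The angle is [2 pi m / (q q')]; this is the largest [k] with [k t <=
   pi]. *)
pose k := (q * q' %/ (2 * m))%N.
have k1 : (2 * m * k <= q * q')%N by rewrite /k mulnC leq_divM.
have k2 : (q * q' < 2 * m * k.+1)%N by rewrite /k [X in (_ < X)%N]mulnC ltn_ceil // muln_gt0.
have k0 : (0 < k)%N by rewrite divn_gt0 ?muln_gt0 // /m; nia.
have k3 : (q * q' <= 4 * m * k)%N by nia.
have qq0 : 0 < (q * q')%:R :> R by rewrite ltr0n muln_gt0 q0.
have rk : 0 < k%:R :> R by rewrite ltr0n.
have ck : cos (t * k%:R) <= 0.
  have -> : t * k%:R = (t * k%:R - pi / 2) + pi / 2 by ring.
  rewrite cosDpihalf oppr_le0 sin_ge0_pi //.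
  move: k1 k3; rewrite -!(ler_nat R) !natrM tE; rewrite natrM in qq0 *.
  set Q := q%:R * q'%:R in qq0 * => k1 k3.
  have -> : 2 * pi * m%:R / Q * k%:R = pi * (2 * m%:R * k%:R / Q) by ring.
  have h1 : 2 * m%:R * k%:R / Q <= 1 by rewrite ler_pdivrMr // mul1r.
  have h3 : 1 / 2 <= 2 * m%:R * k%:R / Q by rewrite ler_pdivlMr //; lra.
  by apply/andP; split; nra.
have hk : nsq (1 - cis t) * k%:R ^+ 2 >= 2.
  apply: le_trans (_ : nsq (1 - cis t ^+ k) <= _).
    by rewrite cisX nsq_1Bcis; lra.
  rewrite -geometric_sum nsqM ler_wpM2l ?nsq_ge0 //; exact: nsq_sum_cis_le.
have kp : m%:R * k%:R <= 2 * p%:R ^+ 2 :> R.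
  rewrite -natrX -!natrM ler_nat.
  have : (q * q' <= (2 * p) * (2 * p))%N by apply: leq_mul => //; apply: leq_trans q'p; apply: ltnW.
  by move: k1; rewrite expnS expn1; nia.
have mk0 : 0 <= m%:R * k%:R :> R by rewrite mulr_ge0.
have kp2 : (m%:R * k%:R) ^+ 2 <= 4 * p%:R ^+ 4 :> R.
  rewrite (_ : 4 * p%:R ^+ 4 = (2 * p%:R ^+ 2) ^+ 2); last by ring.
  by rewrite lerXn2r ?nnegrE ?mulr_ge0 ?exprn_ge0.
rewrite -(ler_pM2r (_ : 0 < k%:R ^+ 2)) ?exprn_gt0 // -exprMn.
apply: le_trans kp2 _.
have : 0 <= p%:R ^+ 4 :> R by rewrite exprn_ge0.
move: hk; set z := nsq _; set y := p%:R ^+ 4; set w := k%:R ^+ 2 => hk y0.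
have := ler_wpM2l y0 hk; lra.
Qed.

(** Each side of [i] contributes at most [sum 1 / j ^ 2 <= 2]. *)
Lemma sum_inv_sq n (i : 'I_n) : \sum_(j < n | j != i) (`|(i : nat)%:Z - (j : nat)%:Z|%N)%:R ^- 2 <= 4 :> R.
Proof.
have H m : \sum_(j < m) j.+1%:R ^- 2 <= 2 :> R.
  case: m => [|m]; first by rewrite big_ord0.
  suff : \sum_(j < m.+1) j.+1%:R ^- 2 <= 2 - m.+1%:R^-1 :> R.
    by move=> h; apply: le_trans h _; rewrite lerBlDr lerDl invr_ge0.
  elim: m => [|m IH]; first by rewrite big_ord_recl big_ord0 expr1n invr1; lra.
  rewrite big_ord_recr /=; apply: le_trans (lerD IH (lexx _)) _.
  rewrite -(natr1 m.+1); have : 0 < m.+1%:R :> R by []. move: (m.+1%:R : R) => x x0.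
  have x1 : 0 < x + 1 by rewrite addr_gt0.
  rewrite -subr_ge0.
  have -> : 2 - (x + 1)^-1 - (2 - x^-1 + (x + 1) ^- 2) = (x * (x + 1) ^+ 2)^-1.
    by field; apply/andP; split; apply: lt0r_neq0.
  by rewrite invr_ge0 mulr_ge0 ?exprn_ge0 // ltW.
pose F (j : nat) : R := (`|(i : nat)%:Z - j%:Z|%N)%:R ^- 2.
rewrite -(big_mkord (fun j => j != i :> nat) F) (big_cat_nat (n := i)) //=; last by rewrite ltnW.
rewrite (_ : 4 = 2 + 2 :> R); last by ring.
apply: lerD.
  rewrite big_mkord (reindex_inj rev_ord_inj) /=; apply: le_trans (H i).
  rewrite [X in _ <= X](bigID (fun j : 'I_i => (i - j.+1)%N != i)) /= -[X in X <= _]addr0.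
  apply: lerD; last by rewrite sumr_ge0 // => j _; rewrite invr_ge0 exprn_ge0.
  apply: ler_sum => j _; rewrite /F; suff -> : `|(i : nat)%:Z - (i - j.+1)%N%:Z|%N = j.+1 by [].
  by have := ltn_ord j; lia.
rewrite big_ltn_cond // eqxx /= -{1}[(i : nat).+1]add0n big_addn big_mkord.
rewrite (eq_bigl xpredT); last by move=> j /=; apply/eqP; lia.
apply: le_trans (H (n - i.+1)%N); apply: ler_sum => j _; rewrite /F.
suff -> : `|(i : nat)%:Z - (j + i.+1)%N%:Z|%N = j.+1 by [].
by lia.
Qed.

End ExponentialSums.

Section LargeSieve.
Variable R : realType.
Local Notation rC := (real_complex R).
Local Arguments conjc : simpl never.
Local Arguments cis : simpl never.

Lemma nsq_rC (x : R) : nsq (rC x) = x ^+ 2.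
Proof. by rewrite /nsq /= expr0n addr0. Qed.

Lemma Re_rCM (x : R) (z : R[i]) : complex.Re (rC x * z) = x * complex.Re z.
Proof. by case: z => a b /=; ring. Qed.

Lemma mul_conj (z : R[i]) : z * conjc z = rC (nsq z).
Proof.
case: z => a b; apply/eqP; rewrite eq_complex /nsq /=.
by apply/andP; split; apply/eqP; ring.
Qed.

Lemma conjcM (z w : R[i]) : conjc (z * w) = conjc z * conjc w.
Proof. exact: rmorphM. Qed.

Lemma conjcX (z : R[i]) n : conjc (z ^+ n) = conjc z ^+ n.
Proof. exact: rmorphXn. Qed.

Lemma conjc_sum (I : finType) (F : I -> R[i]) :
  conjc (\sum_i F i) = \sum_i conjc (F i).
Proof. exact: rmorph_sum. Qed.

Lemma nsqX (z : R[i]) n : nsq (z ^+ n) = nsq z ^+ n.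
Proof.
elim: n => [|n IH]; first by rewrite !expr0 /nsq /=; ring.
by rewrite !exprS nsqM IH.
Qed.

Lemma nsqN (z : R[i]) : nsq (- z) = nsq z.
Proof. by case: z => a b; rewrite /nsq /=; ring. Qed.

Lemma nsq1Bcis_sym (t : R) : nsq (1 - cis (- t)) = nsq (1 - cis t).
Proof. by rewrite !nsq_1Bcis cosN. Qed.

Variables (p M : nat).
Hypotheses (p0 : (0 < p)%N) (pM : (p ^ 2 <= M)%N).

Let z (i : 'I_p) : R[i] := root_cis R (p + i).

Lemma conj_z i : z i * conjc (z i) = 1.
Proof. exact: cis_conj. Qed.

(** The frequencies [1 / (p + i)] are separated by a multiple of [|i - j| / p ^
    2]; the geometric sum is at most [2] divided by the distance of its ratio to
    [1]. *)
Lemma correlation_bound (i j : 'I_p) : j != i ->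
  nsq (\sum_(h < 2 * M) (z i * conjc (z j)) ^+ h) <=
  8 * p%:R ^+ 4 * (`|(i : nat)%:Z - (j : nat)%:Z|%N)%:R ^- 2.
Proof.
move=> ji; set m := `|_|%N; set t : R := 2 * pi / (p + i)%:R - 2 * pi / (p + j)%:R.
have -> : z i * conjc (z j) = cis t by rewrite /z /root_cis conj_cis -cisD.
have m0 : (0 < m)%N.
  rewrite /m lt0n; apply: contra ji => /eqP h; apply/eqP/val_inj; move: h => /=; lia.
have rm : 0 < m%:R ^+ 2 :> R by rewrite exprn_gt0 // ltr0n.
have hm : m%:R ^+ 2 <= 2 * p%:R ^+ 4 * nsq (1 - cis t).
  have [ij|ij|ij] := ltngtP i j; last by rewrite (val_inj ij) eqxx in ji.
    have := @nsq_1Bcis_ge R p (p + i) (p + j) p0 (leq_addr _ _).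
    rewrite ltn_add2l ij => /(_ isT); rewrite subnDl.
    have -> : m = (j - i)%N by rewrite /m; lia.
    by apply; have := ltn_ord j; lia.
  have := @nsq_1Bcis_ge R p (p + j) (p + i) p0 (leq_addr _ _).
  rewrite ltn_add2l ij => /(_ isT); rewrite subnDl -nsq1Bcis_sym opprB.
  have -> : m = (i - j)%N by rewrite /m; lia.
  by apply; have := ltn_ord i; lia.
rewrite ler_pdivlMr //; set S := \sum_(_ < _) _.
have SE : nsq (1 - cis t) * nsq S <= 4.
  rewrite -nsqM geometric_sum; apply: le_trans (nsqD_le _ _) _.
  rewrite nsqN nsqX nsq_cis expr1n (_ : nsq 1 = 1); last by rewrite /nsq /=; ring.
  lra.
have S0 : 0 <= nsq S by exact: nsq_ge0.
have p4 : 0 <= p%:R ^+ 4 :> R by rewrite exprn_ge0.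
apply: le_trans (ler_wpM2l S0 hm) _.
have := ler_wpM2l p4 SE; lra.
Qed.

Lemma correlation_diag (i : 'I_p) :
  nsq (\sum_(h < 2 * M) (z i * conjc (z i)) ^+ h) = (2 * M)%:R ^+ 2.
Proof.
rewrite conj_z; under eq_bigr => h _ do rewrite expr1n.
by rewrite sumr_const card_ord -[_ *+ _](rmorph_nat rC) nsq_rC.
Qed.

(** Opening the square turns the double sum over the window into the squared
    geometric sums of the correlations: this is the Fejer kernel, whose
    quadratic decay makes the row sums of the Gram matrix bounded without a
    logarithm. *)
Lemma window_sum (b : 'I_p -> R[i]) :
  \sum_(h < 2 * M) \sum_(h' < 2 * M) nsq (\sum_i b i * (z i ^+ h * conjc (z i) ^+ h')) =
  \sum_i \sum_j complex.Re (b i * conjc (b j)) *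
     nsq (\sum_(h < 2 * M) (z i * conjc (z j)) ^+ h).
Proof.
have E h h' : nsq (\sum_i b i * (z i ^+ h * conjc (z i) ^+ h')) =
  complex.Re (\sum_i \sum_j (b i * conjc (b j)) *
     ((z i * conjc (z j)) ^+ h * conjc (z i * conjc (z j)) ^+ h')).
  rewrite nsqE conjc_sum big_distrlr; congr complex.Re.
  apply: eq_bigr => i _; apply: eq_bigr => j _.
  rewrite !conjcM !conjcX !conjcK !exprMn /=; ring.
under eq_bigr => h _ do under eq_bigr => h' _ do rewrite E.
under eq_bigr => h _ do rewrite -Re_sum.
rewrite -Re_sum.
have -> : \sum_i \sum_j complex.Re (b i * conjc (b j)) *
     nsq (\sum_(h < 2 * M) (z i * conjc (z j)) ^+ h) = complex.Re (\sum_i \sum_j b i * conjc (b j) *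
     ((\sum_(h < 2 * M) (z i * conjc (z j)) ^+ h) * conjc (\sum_(h < 2 * M) (z i * conjc (z j)) ^+ h))).
  rewrite Re_sum; apply: eq_bigr => i _; rewrite Re_sum; apply: eq_bigr => j _.
  by rewrite mul_conj [b i * _ * _]mulrC Re_rCM mulrC.
congr complex.Re.
under eq_bigr => h _ do rewrite exchange_big.
rewrite exchange_big; apply: eq_bigr => i _ /=.
under eq_bigr => h _ do rewrite exchange_big.
rewrite exchange_big; apply: eq_bigr => j _ /=.
under eq_bigr => h _ do rewrite -mulr_sumr.
rewrite -mulr_sumr; congr (_ * _); rewrite conjc_sum big_distrlr.
by apply: eq_bigr => h _; apply: eq_bigr => h' _; rewrite conjcX.
Qed.

(** Every difference [s < M] occurs at least [M] times as [h - h'] in the window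
    of length [2 M]. *)
Lemma dual_large_sieve (b : 'I_p -> R[i]) :
  \sum_(s < M) nsq (\sum_i b i * z i ^+ s) <= (36 * M)%:R * \sum_i nsq (b i).
Proof.
have M0 : (0 < M)%N by apply: leq_trans pM; rewrite expn_gt0 p0.
have rM : 0 < M%:R :> R by rewrite ltr0n.
rewrite -(ler_pM2l rM).
pose W (h h' : nat) := nsq (\sum_i b i * (z i ^+ h * conjc (z i) ^+ h')).
have W0 h h' : 0 <= W h h' by exact: nsq_ge0.
apply: le_trans (_ : \sum_(h' < 2 * M) \sum_(h < 2 * M) W h h' <= _).
  apply: le_trans (_ : \sum_(h' < M) \sum_(h < 2 * M) W h h' <= _); last first.
    rewrite -!(big_mkord xpredT (fun h' => \sum_(h < 2 * M) W h h')).
    rewrite [X in _ <= X](big_cat_nat (n := M)) //=; last by rewrite leq_pmull.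
    by rewrite lerDl sumr_ge0 // => h' _; rewrite sumr_ge0.
  have -> (x : R) : M%:R * x = \sum_(h' < M) x by rewrite sumr_const card_ord mulr_natl.
  apply: ler_sum => h' _.
  rewrite -(big_mkord xpredT (fun h => W h h')) (big_cat_nat (n := h')) //=; last first.
    by have := ltn_ord h'; lia.
  rewrite [X in _ + X](big_cat_nat (n := h' + M)) //=; [|lia|]; last first.
    by have := ltn_ord h'; lia.
  rewrite addrCA -[X in X <= _]addr0; apply: lerD; last first.
    by rewrite addr_ge0 // sumr_ge0.
  rewrite -{1}[(h' : nat)]add0n big_addn addKn big_mkord.
  apply: ler_sum => s _; rewrite le_eqVlt; apply/orP; left; apply/eqP.
  congr nsq; apply: eq_bigr => i _; congr (_ * _).
  by rewrite exprD -mulrA -exprMn conj_z expr1n mulr1.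
rewrite exchange_big window_sum.
pose K (i j : 'I_p) := nsq (\sum_(h < 2 * M) (z i * conjc (z j)) ^+ h).
have K0 i j : 0 <= K i j by exact: nsq_ge0.
have Ksym i j : K i j = K j i.
  rewrite /K !nsqE; congr complex.Re; rewrite mulrC; congr (_ * _).
    rewrite conjc_sum; apply: eq_bigr => h _.
    by rewrite conjcX conjcM conjcK mulrC.
  rewrite conjc_sum; apply: eq_bigr => h _.
  by rewrite conjcX conjcM conjcK mulrC.
have row i : \sum_j K i j <= (36 * M)%:R * M%:R.
  rewrite (bigD1 i) //= /K correlation_diag.
  apply: le_trans (_ : (2 * M)%:R ^+ 2 + 8 * p%:R ^+ 4 * 4 <= _).
    rewrite lerD2l; apply: le_trans (ler_sum _ (fun j ji => correlation_bound ji)) _.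
    by rewrite -mulr_sumr ler_wpM2l ?mulr_ge0 ?exprn_ge0 // sum_inv_sq.
  have : p%:R ^+ 4 <= M%:R ^+ 2 :> R.
    rewrite -!natrX ler_nat; apply: leq_trans (_ : (p ^ 2) ^ 2 <= _)%N; first by rewrite -expnM.
    by rewrite leq_exp2r.
  by rewrite !natrM expr2; lra.
apply: le_trans (_ : \sum_i \sum_j (nsq (b i) + nsq (b j)) / 2 * K i j <= _).
  apply: ler_sum => i _; apply: ler_sum => j _; rewrite ler_wpM2r ?nsq_ge0 //.
  exact: ReM_conj_le.
have -> : \sum_i \sum_j (nsq (b i) + nsq (b j)) / 2 * K i j = \sum_i nsq (b i) * \sum_j K i j.
  have -> : \sum_i \sum_j (nsq (b i) + nsq (b j)) / 2 * K i j =
    \sum_i \sum_j nsq (b i) / 2 * K i j + \sum_i \sum_j nsq (b j) / 2 * K i j.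
    rewrite -big_split; apply: eq_bigr => i _; rewrite -big_split; apply: eq_bigr => j _ /=.
    ring.
  rewrite [X in _ + X]exchange_big -big_split; apply: eq_bigr => i _ /=.
  rewrite -big_split mulr_sumr; apply: eq_bigr => j _ /=; rewrite (Ksym j i).
  by field.
rewrite !mulr_sumr; apply: ler_sum => i _.
by rewrite mulrA [M%:R * _]mulrC [X in _ <= X]mulrC ler_wpM2l ?nsq_ge0.
Qed.

(** Duality with [dual_large_sieve] by the Cauchy-Schwarz inequality. *)
Lemma large_sieve (a : 'I_M -> R) :
  \sum_i nsq (\sum_s rC (a s) * z i ^+ s) <= (36 * M)%:R * \sum_s a s ^+ 2.
Proof.
pose Y i := \sum_s rC (a s) * z i ^+ s.
pose beta (s : 'I_M) := complex.Re (\sum_i conjc (Y i) * z i ^+ s).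
set N := \sum_i nsq _; have NY : N = \sum_i nsq (Y i) by [].
have NE : N = \sum_s a s * beta s.
  rewrite NY; under eq_bigr => i _ do rewrite nsqE {1}/Y mulr_suml Re_sum.
  rewrite exchange_big; apply: eq_bigr => s _ /=; rewrite /beta Re_sum mulr_sumr.
  by apply: eq_bigr => i _; rewrite -mulrA Re_rCM mulrC [z i ^+ s * _]mulrC mulrC.
have N0 : 0 <= N by rewrite sumr_ge0 // => i _; apply: nsq_ge0.
(* The dual inequality is applied to the conjugates of the sums themselves. *)
have conjN (w : R[i]) : nsq (conjc w) = nsq w by case: w => x y; rewrite /nsq /=; ring.
have hb : \sum_s beta s ^+ 2 <= (36 * M)%:R * N.
  rewrite NY; under [X in _ <= _ * X]eq_bigr => i _ do rewrite -conjN.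
  apply: le_trans (dual_large_sieve (fun i => conjc (Y i))).
  by apply: ler_sum => s _; rewrite /beta /nsq lerDl sqr_ge0.
have A0 : 0 <= \sum_s a s ^+ 2 by rewrite sumr_ge0 // => s _; apply: sqr_ge0.
case: (eqVneq N 0) => [->|Nn0]; first by rewrite mulr_ge0.
have Np : 0 < N by rewrite lt0r Nn0.
rewrite -(ler_pM2r Np) -expr2 {1}NE; apply: le_trans (cauchy_schwarz _ _ _) _.
by rewrite [X in _ <= X * _]mulrC -mulrA ler_wpM2l.
Qed.

End LargeSieve.

Section Grid.
Variables (R : realType) (d p : nat).
Local Notation rC := (real_complex R).
Local Arguments conjc : simpl never.
Local Arguments cis : simpl never.

Definition gdot m (v : {ffun 'I_d -> 'I_m}) (x : {ffun 'I_d -> 'I_p}) : nat :=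
  (\sum_l v l * x l)%N.

(** The frequencies [v / q], for all [v] modulo [q], form an orthogonal system
    on a grid of side at most [q]. *)
Lemma parseval q m (chi : {ffun 'I_d -> 'I_p} -> R) : (0 < q)%N -> (p <= q)%N -> (q <= m)%N ->
  \sum_(v : {ffun 'I_d -> 'I_m} | v \in ffun_on (fun k : 'I_m => (k < q)%N))
    nsq (\sum_x rC (chi x) * root_cis R q ^+ gdot v x) = (q ^ d)%:R * \sum_x chi x ^+ 2.
Proof.
move=> q0 pq qm; set z := root_cis R q.
have Ez (v : {ffun 'I_d -> 'I_m}) (x y : {ffun 'I_d -> 'I_p}) :
    z ^+ gdot v x * conjc (z ^+ gdot v y) = \prod_l (z ^+ x l * conjc z ^+ y l) ^+ v l.
  rewrite conjcX /gdot -!prodrXr -big_split; apply: eq_bigr => l _ /=.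
  by rewrite exprMn -!exprM !(mulnC (v l)).
have E (v : {ffun 'I_d -> 'I_m}) : nsq (\sum_x rC (chi x) * z ^+ gdot v x) =
  complex.Re (\sum_x \sum_y rC (chi x * chi y) * \prod_l (z ^+ x l * conjc z ^+ y l) ^+ v l).
  rewrite nsqE conjc_sum big_distrlr; congr complex.Re.
  apply: eq_bigr => x _; apply: eq_bigr => y _ /=.
  by rewrite -Ez conjcM conjc_real rmorphM; ring.
under eq_bigr => v _ do rewrite E.
rewrite -Re_sum exchange_big.
have orth (x y : {ffun 'I_d -> 'I_p}) :
  \sum_(v : {ffun 'I_d -> 'I_m} | v \in ffun_on (fun k : 'I_m => (k < q)%N))
     rC (chi x * chi y) * \prod_l (z ^+ x l * conjc z ^+ y l) ^+ v l =
  rC (chi x * chi y * ((q ^ d)%:R * (x == y)%:R)).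
  rewrite -mulr_sumr [in RHS]rmorphM; congr (_ * _).
  rewrite -(bigA_distr_big (fun k : 'I_m => (k < q)%N)
    (fun l (k : 'I_m) => (z ^+ x l * conjc z ^+ y l) ^+ k)).
  have -> : \prod_l \sum_(k < m | (k < q)%N) (z ^+ x l * conjc z ^+ y l) ^+ k =
     \prod_l (q * (x l == y l))%:R.
    apply: eq_bigr => l _; rewrite -(big_ord_widen _ (fun k => (z ^+ x l * conjc z ^+ y l) ^+ k) qm).
    by rewrite root_cis_ortho ?(leq_trans (ltn_ord _) pq).
  rewrite -natr_prod big_split /= prod_nat_const card_ord.
  have -> : (\prod_l (x l == y l) = (x == y))%N.
    case: eqVneq => [->|xy]; first by rewrite big1 // => l _; rewrite eqxx.
    have [l xl] : exists l, x l != y l.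
      apply: contrapT => /forallNP h; move/eqP: xy; apply; apply/ffunP => l.
      by apply/eqP; move: (h l) => /negP; rewrite negbK.
    by rewrite (bigD1 l) //= (negbTE xl) mul0n.
  by rewrite natrM -[(q ^ d)%:R in LHS](rmorph_nat rC) -[_%:R in X in _ * X = _](rmorph_nat rC) -rmorphM.
have -> : \sum_x \sum_(v : {ffun 'I_d -> 'I_m} | v \in ffun_on (fun k : 'I_m => (k < q)%N))
   \sum_y rC (chi x * chi y) * \prod_l (z ^+ x l * conjc z ^+ y l) ^+ v l
   = rC ((q ^ d)%:R * \sum_x chi x ^+ 2).
  rewrite mulr_sumr rmorph_sum; apply: eq_bigr => x _.
  rewrite exchange_big (eq_bigr _ (fun y _ => orth x y)) (bigD1 x) //= big1 ?addr0.
    by rewrite eqxx mulr1; congr rC; ring.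
  by move=> y yx; rewrite eq_sym (negbTE yx) !mulr0.
by [].
Qed.

(** Abel summation for one exponential, which becomes linear in the indicators
    of [n <= s]. *)
Lemma abel_power (V : comNzRingType) (z : V) M n : (n <= M)%N ->
  z ^+ n = z ^+ M + (1 - z) * \sum_(s < M | (n <= s)%N) z ^+ s.
Proof.
move=> nM.
have : \sum_(s < M) z ^+ s = \sum_(s < n) z ^+ s + \sum_(s < M | (n <= s)%N) z ^+ s.
  rewrite (bigID (fun s : 'I_M => (s < n)%N)) /= -(big_ord_widen _ (fun s => z ^+ s) nM).
  by congr (_ + _); apply: eq_bigl => s; rewrite -leqNgt.
move/(congr1 (fun x => (1 - z) * x)); rewrite mulrDr !geometric_sum.
set X := (1 - z) * _ => h.
have -> : X = (1 - z ^+ M) - (1 - z ^+ n) by rewrite h addrAC subrr add0r.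
ring.
Qed.

(** Alexander's lower bound for the discrepancy of halfspaces. The exponential
    sums with frequencies [v / q], for [p <= q < 2 p] and [v] modulo [q], are
    bounded below on average by [parseval] and above, for each [v], by the large
    sieve in [q]. *)
Lemma grid_discrepancy (chi : {ffun 'I_d -> 'I_p} -> R) (D : R) :
  (0 < d)%N -> (0 < p)%N ->
  (forall (v : {ffun 'I_d -> 'I_(2 * p)}) s,
     `|\sum_(x | (gdot v x <= s)%N) chi x| <= D) ->
  \sum_x chi x ^+ 2 <= ((2 ^ d) * (2 + 2 * (96 * d) ^ 2))%:R * p%:R * D ^+ 2.
Proof.
move=> d0 p0 hD; pose M := (2 * d * p ^ 2)%N.
have pM : (p ^ 2 <= M)%N by rewrite /M leq_pmull // muln_gt0 d0.
have rp : 0 < p%:R :> R by rewrite ltr0n.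
have D2 : 0 <= D ^+ 2 by exact: sqr_ge0.
have gM (v : {ffun 'I_d -> 'I_(2 * p)}) x : (gdot v x < M)%N.
  apply: (@leq_ltn_trans (\sum_(l < d) (2 * p * p).-1)%N).
    apply: leq_sum => l _; have := ltn_ord (v l); have := ltn_ord (x l).
    by move: (v l : nat) (x l : nat) => a b; nia.
  rewrite sum_nat_const card_ord /M expnS expn1; nia.
have sqD (v : {ffun 'I_d -> 'I_(2 * p)}) s : (\sum_(x | (gdot v x <= s)%N) chi x) ^+ 2 <= D ^+ 2.
  by rewrite -real_normK ?num_real // lerXn2r ?nnegrE // (le_trans _ (hD v s)).
pose Y (v : {ffun 'I_d -> 'I_(2 * p)}) q := nsq (\sum_x rC (chi x) * root_cis R q ^+ gdot v x).
have Y0 v q : 0 <= Y v q by exact: nsq_ge0.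
have upper v : \sum_(i < p) Y v (p + i)%N <= (2 + 2 * (96 * d) ^ 2)%:R * p%:R ^+ 2 * D ^+ 2.
  pose G (s : 'I_M) := \sum_(x | (gdot v x <= s)%N) chi x.
  have YE q : Y v q <= 2 * D ^+ 2 + 2 * nsq (1 - root_cis R q) * nsq (\sum_s rC (G s) * root_cis R q ^+ s).
    rewrite /Y; set z := root_cis R q.
    have -> : \sum_x rC (chi x) * z ^+ gdot v x =
       rC (\sum_(x | (gdot v x <= M)%N) chi x) * z ^+ M + (1 - z) * \sum_s rC (G s) * z ^+ s.
      rewrite (eq_bigr _ (fun x _ => congr1 _ (abel_power z (ltnW (gM v x))))).
      have -> : \sum_(x | (gdot v x <= M)%N) chi x = \sum_x chi x.
        by apply: eq_bigl => x; rewrite ltnW.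
      rewrite rmorph_sum mulr_suml.
      under eq_bigr => x _ do rewrite mulrDr mulrCA.
      rewrite big_split /=; congr (_ + _); rewrite -mulr_sumr; congr (_ * _).
      under [LHS]eq_bigr => x _ do rewrite mulr_sumr big_mkcond /=.
      rewrite exchange_big; apply: eq_bigr => s _ /=.
      by rewrite /G rmorph_sum mulr_suml [RHS]big_mkcond.
    apply: le_trans (nsqD_le _ _) _; rewrite !nsqM nsqX nsq_cis expr1n mulr1 nsq_rC -!mulrA.
    by rewrite lerD2r ler_pM2l // sqD.
  apply: le_trans (_ : \sum_(i < p) (2 * D ^+ 2 + 2 * nsq (1 - root_cis R (p + i)) *
    nsq (\sum_s rC (G s) * root_cis R (p + i) ^+ s)) <= _).
    by apply: ler_sum => i _; apply: YE.
  rewrite big_split /= sumr_const card_ord -[_ *+ p]mulr_natl.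
  have h1 : \sum_(i < p) 2 * nsq (1 - root_cis R (p + i)) * nsq (\sum_s rC (G s) * root_cis R (p + i) ^+ s) <=
     128 / p%:R ^+ 2 * \sum_(i < p) nsq (\sum_s rC (G s) * root_cis R (p + i) ^+ s).
    rewrite mulr_sumr; apply: ler_sum => i _; rewrite ler_wpM2r ?nsq_ge0 //.
    have pi0 : (0 < p + i)%N by rewrite addn_gt0 p0.
    apply: le_trans (_ : 2 * (64 / (p + i)%:R ^+ 2) <= _); first by rewrite ler_pM2l // nsq_1Broot.
    rewrite mulrA -natrM ler_pM2l // lef_pV2 ?posrE ?exprn_gt0 ?ltr0n //.
    by rewrite lerXn2r ?nnegrE // ler_nat leq_addr.
  have h2 := large_sieve p0 pM G.
  have h3 : \sum_s G s ^+ 2 <= M%:R * D ^+ 2.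
    apply: le_trans (_ : \sum_(s < M) D ^+ 2 <= _).
      by apply: ler_sum => s _; apply: sqD.
    by rewrite sumr_const card_ord mulr_natl.
  have c0 : 0 <= 128 / p%:R ^+ 2 :> R by rewrite divr_ge0 ?exprn_ge0.
  apply: le_trans (lerD (lexx _) (le_trans h1 (ler_wpM2l c0 (le_trans h2 (ler_wpM2l (ler0n _ _) h3))))) _.
  have -> : 128 / p%:R ^+ 2 * ((36 * M)%:R * (M%:R * D ^+ 2)) = (2 * (96 * d) ^ 2)%:R * p%:R ^+ 2 * D ^+ 2.
    rewrite /M !natrM ?natrX; field; exact: lt0r_neq0.
  have : p%:R <= p%:R ^+ 2 :> R by rewrite -natrX ler_nat expnS expn1 leq_pmull.
  rewrite [(2 + _)%:R]natrD; move: ((2 * (96 * d) ^ 2)%:R : R) => X h4.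
  by have := ler_wpM2r D2 h4; lra.
have lower : p%:R * (p ^ d)%:R * \sum_x chi x ^+ 2 <= \sum_v \sum_(i < p) Y v (p + i)%N.
  have -> (x : R) : p%:R * (p ^ d)%:R * x = \sum_(i < p) (p ^ d)%:R * x.
    by rewrite sumr_const card_ord -[RHS]mulr_natl mulrA.
  rewrite exchange_big; apply: ler_sum => i _ /=.
  apply: le_trans (_ : ((p + i) ^ d)%:R * \sum_x chi x ^+ 2 <= _).
    rewrite ler_wpM2r ?sumr_ge0 // => [x _|]; first exact: sqr_ge0.
    by rewrite ler_nat leq_exp2r // leq_addr.
  have pi0 : (0 < p + i)%N by rewrite addn_gt0 p0.
  have pi2 : (p + i <= 2 * p)%N by have := ltn_ord i; lia.
  rewrite -(parseval chi pi0 (leq_addr _ _) pi2) [X in _ <= X](bigID (fun v : {ffun 'I_d -> 'I_(2 * p)} => v \in ffun_on (fun k : 'I_(2 * p) => (k < p + i)%N))) /=.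
  by rewrite lerDl sumr_ge0 // => v _; apply: Y0.
have : p%:R * (p ^ d)%:R * \sum_x chi x ^+ 2 <= ((2 * p) ^ d)%:R * ((2 + 2 * (96 * d) ^ 2)%:R * p%:R ^+ 2 * D ^+ 2).
  apply: le_trans lower _; apply: le_trans (_ : \sum_(v : {ffun 'I_d -> 'I_(2 * p)}) ((2 + 2 * (96 * d) ^ 2)%:R * p%:R ^+ 2 * D ^+ 2) <= _).
    by apply: ler_sum => v _; apply: upper.
  by rewrite sumr_const card_ffun !card_ord -[X in X <= _]mulr_natl.
have pd : 0 < p%:R * (p ^ d)%:R :> R by rewrite mulr_gt0 // ltr0n expn_gt0 p0.
move=> h; rewrite -(ler_pM2l pd); apply: le_trans h _; rewrite le_eqVlt; apply/orP; left; apply/eqP.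
by rewrite expnMn !natrM; ring.
Qed.

End Grid.

(** * Grids have no balanced partition *)

Lemma points_setII (T : Type) N (pt : 'I_N -> T) : injective pt ->
  ([set x | exists i, pt i = x]%classic #= `I_N)%card.
Proof.
move=> ipt; case: (posnP N) => [N0|N0].
  have -> : [set x | exists i, pt i = x]%classic = set0.
    by rewrite -subset0 => x [i _]; have := leq_ltn_trans (leq0n i) (ltn_ord i); rewrite N0.
  by rewrite N0 II0 card_eq0.
pose g n := pt (insubd (Ordinal N0) n).
have -> : [set x | exists i, pt i = x]%classic = (g @` `I_N)%classic.
  rewrite eqEsubset; split=> [x [i <-]|x [n nN <-]]; last by exists (insubd (Ordinal N0) n).
  by exists i; [exact: ltn_ord|rewrite /g valKd].
apply: inj_card_eq => m n; rewrite !inE /= => mN nN /ipt /(congr1 val).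
by rewrite !val_insubd mN nN.
Qed.

Lemma card_le_points (T : Type) N (pt : 'I_N -> T) (J : {set 'I_N}) t : (#|J| <= t)%N ->
  ([set x | exists2 i, i \in J & pt i = x]%classic #<= `I_t)%card.
Proof.
move=> Jt; case: (posnP #|J|) => [/eqP|J0].
  rewrite cards_eq0 => /eqP ->; rewrite (_ : [set x | _]%classic = set0) ?card_ge0 //.
  by rewrite -subset0 => x [j]; rewrite inE.
have [i0 i0J] : exists i, i \in J by apply/card_gt0P.
apply: (@card_le_trans _ _ _ `I_(#|J|)); last by rewrite card_le_II.
pose g n := pt (nth i0 (enum J) n).
apply: card_le_trans (card_image_le g `I_(#|J|)).
apply: subset_card_le => x [i iJ <-]; exists (index i (enum J)).
  by rewrite /= cardE index_mem mem_enum.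
by rewrite /g nth_index // mem_enum.
Qed.

Section LowerBound.
Variables (R : realType) (d p N r t : nat) (e : 'I_N -> {ffun 'I_d -> 'I_p}).
Hypothesis e_inj : injective e.

Definition grid_point (x : {ffun 'I_d -> 'I_p}) : 'rV[R]_d := \row_l (x l)%:R.

Lemma grid_point_inj : injective grid_point.
Proof.
move=> x y h; apply/ffunP => l; apply: val_inj; apply/eqP; rewrite -(eqr_nat R).
by apply/eqP; have := congr1 (fun v : 'rV_d => v 0 l) h; rewrite !mxE.
Qed.

Let pt i := grid_point (e i).

Lemma pt_inj : injective pt.
Proof. by move=> i j /grid_point_inj /e_inj. Qed.

Lemma dotv_grid (v : {ffun 'I_d -> 'I_(2 * p)}) i :
  dotv (\row_l (v l)%:R) (pt i) = (gdot v (e i))%:R :> R.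
Proof.
by rewrite /dotv natr_sum; apply: eq_bigr => l _; rewrite !mxE natrM.
Qed.

Lemma conv_hull_halfspace (A : set 'rV[R]_d) v (P : R -> Prop) z :
  (forall a b s, 0 <= s -> s <= 1 -> P a -> P b -> P (s * a + (1 - s) * b)) ->
  (forall x, A x -> P (dotv v x)) -> conv_hull A z -> P (dotv v z).
Proof.
move=> hP AP hz; have := hz [set x | P (dotv v x)]%classic; apply.
by split; first exact: convex_halfspace.
Qed.

Variable f : 'I_N -> 'I_r.
Hypothesis survive : forall J : {set 'I_N}, (#|J| <= t)%N ->
  exists z, forall j, conv_hull [set x | exists i, [/\ f i = j, i \notin J & pt i = x]]%classic z.

(** Otherwise a whole part can be removed. *)
Lemma large_class j : (t < #|[set i | f i == j]|)%N.
Proof.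
rewrite ltnNge; apply/negP => /survive [z /(_ j)] hz.
have /= := hz set0; apply; split; first by move=> x y k; rewrite inE.
by move=> x [i [fi]]; rewrite inE fi eqxx.
Qed.

Definition below v s := [set i | (gdot (v : {ffun 'I_d -> 'I_(2 * p)}) (e i) <= s)%N].

(** Otherwise these points can be removed, and the hyperplane separates what
    remains of the two parts. *)
Lemma large_separator j k v s : j != k ->
  (t < #|[set i in below v s | f i == j]| + #|[set i in ~: below v s | f i == k]|)%N.
Proof.
move=> jk; rewrite ltnNge; apply/negP => h.
have [|z hz] := @survive ([set i in below v s | f i == j] :|: [set i in ~: below v s | f i == k]).
  by apply: leq_trans h; rewrite cardsU leq_subr.
pose w : 'rV[R]_d := \row_l (v l)%:R.
have h1 : s%:R < dotv w z.
  apply: (conv_hull_halfspace (P := fun a => s%:R < a) _ _ (hz j)) => [a b u u0 u1 ha hb|x [i [fi iJ <-]]].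
    move: ha hb; move: (s%:R : R) => y ha hb.
    case: (eqVneq u 0) => [->|un0]; first by rewrite mul0r add0r subr0 mul1r.
    have up : 0 < u by rewrite lt0r un0.
    have v0 : 0 <= 1 - u by rewrite subr_ge0.
    have hya : u * y < u * a by rewrite ltr_pM2l.
    by have := ler_wpM2l v0 (ltW hb); lra.
  rewrite dotv_grid ltr_nat ltnNge; apply: contra iJ => hs.
  by rewrite !inE fi eqxx hs.
have h2 : dotv w z <= s%:R.
  apply: (conv_hull_halfspace (P := fun a => a <= s%:R) _ _ (hz k)) => [a b u u0 u1 ha hb|x [i [fi iJ <-]]].
    have v1 : 0 <= 1 - u by rewrite subr_ge0.
    by have := ler_wpM2l u0 ha; have := ler_wpM2l v1 hb; lra.
  rewrite dotv_grid ler_nat leqNgt; apply: contra iJ => hs.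
  by rewrite !inE fi eqxx -ltnNge hs orbT.
by move: h1; rewrite ltNge h2.
Qed.

Lemma sum_classes (S : {set 'I_N}) : (\sum_j #|[set i in S | f i == j]| = #|S|)%N.
Proof.
rewrite -sum1_card (partition_big f xpredT) //=; apply: eq_bigr => j _.
by rewrite sum1dep_card; apply: eq_card => i; rewrite !inE.
Qed.

Lemma class_le k : (#|[set i | f i == k]| + r.-1 * t <= N)%N.
Proof.
rewrite -[X in (_ <= X)%N](card_ord N) -cardsT -(sum_classes [set: 'I_N]).
rewrite (bigD1 k) //=; apply: leq_add.
  by apply: subset_leq_card; apply/fintype.subsetP => i; rewrite !inE.
have -> : (r.-1 * t = \sum_(j < r | j != k) t)%N.
  by rewrite sum_nat_const cardC1 card_ord.
apply: leq_sum => j _; apply: leq_trans (ltnW (large_class j)) _.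
by apply: subset_leq_card; apply/fintype.subsetP => i; rewrite !inE.
Qed.

(** More than [t] points lie in part [j] inside the halfspace or in part [k]
    outside it, and part [k] has at most [N - (r - 1) t] points because every
    other part has more than [t]. *)
Lemma class_diff j k v s : (#|[set i in below v s | f i == k]| + r * t <=
  #|[set i in below v s | f i == j]| + N)%N.
Proof.
have r0 : (0 < r)%N by case: (r) j => // -[].
have rt : (r * t = t + r.-1 * t)%N by rewrite -mulSn prednK.
case: (eqVneq j k) => [->|jk].
  rewrite leq_add2l rt; apply: leq_trans (class_le k); rewrite leq_add2r.
  exact: ltnW (large_class k).
have h1 := large_separator v s jk; have h2 := class_le k.
have h3 : (#|[set i | f i == k]| = #|[set i in below v s | f i == k]| + #|[set i in ~: below v s | f i == k]|)%N.
  rewrite -(cardsID (below v s) [set i | f i == k]); congr (_ + _)%N;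
    by apply: eq_card => i; rewrite !inE andbC.
by move: h1 h2 h3; rewrite rt; lia.
Qed.

Hypothesis r2 : (2 <= r)%N.

(** The weight [r - 1] on one part and [-1] on the others has absolute value at
    least [1] on all points, and its halfspace sums are sums of [r] differences
    between two parts. *)
Lemma discrepancy_excess : (0 < d)%N -> (0 < p)%N ->
  N%:R <= ((2 ^ d) * (2 + 2 * (96 * d) ^ 2))%:R * p%:R * (r%:R * (N%:R - (r * t)%:R)) ^+ 2 :> R.
Proof.
move=> d0 p0; have r0 : (0 < r)%N by apply: ltnW.
pose j0 : 'I_r := Ordinal r0.
pose g i : R := r%:R * (f i == j0)%:R - 1.
(* The weights are extended by zero to the whole grid. *)
pose chi x := if [pick i | e i == x] is Some i then g i else 0.
have pickE i : [pick i' | e i' == e i] = Some i.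
  by case: pickP => [i' /eqP /e_inj -> //|/(_ i)]; rewrite eqxx.
have sumE (Q : pred {ffun 'I_d -> 'I_p}) (h : R -> R) : h 0 = 0 ->
    \sum_(x | Q x) h (chi x) = \sum_(i | Q (e i)) h (g i).
  move=> h0; rewrite (bigID (fun x => [pick i | e i == x] != None)) /= [X in _ + X]big1 ?addr0; last first.
    by move=> x /andP[_]; rewrite negbK /chi => /eqP ->.
  rewrite (reindex_omap e (fun x => [pick i | e i == x])); last first.
    by move=> x /andP[_]; case: pickP => [i /eqP <-|].
  by apply: eq_big => [i|i _]; rewrite /chi pickE ?eqxx ?andbT.
have h1 : N%:R <= \sum_x chi x ^+ 2.
  rewrite (sumE xpredT (fun a => a ^+ 2)) ?expr0n // -[N in N%:R]card_ord -sumr_const.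
  apply: ler_sum => i _; rewrite /g; have : 2 <= r%:R :> R by rewrite ler_nat.
  by case: (f i == j0) => /=; rewrite ?mulr1 ?mulr0 ?sub0r ?sqrrN ?expr1n //; move: (r%:R : R) => y y2; nra.
have h2 (v : {ffun 'I_d -> 'I_(2 * p)}) s : `|\sum_(x | (gdot v x <= s)%N) chi x| <= r%:R * (N%:R - (r * t)%:R).
  pose a k : R := #|[set i in below v s | f i == k]|%:R.
  have aE k : \sum_(i | (gdot v (e i) <= s)%N) (f i == k)%:R = a k.
    rewrite /a -sum1_card natr_sum big_mkcond [RHS]big_mkcond; apply: eq_bigr => i _.
    by rewrite !inE; case: (_ <= s)%N => //=; case: (f i == k).
  have -> : \sum_(x | (gdot v x <= s)%N) chi x = \sum_k (a j0 - a k).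
    rewrite (sumE (fun x => (gdot v x <= s)%N) (fun y => y)) //.
    rewrite [RHS]sumrB sumr_const card_ord -[a j0 *+ r]mulr_natl -aE mulr_sumr /g sumrB.
    have -> : \sum_k a k = \sum_k \sum_(i | (gdot v (e i) <= s)%N) (f i == k)%:R.
      by apply: eq_bigr => k _; rewrite aE.
    rewrite [X in _ = _ - X]exchange_big; congr (_ - _); apply: eq_bigr => i _.
    by rewrite (bigD1 (f i)) //= eqxx big1 ?addr0 // => k; rewrite eq_sym => /negbTE ->.
  apply: le_trans (ler_norm_sum _ _ _) _.
  have -> (x : R) : r%:R * x = \sum_(k < r) x by rewrite sumr_const card_ord mulr_natl.
  apply: ler_sum => k _.
  have := class_diff j0 k v s; have := class_diff k j0 v s.
  rewrite -!(ler_nat R) !natrD -/(a j0) -/(a k) => h3 h4; rewrite ler_norml.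
  by apply/andP; split; lra.
exact: le_trans h1 (grid_discrepancy d0 p0 h2).
Qed.

End LowerBound.

(** * The Tverberg numbers *)

Lemma disc_exponent_root (R : realType) (d : nat) : (0 < d)%N ->
  1 / d%:R + 2 * disc_exponent R d = 1.
Proof.
move=> d0; have : 0 < d%:R :> R by rewrite ltr0n.
by rewrite /disc_exponent => h; field; apply: lt0r_neq0.
Qed.

Lemma grid_side (R : realType) (d N : nat) : (0 < d)%N -> (0 < N)%N ->
  exists p, [/\ (0 < p)%N, (N <= p ^ d)%N & p%:R <= 2 * N%:R `^ (1 / d%:R) :> R].
Proof.
move=> d0 N0; have ex : exists p, (N <= p ^ d)%N.
  by exists N; rewrite -{1}(expn1 N) leq_pexp2l.
case: (ex_minnP ex) => p pN pmin.
have p0 : (0 < p)%N.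
  by rewrite lt0n; apply/eqP => p0; move: pN; rewrite p0 exp0n // leqn0 => /eqP N'; rewrite N' in N0.
exists p; split=> //.
have rd : 0 < d%:R :> R by rewrite ltr0n.
have i0 : 0 <= 1 / d%:R :> R by rewrite divr_ge0.
have h1 : 1 <= N%:R `^ (1 / d%:R) :> R.
  have e1 : 1 `^ (1 / d%:R) = 1 :> R by rewrite powR1.
  by rewrite -[X in X <= _]e1 ge0_ler_powR ?nnegrE // ler1n.
have h2 : p.-1%:R <= N%:R `^ (1 / d%:R) :> R.
  have lt : (p.-1 ^ d <= N)%N.
    by rewrite leqNgt; apply/negP => /ltnW /pmin; rewrite -{1}(prednK p0) ltnn.
  have -> : p.-1%:R = ((p.-1 ^ d)%:R : R) `^ (1 / d%:R).
    by rewrite natrX -powR_mulrn // -powRrM mulrC divfK ?lt0r_neq0 // powRr1.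
  by rewrite ge0_ler_powR ?nnegrE // ler_nat.
by rewrite -(prednK p0) -natr1; lra.
Qed.

Lemma tolerant_Tverberg_lower (R : realType) (d r : nat) : (2 <= d)%N -> (2 <= r)%N ->
  exists2 c : R, 0 < c & forall t N : nat, (0 < N)%N ->
    tolerant_Tverberg_number R t d r N ->
    (r * t)%:R + c * t%:R `^ disc_exponent R d <= N%:R.
Proof.
move=> d2 r2; have d0 : (0 < d)%N by apply: ltnW.
set al := disc_exponent R d.
have al0 : 0 < al := disc_exponent_gt0 R d2.
have [C1 C11 C1E] : exists2 C1 : R, 1 <= C1 & ((2 ^ d) * (2 + 2 * (96 * d) ^ 2))%:R = C1.
  by eexists; last reflexivity; rewrite ler1n muln_gt0 expn_gt0.
have rr : 0 < r%:R :> R by rewrite ltr0n ltnW.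
pose c : R := (r%:R * (2 * C1))^-1.
have c0 : 0 < c by rewrite invr_gt0 mulr_gt0 // mulr_gt0 //; lra.
exists c => // t N N0 hN.
have [p [p0 Np hp]] := grid_side R d0 N0.
pose e (i : 'I_N) : {ffun 'I_d -> 'I_p} := enum_val (cast_ord (esym (card_ffun _ _)) (cast_ord (esym (congr2 expn (card_ord p) (card_ord d))) (widen_ord Np i))).
have e_inj : injective e by move=> i j /enum_val_inj /cast_ord_inj /cast_ord_inj /(congr1 val) /= h; apply: val_inj.
pose pt (i : 'I_N) := @grid_point R d p (e i).
have ipt : injective pt := @pt_inj R d p N e e_inj.
have [F [[Fcov Ftriv Fne] hF]] := hN _ (points_setII ipt).
have /choice [f hf] : forall i, exists j, F j (pt i).
  move=> i; have : [set x | exists i, pt i = x]%classic (pt i) by exists i.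
  by rewrite -Fcov => -[j _ Fj]; exists j.
have surv (J : {set 'I_N}) : (#|J| <= t)%N -> exists z, forall j,
    conv_hull [set x | exists i, [/\ f i = j, i \notin J & pt i = x]]%classic z.
  move=> Jt; have [|z hz] := hF _ _ (card_le_points pt Jt).
    by move=> x [i _ <-]; exists i.
  exists z => j; apply: conv_hull_sub (hz j I) => x [Fx nJ].
  have : [set x | exists i, pt i = x]%classic x by rewrite -Fcov; exists j.
  case=> i ix; exists i; split=> //; last by apply/negP => iJ; apply: nJ; exists i.
  by apply: (Ftriv (f i) j) => //; exists x; split=> //; rewrite -ix.
have hm := discrepancy_excess e_inj surv r2 d0 p0; rewrite C1E in hm.
have rtN : (r * t <= N)%N.
  have r0 : (0 < r)%N by apply: ltnW.
  have := class_le surv (Ordinal r0); have := large_class surv (Ordinal r0).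
  have rt : (r * t = t + r.-1 * t)%N by rewrite -mulSn prednK.
  by move=> h1 h2; rewrite rt; apply: leq_trans h2; rewrite leq_add2r ltnW.
have m0 : 0 <= N%:R - (r * t)%:R :> R by rewrite subr_ge0 ler_nat.
rewrite addrC -lerBrDr; set m : R := N%:R - (r * t)%:R in m0 hm *.
have tN : (t <= N)%N by apply: leq_trans rtN; rewrite leq_pmull // ltnW.
set x : R := N%:R `^ (1 / d%:R) in hp.
have x0 : 0 < x by rewrite powR_gt0 // ltr0n.
have NE : N%:R = x * (N%:R `^ al) ^+ 2 :> R.
  rewrite /x -powR_mulrn ?powR_ge0 // -powRrM -powRD; last first.
    by rewrite (gt_eqF (_ : (0 : R) < N%:R)) ?implybT // ltr0n.
  by rewrite (mulrC al) disc_exponent_root // powRr1.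
have y0 : 0 <= N%:R `^ al :> R by exact: powR_ge0.
have ty : t%:R `^ al <= N%:R `^ al :> R.
  by rewrite ge0_ler_powR ?nnegrE ?(ltW al0) // ler_nat.
have h1 : (N%:R `^ al) ^+ 2 <= 2 * C1 * (r%:R * m) ^+ 2.
  have s0 : 0 <= C1 * (r%:R * m) ^+ 2 by rewrite mulr_ge0 ?sqr_ge0 //; lra.
  rewrite -(ler_pM2l x0) -NE; apply: le_trans hm _.
  rewrite mulrAC (_ : x * _ = C1 * (r%:R * m) ^+ 2 * (2 * x)).
    exact: ler_wpM2l.
  by ring.
apply: le_trans (_ : c * N%:R `^ al <= _); first by rewrite ler_pM2l.
rewrite -(@ler_pXn2r _ 2) ?nnegrE ?mulr_ge0 ?(ltW c0) // exprMn.
apply: le_trans (ler_wpM2l (sqr_ge0 c) h1) _.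
have -> : c ^+ 2 * (2 * C1 * (r%:R * m) ^+ 2) = m ^+ 2 / (2 * C1).
  by rewrite /c; field; apply/andP; split; apply: lt0r_neq0 => //; lra.
rewrite ler_pdivrMr; last by lra.
have := sqr_ge0 m; nra.
Qed.

(** The default value of [Npt] does not occur as soon as some size works. *)
Lemma Npt_spec (R : realType) (t d r N : nat) : (0 < N)%N ->
  tolerant_Tverberg_number R t d r N ->
  [/\ (0 < Npt R t d r)%N, tolerant_Tverberg_number R t d r (Npt R t d r) &
      (Npt R t d r <= N)%N].
Proof.
move=> N0 hN; have ex : exists n, (0 < n)%N && `[< tolerant_Tverberg_number R t d r n >].
  by exists N; rewrite N0; apply/asboolP.
case: (ex_minnP ex) => n /andP[n0 /asboolP hn] nmin.
have [|h1 h2 h3] := @xgetPex _ 0%N [set N : nat | [/\ (0 < N)%N, tolerant_Tverberg_number R t d r N &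
    forall M : nat, (0 < M)%N -> tolerant_Tverberg_number R t d r M ->
      (N <= M)%N]]%classic.
  exists n; split=> // M M0 hM; apply: nmin; rewrite M0; exact/asboolP.
by split=> //; apply: h3.
Qed.

Unset Implicit Arguments.

Theorem theorem1 (R : realType) (d r : nat) (hd : (2 <= d)%N) (hr : (2 <= r)%N) :
  exists c C : R, [/\ 0 < c, 0 < C &
    forall t : nat, (0 < t)%N ->
      (r * t)%:R + c * t%:R `^ (1 / 2 - 1 / (2 * d%:R)) <= (Npt R t d r)%:R
      /\ (Npt R t d r)%:R <= (r * t)%:R + C * t%:R `^ (1 / 2 - 1 / (2 * d%:R))].
Proof.
have [c c0 hc] := tolerant_Tverberg_lower R hd hr.
have [C0 C00 hC] := tolerant_Tverberg_upper R hd (ltnW hr).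
(* [L] solves [r + K + 1 <= L ^ 2]: then [N <= L ^ 2 t], and the error [C0
   (N ^ al + 1)] is at most [K t ^ al]. *)
pose L : R := r%:R + 1 + 2 * C0; pose K := C0 * (L + 1).
have r0 : 0 <= r%:R :> R by [].
have L1 : 1 <= L by rewrite /L; lra.
have K0 : 0 < K by rewrite mulr_gt0 //; lra.
exists c, (K + 1); split=> //; first by rewrite addr_gt0.
move=> t t0; rewrite -/(disc_exponent R d); set al := disc_exponent R d.
have al0 : 0 < al := disc_exponent_gt0 R hd.
have alh : al <= 1 / 2 := disc_exponent_le_half R d.
have t1 : 1 <= t%:R :> R by rewrite ler1n.
set y : R := t%:R `^ al.
have y1 : 1 <= y.
  have e1 : 1 `^ al = 1 :> R by rewrite powR1.
  by rewrite -[X in X <= _]e1 ge0_ler_powR ?nnegrE ?(ltW al0).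
have yt : y <= t%:R by apply: ler1_powR => //; lra.
pose m := (Num.truncn (K * y)).+1.
have Ky0 : 0 <= K * y by rewrite mulr_ge0 ?(ltW K0) //; lra.
have [m1 m2] : m%:R <= K * y + 1 /\ K * y < m%:R.
  have /andP[h1 h2] := truncn_itv Ky0; split; last exact: h2.
  by rewrite /m -natr1 lerD2r.
pose N := (r * t + m)%N.
have hN : tolerant_Tverberg_number R t d r N.
  apply: hC; rewrite [in ltRHS]natrD ltrD2l; apply: le_lt_trans m2.
  rewrite /K -mulrA ler_pM2l //.
  have NL : N%:R `^ al <= L * y.
    have hL : N%:R <= L ^+ 2 * t%:R.
      rewrite natrD natrM; have : K * y + 1 <= (K + 1) * t%:R.
        rewrite mulrDl mul1r lerD // ler_pM2l //.
      have : r%:R + K + 1 <= L ^+ 2 by rewrite /K expr2 {2}/L; nra.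
      nra.
    apply: le_trans (_ : (L ^+ 2 * t%:R) `^ al <= _).
      by rewrite ge0_ler_powR ?nnegrE ?(ltW al0) ?mulr_ge0 ?exprn_ge0 //; lra.
    have L0 : 0 <= L by lra.
    rewrite powRM ?exprn_ge0 // -/y ler_wpM2r //; first by lra.
    rewrite -powR_mulrn // -powRrM -[X in _ <= X]powRr1 //.
    by apply: ler_powR => //; lra.
  lra.
have N0 : (0 < N)%N by rewrite /N addnS.
have [h1 h2 h3] := Npt_spec N0 hN; split; first exact: hc.
apply: le_trans (_ : N%:R <= _); first by rewrite ler_nat.
rewrite natrD lerD2l; lra.
Qed.
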